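(* Let $K_0$ and $K_r$ be regular constant distance, complete, convex, connected, $C^2$ surfaces in $\mathbb{R}^3$ at a distance $r>0$. The projection from $K_r$ to $K_0$ preserves geodesics if and only if both surfaces are spheres or both surfaces are (infinite) round cylinders.
   Context: A convex surface here means the boundary of a convex body in $\mathbb{R}^3$ (bodies are not required to be bounded). For closed surfaces $S_1,S_2$ in $\mathbb{R}^3$, the projection $\Pi:S_1\to S_2$ sends $x\in S_1$ to the set of points $y\in S_2$ that minimize the Euclidean distance $d(x,y)$. Two surfaces $S_1,S_2$ are called regular constant distance surfaces (at distance $r$) if the Euclidean distance from any point $x\in S_1$ to $S_2$ equals $r$ (fixed), and the nearest point on $S_2$ is always unique (so that $\Pi$ is a point-valued map). In the claim, $S_1=K_r$ and $S_2=K_0$, where $K_r$ lies outside the convex body bounded by $K_0$. Any non-singular reparametrization (i.e. with non-zero, possibly variable, speed) of a unit speed geodesic is also called a geodesic. A map between surfaces preserves geodesics if it sends every geodesic of the first surface to a (possibly reparametrized) geodesic of the second. A (generalized) cylinder $C$ is a set of points such that for every point $p\in C$ there is a unique line $\ell(p)$ in $C$ through $p$, and any two such lines are either the same or parallel. A round cylinder is a cylinder that is rotationally symmetric around its axis; in particular its principal curvatures are constant.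
   Formalization: The formal theorem additionally assumes that K_0 is not a plane: for two parallel planes all the stated hypotheses hold and the projection preserves geodesics, yet they are neither spheres nor round cylinders. *)

(* Defs.v *)
(* Points of R^3 are row vectors 'rV[R]_3 over a realType R. *)
From HB Require Import structures.
From mathcomp Require Import all_boot all_order all_algebra.
From mathcomp Require Import all_classical all_reals all_analysis.

Set Implicit Arguments.
Unset Strict Implicit.
Unset Printing Implicit Defensive.

Import Order.TTheory GRing.Theory Num.Theory.
Import numFieldNormedType.Exports.

Local Open Scope classical_set_scope.
Local Open Scope ring_scope.

(* The library norm `|x| on 'rV[R]_3 is the sup norm: it induces the usual
   topology and derivatives, but lengths, angles and distances must be
   Euclidean. *)
Definition dotv (R : realType) (u v : 'rV[R]_3) : R := \sum_(i < 3) u 0 i * v 0 i.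

Definition enorm (R : realType) (u : 'rV[R]_3) : R := Num.sqrt (dotv u u).

Definition eudist (R : realType) (x y : 'rV[R]_3) : R := enorm (x - y).

Definition eudist_set (R : realType) (x : 'rV[R]_3) (S : set 'rV[R]_3) : R :=
  inf [set eudist x y | y in S].

(* For open U and finite-dimensional V, having all iterated directional
   derivatives up to order k, all of them continuous on U, is the usual C^k. *)
Fixpoint Ck (R : realType) (V W : normedModType R) (k : nat) (U : set V)
    (f : V -> W) : Prop :=
  (forall x, U x -> {for x, continuous f}) /\
  if k is k'.+1 then
    (forall x v, U x -> derivable f x v) /\
    (forall v, Ck k' U (fun x => 'D_v f x))
  else True.

(* An embedded C^2 surface: locally a regular level set of a C^2 function. *)
Definition C2_surface (R : realType) (K : set 'rV[R]_3) : Prop :=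
  K !=set0 /\
  forall p, K p ->
    exists (U : set 'rV[R]_3) (f : 'rV[R]_3 -> R^o),
      [/\ open U, U p, Ck 2 U f,
          (forall x, U x -> (K x <-> f x = 0)) &
          exists v, 'D_v f p != 0].

(* Completeness as a metric subspace of R^3. *)
Definition complete_subset (R : realType) (K : set 'rV[R]_3) : Prop :=
  forall F : set_system 'rV[R]_3, ProperFilter F -> F K -> cauchy F ->
    exists2 p, K p & F --> p.

Definition boundary (R : realType) (C : set 'rV[R]_3) : set 'rV[R]_3 :=
  closure C `\` interior C.

Definition convex_body (R : realType) (C : set 'rV[R]_3) : Prop :=
  [/\ closed C, convex_set C & interior C !=set0].

Definition bounds_convex_body (R : realType) (K C : set 'rV[R]_3) : Prop :=
  convex_body C /\ K = boundary C.

Definition convex_surface (R : realType) (K : set 'rV[R]_3) : Prop :=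
  exists C, bounds_convex_body K C.

Definition proj_set (R : realType) (S : set 'rV[R]_3) (x : 'rV[R]_3) :
    set 'rV[R]_3 :=
  [set y | S y /\ forall z, S z -> eudist x y <= eudist x z].

Definition regular_constant_distance (R : realType) (S1 S2 : set 'rV[R]_3)
    (r : R) : Prop :=
  forall x, S1 x ->
    eudist_set x S2 = r /\ exists y, proj_set S2 x = [set y].

(* Arbitrary where proj_set S x is empty, and one arbitrary minimizer where it
   has several. *)
Definition projection (R : realType) (S : set 'rV[R]_3) (x : 'rV[R]_3) :
    'rV[R]_3 :=
  get (proj_set S x).

(* On a C^1 surface, curves differentiable at 0 and C^1 curves have the same
   velocities. *)
Definition tangent (R : realType) (K : set 'rV[R]_3) (p v : 'rV[R]_3) : Prop :=
  exists c : R^o -> 'rV[R]_3,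
    [/\ c 0 = p, (\forall t \near (0 : R^o), K (c t)) & is_derive (0 : R^o) 1 c v].

Definition open_interval (R : realType) (I : set R) : Prop :=
  [/\ open I, is_interval I & I !=set0].

(* A geodesic has acceleration normal to the surface. *)
Definition unit_speed_geodesic (R : realType) (K : set 'rV[R]_3) (I : set R)
    (g : R -> 'rV[R]_3) : Prop :=
  [/\ open_interval I,
      Ck 2 (I : set R^o) (g : R^o -> 'rV[R]_3),
      (forall t, I t -> K (g t)),
      (forall t, I t -> enorm (derive1 g t) = 1) &
      (forall t v, I t -> tangent K (g t) v -> dotv (derive1n 2 g t) v = 0)].

Definition geodesic (R : realType) (K : set 'rV[R]_3) (I : set R)
    (g : R -> 'rV[R]_3) : Prop :=
  open_interval I /\
  exists (J : set R) (s : R -> 'rV[R]_3) (phi : R -> R),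
    [/\ unit_speed_geodesic K J s,
        Ck 1 (I : set R^o) (phi : R^o -> R^o),
        (forall t, I t -> derive1 phi t != 0),
        phi @` I = J &
        (forall t, I t -> g t = s (phi t))].

Definition preserves_geodesics (R : realType) (S1 S2 : set 'rV[R]_3)
    (F : 'rV[R]_3 -> 'rV[R]_3) : Prop :=
  forall (I : set R) (g : R -> 'rV[R]_3),
    geodesic S1 I g -> geodesic S2 I (F \o g).

Definition sphere (R : realType) (K : set 'rV[R]_3) : Prop :=
  exists (c : 'rV[R]_3) (rho : R),
    0 < rho /\ K = [set x | eudist x c = rho].

Definition plane (R : realType) (K : set 'rV[R]_3) : Prop :=
  exists a u : 'rV[R]_3, u != 0 /\ K = [set x | dotv u (x - a) = 0].

Definition line (R : realType) (a u : 'rV[R]_3) : set 'rV[R]_3 :=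
  [set a + t *: u | t in [set: R]].

Definition is_line (R : realType) (L : set 'rV[R]_3) : Prop :=
  exists a u : 'rV[R]_3, u != 0 /\ L = line a u.

Definition same_or_parallel (R : realType) (L M : set 'rV[R]_3) : Prop :=
  exists a b u : 'rV[R]_3, [/\ u != 0, L = line a u & M = line b u].

Definition generalized_cylinder (R : realType) (C : set 'rV[R]_3) : Prop :=
  (forall p, C p -> exists! L : set 'rV[R]_3, [/\ is_line L, L p & L `<=` C]) /\
  (forall L M : set 'rV[R]_3, is_line L -> is_line M -> L `<=` C -> M `<=` C ->
    same_or_parallel L M).

(* Q is a rotation matrix fixing u, so x |-> a + (x - a) Q runs over all
   rotations about the line through a directed by u. *)
Definition rotationally_symmetric (R : realType) (C : set 'rV[R]_3)
    (a u : 'rV[R]_3) : Prop :=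
  forall Q : 'M[R]_3, Q *m Q^T = 1%:M -> \det Q = 1 -> u *m Q = u ->
    forall x, C x -> C (a + (x - a) *m Q).

(* Uniqueness of the lines forces the symmetry axis to be parallel to them. *)
Definition round_cylinder (R : realType) (C : set 'rV[R]_3) : Prop :=
  generalized_cylinder C /\
  exists a u : 'rV[R]_3, u != 0 /\ rotationally_symmetric C a u.

(* Main.v *)
(** Let N be the unit normal of Kr for which the projection is x |-> x - r N x, let A be the shape operator of
    Kr and B = 1 - r A. The two surfaces share their normal lines. If geodesics are preserved, then along a
    unit speed geodesic of Kr with velocity w both w and the unit vector along B w, which is the velocity of
    the image geodesic, have normal derivatives; hence the angle between w and B w is constant. In particular
    a geodesic that starts in a principal direction stays principal, so it is planar. Where the principal
    curvatures k1 and k2 differ, leaving p along the first principal geodesic and then along the second, or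
    the other way round, one reaches the same normal, hence the same point, with two principal directions for
    k1 and k2 that are not orthogonal, unless k1 k2 = 0. When k2 = 0 its direction is constant and spans
    rulings, and the geodesics bisecting the principal directions show that k1 is constant. Where k1 = k2
    everywhere, N - k1 x has derivative 0. By connectedness Kr lies in a plane, a sphere or a round cylinder,
    and convexity forces equality, for Kr and then for K0; a plane is excluded by hypothesis.

    Conversely, next to a sphere or a round cylinder the projection is the restriction of an affine map that
    multiplies the components orthogonal to the axis by a constant; geodesics make a constant angle with the
    axis, so their images have constant speed and normal acceleration. *)

(* The surfaces are only C^2, so the shape operator is merely continuous: the Codazzi equations are
   out of reach, and the geodesic equation has a continuous right-hand side, which yields existence
   of geodesics without uniqueness. Each argument therefore works with some geodesic of given
   initial data, with constants uniform in the data, and compares normals instead of derivatives of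
   curvature. The two routes along principal geodesics are an integrated substitute for a Codazzi
   equation; their end points are matched through the Gauss map, which is injective where [k1 k2] is
   nonzero.

   The normal is taken from the projection and not from a gradient: projection onto a convex body is
   firmly nonexpansive, which makes the normal Lipschitz and decides the sign of the curvatures.
   First-order estimates are kept in strict form, with two points moving near a third. This is
   strong enough to recover the continuity of the shape operator, and to show that two points
   coincide by bounding their distance by half of itself. *)
Require Import Defs.
From HB Require Import structures.
From mathcomp Require Import all_boot all_order all_algebra.
From mathcomp Require Import all_classical all_reals all_analysis.
From mathcomp Require Import ring lra.
Import Order.TTheory GRing.Theory Num.Theory.
Import numFieldNormedType.Exports.
Local Open Scope classical_set_scope.
Local Open Scope ring_scope.

Set Implicit Arguments. Unset Strict Implicit. Unset Printing Implicit Defensive.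
Local Notation "u *d v" := (dotv u v) (at level 40, left associativity).

(** * Euclidean vectors *)

Section EuclideanSpace.
Variable R : realType.
Implicit Types (u v w x y z : 'rV[R]_3) (a b c t : R).

Lemma eq_ler a b : a = b -> a <= b.
Proof. by move->. Qed.

Lemma dotE u v : u *d v = u 0 0 * v 0 0 + u 0 1 * v 0 1 + u 0 (2 : 'I_3) * v 0 (2 : 'I_3).
Proof.
rewrite /dotv !big_ord_recl big_ord0 addr0 addrA.
by congr (_ * _ + _ * _ + _ * _); congr (_ _ _); apply: val_inj.
Qed.

Lemma I3P (P : 'I_3 -> Prop) : P 0 -> P 1 -> P 2 -> forall i, P i.
Proof.
move=> h0 h1 h2 -[[|[|[|//]]] hi].
- by rewrite (_ : Ordinal hi = 0) //; apply: val_inj.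
- by rewrite (_ : Ordinal hi = 1) //; apply: val_inj.
- by rewrite (_ : Ordinal hi = 2) //; apply: val_inj.
Qed.

Lemma row3P u v : u 0 0 = v 0 0 -> u 0 1 = v 0 1 -> u 0 (2 : 'I_3) = v 0 (2 : 'I_3) -> u = v.
Proof. by move=> h0 h1 h2; apply/rowP; apply: I3P. Qed.

Lemma dotC u v : u *d v = v *d u.
Proof. by rewrite !dotE; ring. Qed.
Lemma dotDl u v w : (u + v) *d w = u *d w + v *d w.
Proof. by rewrite !dotE !mxE; ring. Qed.
Lemma dotDr u v w : w *d (u + v) = w *d u + w *d v.
Proof. by rewrite !dotE !mxE; ring. Qed.
Lemma dotZl a u w : (a *: u) *d w = a * (u *d w).
Proof. by rewrite !dotE !mxE; ring. Qed.
Lemma dotZr a u w : w *d (a *: u) = a * (w *d u).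
Proof. by rewrite !dotE !mxE; ring. Qed.
Lemma dotNl u w : (- u) *d w = - (u *d w).
Proof. by rewrite !dotE !mxE; ring. Qed.
Lemma dotNr u w : w *d (- u) = - (w *d u).
Proof. by rewrite !dotE !mxE; ring. Qed.
Lemma dotBl u v w : (u - v) *d w = u *d w - v *d w.
Proof. by rewrite dotDl dotNl. Qed.
Lemma dotBr u v w : w *d (u - v) = w *d u - w *d v.
Proof. by rewrite dotDr dotNr. Qed.
Lemma dot0l w : 0 *d w = 0.
Proof. by rewrite !dotE !mxE; ring. Qed.
Lemma dot0r w : w *d 0 = 0.
Proof. by rewrite !dotE !mxE; ring. Qed.
Definition dotL := (dotDl, dotDr, dotBl, dotBr, dotNl, dotNr, dotZl, dotZr, dot0l, dot0r).

Lemma dot_ge0 u : 0 <= u *d u.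
Proof. by rewrite dotE -!expr2 !addr_ge0 // sqr_ge0. Qed.

Lemma dot_eq0 u : u *d u = 0 -> u = 0.
Proof.
rewrite dotE => h.
have ha := sqr_ge0 (u 0 0); have hb := sqr_ge0 (u 0 1); have hc := sqr_ge0 (u 0 (2:'I_3)).
by apply: row3P; rewrite mxE; apply/eqP; rewrite -sqrf_eq0; apply/eqP; lra.
Qed.

Lemma dot_gt0 u : u != 0 -> 0 < u *d u.
Proof. by move=> u0; rewrite lt0r dot_ge0 andbT; apply: contra u0 => /eqP/dot_eq0->. Qed.

(** Lagrange's identity: the difference of the two sides is the sum of the squares of the
    coordinates of the cross product. *)
Lemma cauchy_schwarz u v : (u *d v) ^+ 2 <= (u *d u) * (v *d v).
Proof.
rewrite !dotE.
have h1 := sqr_ge0 (u 0 0 * v 0 1 - u 0 1 * v 0 0).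
have h2 := sqr_ge0 (u 0 0 * v 0 (2:'I_3) - u 0 (2:'I_3) * v 0 0).
have h3 := sqr_ge0 (u 0 1 * v 0 (2:'I_3) - u 0 (2:'I_3) * v 0 1).
rewrite -subr_ge0; apply: le_trans (addr_ge0 (addr_ge0 h1 h2) h3) _.
by apply/eq_ler; ring.
Qed.

Lemma enorm_ge0 u : 0 <= enorm u.
Proof. exact: sqrtr_ge0. Qed.

Lemma enorm2 u : enorm u ^+ 2 = u *d u.
Proof. by rewrite sqr_sqrtr // dot_ge0. Qed.

Lemma enorm_le u a : 0 <= a -> (enorm u <= a) = (u *d u <= a ^+ 2).
Proof. by move=> a0; rewrite -enorm2 ler_sqr // ?nnegrE ?enorm_ge0. Qed.

Lemma enorm_eq u a : 0 <= a -> u *d u = a ^+ 2 -> enorm u = a.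
Proof. by move=> a0 h; rewrite /enorm h sqrtr_sqr ger0_norm. Qed.

Lemma enorm_unit u : (u *d u = 1) <-> (enorm u = 1).
Proof.
split=> h; first by apply: enorm_eq => //; rewrite expr1n.
by rewrite -enorm2 h expr1n.
Qed.

Lemma enorm0_eq0 u : enorm u = 0 -> u = 0.
Proof. by move=> h; apply: dot_eq0; rewrite -enorm2 h expr0n. Qed.

Lemma enormZ a u : enorm (a *: u) = `|a| * enorm u.
Proof.
by rewrite /enorm !dotL mulrA -expr2 sqrtrM ?sqr_ge0 // sqrtr_sqr.
Qed.

Lemma dot_le_enorm u v : u *d v <= enorm u * enorm v.
Proof.
have [h|h] := ltP (u *d v) 0.
  by apply: le_trans (ltW h) _; rewrite mulr_ge0 ?enorm_ge0.
by rewrite -ler_sqr ?nnegrE ?mulr_ge0 ?enorm_ge0 // exprMn !enorm2 cauchy_schwarz.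
Qed.

Lemma ler_enormD u v : enorm (u + v) <= enorm u + enorm v.
Proof.
rewrite enorm_le ?addr_ge0 ?enorm_ge0 // sqrrD !enorm2 !dotL (dotC v u).
by have := dot_le_enorm u v; lra.
Qed.

Lemma coord_le_norm n (u : 'rV[R]_n) i : `|u 0 i| <= `|u|.
Proof. by rewrite [leRHS]mx_normrE; apply: (le_bigmax_cond _ (fun ij => `|u ij.1 ij.2|) (j := (0, i))). Qed.

Lemma norm_le_coord n (u : 'rV[R]_n) a : 0 <= a -> (forall i, `|u 0 i| <= a) -> `|u| <= a.
Proof.
move=> a0 h; rewrite [leLHS]mx_normrE; apply: bigmax_le => // -[i j] _ /=.
by rewrite ord1.
Qed.

Lemma norm_le_enorm u : `|u| <= enorm u.
Proof.
apply: norm_le_coord (enorm_ge0 _) _ => i.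
rewrite -ler_sqr ?nnegrE ?enorm_ge0 // enorm2 real_normK ?num_real //.
rewrite /dotv (bigD1 i) //= -expr2 lerDl sumr_ge0 // => j _.
by rewrite -expr2 sqr_ge0.
Qed.

Lemma dot_le_norm u v : `|u *d v| <= 3 * `|u| * `|v|.
Proof.
rewrite dotE.
have h i : `|u 0 i * v 0 i| <= `|u| * `|v|.
  by rewrite normrM ler_pM // coord_le_norm.
apply: le_trans (ler_normD _ _) _; apply: le_trans (lerD (ler_normD _ _) (le_refl _)) _.
by have := h 0; have := h 1; have := h (2:'I_3); lra.
Qed.

(** The sharp factor is the square root of 3; the value 2 keeps later constants rational. *)
Lemma enorm_le_norm u : enorm u <= 2 * `|u|.
Proof.
rewrite enorm_le ?mulr_ge0 //; have := dot_le_norm u u.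
have := sqr_ge0 `|u|; rewrite ger0_norm ?dot_ge0 // => h1 h2; nra.
Qed.

Lemma mulmx_le_norm (A : 'M[R]_3) u : `|u *m A| <= 3 * `|u| * `|A|.
Proof.
apply: norm_le_coord => [|i]; first by rewrite !mulr_ge0.
rewrite mxE; apply: le_trans (ler_norm_sum _ _ _) _.
apply: le_trans (_ : \sum_(j < 3) `|u| * `|A| <= _).
  apply: ler_sum => j _; rewrite normrM ler_pM // ?coord_le_norm //.
  by rewrite [leRHS]mx_normrE; apply: (le_bigmax_cond _ (fun ij => `|A ij.1 ij.2|) (j := (j, i))).
by rewrite sumr_const card_ord -[X in X <= _]mulr_natl; apply/eq_ler; ring.
Qed.

Lemma dot_mulmxl (A : 'M[R]_3) u v : (u *m A) *d v = u *d (v *m A^T).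
Proof.
have h (x y : 'rV[R]_3) : x *d y = (x *m y^T) 0 0.
  by rewrite !mxE; apply: eq_bigr => i _; rewrite mxE.
by rewrite !h trmx_mul trmxK mulmxA.
Qed.

Lemma dot_sym (A : 'M[R]_3) u v : A^T = A -> (u *m A) *d v = u *d (v *m A).
Proof. by move=> h; rewrite dot_mulmxl h. Qed.

Definition cross u v : 'rV[R]_3 :=
  \row_i (if i == 0 then u 0 1 * v 0 (2:'I_3) - u 0 (2:'I_3) * v 0 1
  else if i == 1 then u 0 (2:'I_3) * v 0 0 - u 0 0 * v 0 (2:'I_3)
  else u 0 0 * v 0 1 - u 0 1 * v 0 0).

Definition orthonormal u v w :=
  [/\ u *d u = 1, v *d v = 1, w *d w = 1 & [/\ u *d v = 0, u *d w = 0 & v *d w = 0]].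

Lemma cross_orthonormal u v : u *d u = 1 -> v *d v = 1 -> u *d v = 0 ->
  orthonormal u v (cross u v).
Proof.
move=> hu hv huv.
have e : cross u v *d cross u v = (u *d u) * (v *d v) - (u *d v) ^+ 2.
  by rewrite !dotE !mxE /=; ring.
split=> //; first by rewrite e hu hv huv; ring.
by split => //; rewrite !dotE !mxE /=; ring.
Qed.

(** The matrix [M] with rows [u], [v], [w] satisfies [M M^T = 1]; being square it also satisfies
    [M^T M = 1], and [x = x M^T M] is the expansion. *)
Lemma orthonormal_expand u v w x : orthonormal u v w ->
  x = (x *d u) *: u + (x *d v) *: v + (x *d w) *: w.
Proof.
case=> hu hv hw [huv huw hvw].
pose M : 'M[R]_3 := \matrix_(i, j) (if i == 0 then u 0 j else if i == 1 then v 0 j else w 0 j).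
have MM : M *m M^T = 1%:M.
  apply/matrixP => i j; rewrite !mxE.
  have e (p q : 'rV[R]_3) : \sum_(j < 3) p 0 j * q 0 j = p *d q by [].
  case: i => -[|[|[|//]]] hi; case: j => -[|[|[|//]]] hj; rewrite /=;
  under eq_bigr do rewrite !mxE /=; rewrite e //.
  - by rewrite dotC.
  - by rewrite dotC.
  - by rewrite dotC.
have /(congr1 (fun P => x *m P)) := mulmx1C MM.
rewrite mulmx1 mulmxA => {1}<-; apply/rowP => j.
by rewrite !mxE !big_ord_recl big_ord0 !mxE /= addr0 addrA; congr (_ * _ + _ * _ + _ * _);
  rewrite dotE !big_ord_recl big_ord0 !mxE addr0 addrA;
  congr (_ * _ + _ * _ + _ * _); congr (_ _ _); apply: val_inj.
Qed.

Lemma orthonormal_rot u v w : orthonormal u v w -> orthonormal v w u.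
Proof. by case=> ? ? ? [? ? ?]; split=> //; split=> //; rewrite dotC. Qed.

Lemma orthonormal_swap u v w : orthonormal u v w -> orthonormal v u w.
Proof. by case=> ? ? ? [? ? ?]; split=> //; split=> //; rewrite dotC. Qed.

Definition normalize u : 'rV[R]_3 := (enorm u)^-1 *: u.

Lemma enorm_gt0 u : u != 0 -> 0 < enorm u.
Proof. by move=> u0; rewrite sqrtr_gt0 dot_gt0. Qed.

Lemma normalizeK u : u != 0 -> enorm u *: normalize u = u.
Proof. by move=> /enorm_gt0 h; rewrite scalerA divff ?scale1r // gt_eqF. Qed.

Lemma normalize_unit u : u != 0 -> normalize u *d normalize u = 1.
Proof.
move=> /enorm_gt0 h; rewrite !dotL -enorm2; field; lra.
Qed.

Lemma exists_perp w : w *d w = 1 -> exists u v, orthonormal u v w.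
Proof.
move=> hw.
have [u u0 uw] : exists2 u : 'rV[R]_3, u != 0 & u *d w = 0.
  pose m (a b c : R) : 'rV[R]_3 := \row_i (if i == 0 then a else if i == 1 then b else c).
  have [h|h] := eqVneq (w 0 0) 0.
    exists (m 1 0 0); last by rewrite dotE !mxE /= h; ring.
    by apply/eqP => /rowP /(_ 0); rewrite !mxE /= => /eqP; rewrite oner_eq0.
  exists (m (w 0 1) (- w 0 0) 0); last by rewrite dotE !mxE /=; ring.
  by apply/eqP => /rowP /(_ 1); rewrite !mxE /= => /eqP; rewrite oppr_eq0; apply/negP.
exists (normalize u), (cross w (normalize u)).
apply/orthonormal_rot/cross_orthonormal => //.
  exact: normalize_unit.
by rewrite dotC dotZl uw mulr0.
Qed.

End EuclideanSpace.

(** * Velocities of curves *)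

Section Velocity.
Variable R : realType.
Implicit Types (s t a b eps d : R).

(* Differentiability of curves, in explicit form so that it composes with the
   strict estimates satisfied on a surface. *)
Definition vel (V : normedModType R) (c : R -> V) t (v : V) :=
  forall eps, 0 < eps -> exists2 d : R, 0 < d &
    forall s, `|s - t| < d -> `|c s - c t - (s - t) *: v| <= eps * `|s - t|.

Lemma nbhs_eps (V : normedModType R) (x : V) (P : set V) :
  nbhs x P <-> exists2 d : R, 0 < d & forall y, `|y - x| < d -> P y.
Proof.
split=> [/nbhs_ballP[d /= d0 hd]|[d d0 hd]].
  by exists d => // y yd; apply: hd; rewrite -ball_normE /= distrC.
apply/nbhs_ballP; exists d => // y; rewrite -ball_normE /= distrC; exact: hd.
Qed.

Lemma continuous_eps (V W : normedModType R) (g : V -> W) x :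
  {for x, continuous g} <-> forall eps, 0 < eps ->
    exists2 d : R, 0 < d & forall y, `|y - x| < d -> `|g y - g x| < eps.
Proof.
split=> [/cvgrPdist_lt h eps /h/nbhs_eps[d d0 hd]|h].
  by exists d => // y /hd; rewrite distrC.
apply/cvgrPdist_lt => eps /h[d d0 hd]; apply/nbhs_eps; exists d => // y /hd.
by rewrite distrC.
Qed.

Lemma norm_slope (V : normedModType R) (k : R) (x v : V) : k != 0 ->
  `|k^-1 *: x - v| = `|x - k *: v| / `|k|.
Proof.
move=> k0; rewrite mulrC -normfV -normrZ scalerBr scalerA mulVf //.
by rewrite scale1r.
Qed.

Lemma vel_is_derive (V : normedModType R) (c : R -> V) t v :
  vel c t v -> is_derive (t : R^o) 1 (c : R^o -> V) v.
Proof.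
move=> h.
have cv : h^-1 *: ((c \o shift t) (h *: (1 : R^o)) - c t) @[h --> 0^'] --> v.
  apply/cvgrPdist_le => eps eps0; have [d d0 hd] := h _ eps0.
  near=> k.
  have k0 : k != 0 by near: k; exact: nbhs_dnbhs_neq.
  have kd : `|k| < d by near: k; apply: dnbhs0_lt.
  have := hd (k + t); rewrite addrK => /(_ kd) H.
  rewrite /= /shift /= [k *: 1]mulr1 distrC.
  by rewrite norm_slope // ler_pdivrMr ?normr_gt0.
by split; [apply/cvg_ex; exists v | apply: cvg_lim].
Unshelve. all: by end_near. Qed.

Lemma is_derive_vel (V : normedModType R) (c : R -> V) t v :
  is_derive (t : R^o) 1 (c : R^o -> V) v -> vel c t v.
Proof.
case=> dc dv eps eps0.
have : h^-1 *: ((c \o shift t) (h *: (1 : R^o)) - c t) @[h --> 0^'] --> v.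
  by rewrite -dv; exact: dc.
move=> /cvgrPdist_le /(_ _ eps0); rewrite near_withinE => -[d d0 hd].
exists d => // s; have [->|st] := eqVneq s t.
  by move=> _; rewrite !subrr scale0r subr0 !normr0 mulr0.
move=> sd; have st0 : s - t != 0 by rewrite subr_eq0.
have := hd (s - t); rewrite /= sub0r normrN => /(_ sd st0).
rewrite /shift /= [(s - t) *: 1]mulr1 subrK distrC.
by rewrite norm_slope // ler_pdivrMr ?normr_gt0.
Qed.

Lemma vel_lip (V : normedModType R) (c : R -> V) t v : vel c t v ->
  exists2 d : R, 0 < d & forall s, `|s - t| < d -> `|c s - c t| <= (1 + `|v|) * `|s - t|.
Proof.
move=> /(_ 1 ltr01) [d d0 hd]; exists d => // s /hd.
rewrite mul1r mulrDl mul1r => h.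
rewrite -(subrK ((s - t) *: v) (c s - c t)); apply: le_trans (ler_normD _ _) _.
by rewrite lerD // normrZ mulrC.
Qed.

Lemma vel_cont (V : normedModType R) (c : R -> V) t v : vel c t v ->
  forall eps, 0 < eps -> exists2 d : R, 0 < d & forall s, `|s - t| < d -> `|c s - c t| < eps.
Proof.
move=> /vel_lip[d d0 hd] eps eps0.
have M0 : 0 < 1 + `|v| by rewrite ltr_pwDl.
exists (Num.min d (eps / (1 + `|v|))); first by rewrite lt_min d0 divr_gt0.
move=> s; rewrite lt_min => /andP[/hd h1 h2]; apply: le_lt_trans h1 _.
by rewrite mulrC -ltr_pdivlMr.
Qed.

Lemma vel_continuous (V : normedModType R) (c : R -> V) t v : vel c t v ->
  {for t, continuous (c : R^o -> V)}.
Proof. by move=> /vel_cont h; apply/continuous_eps. Qed.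

Lemma vel_cst (V : normedModType R) (x : V) t : vel (fun _ => x) t 0.
Proof. by move=> eps eps0; exists 1 => // s _; rewrite subrr scaler0 subr0 normr0 mulr_ge0 // ltW. Qed.

Lemma vel_id t : vel (fun s => s : R^o) t 1.
Proof. by move=> eps eps0; exists 1 => // s _; rewrite [_ *: _]mulr1 subrr normr0 mulr_ge0 // ltW. Qed.

Lemma vel_near (V : normedModType R) (c c' : R -> V) t v d : 0 < d ->
  (forall s, `|s - t| < d -> c s = c' s) -> vel c t v -> vel c' t v.
Proof.
move=> d0 h hc eps /hc[d' d'0 h']; exists (Num.min d d'); first by rewrite lt_min d0.
move=> s; rewrite lt_min => /andP[/h <- /h'].
by rewrite -(h t) // subrr normr0.
Qed.

Lemma vel_unique (V : normedModType R) (c : R -> V) t v w : vel c t v -> vel c t w -> v = w.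
Proof. by move=> /vel_is_derive[_ <-] /vel_is_derive[_ <-]. Qed.

Lemma velD (V : normedModType R) (c c' : R -> V) t v v' :
  vel c t v -> vel c' t v' -> vel (fun s => c s + c' s) t (v + v').
Proof. by move=> /vel_is_derive h /vel_is_derive h'; apply: is_derive_vel; apply: is_deriveD. Qed.

Lemma velN (V : normedModType R) (c : R -> V) t v : vel c t v -> vel (fun s => - c s) t (- v).
Proof. by move=> /vel_is_derive h; apply: is_derive_vel; apply: is_deriveN. Qed.

Lemma velB (V : normedModType R) (c c' : R -> V) t v v' :
  vel c t v -> vel c' t v' -> vel (fun s => c s - c' s) t (v - v').
Proof. by move=> h h'; apply: velD => //; apply: velN. Qed.

Lemma vel_affine (V : normedModType R) (c : R -> V) a b t v :
  vel c (a * t + b) v -> vel (fun s => c (a * s + b)) t (a *: v).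
Proof.
move=> h eps eps0.
have M0 : 0 < 1 + `|a| by rewrite ltr_pwDl.
have [d d0 hd] := h (eps / (1 + `|a|)) (divr_gt0 eps0 M0).
exists (d / (1 + `|a|)); first exact: divr_gt0.
have e s : a * s + b - (a * t + b) = a * (s - t) by ring.
move=> s; rewrite ltr_pdivlMr // => sd.
have := hd (a * s + b); rewrite e scalerA (mulrC (s - t)) normrM.
have n0 := normr_ge0 a; have n1 := normr_ge0 (s - t).
have /[swap]/[apply] : `|a| * `|s - t| < d by nra.
move=> /le_trans; apply; rewrite mulrAC ler_pdivrMr //.
by rewrite -mulrA ler_wpM2l ?(ltW eps0) // mulrC ler_wpM2l // lerDr.
Qed.

Section Bilinear.
Variables (U V W : normedModType R) (B : U -> V -> W) (M : R).
Hypotheses (BDl : forall x y z, B (x - y) z = B x z - B y z)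
  (BDr : forall x y z, B z (x - y) = B z x - B z y)
  (BZl : forall k x y, B (k *: x) y = k *: B x y)
  (BZr : forall k x y, B x (k *: y) = k *: B x y)
  (M0 : 0 <= M) (BM : forall x y, `|B x y| <= M * `|x| * `|y|).

(** One product rule serves the dot product and scaling. The increment splits into the first-order
    error of [c], a mixed term and the first-order error of [c']; [K] collects the factors of the
    common tolerance [e], and [e <= 1] bounds [c' s] by [|c' t| + 1]. *)
Lemma vel_bilinear (c : R -> U) (c' : R -> V) t v v' :
  vel c t v -> vel c' t v' -> vel (fun s => B (c s) (c' s)) t (B v (c' t) + B (c t) v').
Proof.
move=> h h' eps eps0.
pose K := M * (1 + `|c' t| + `|c t| + `|v|) + 1.
have K0 : 0 < K by rewrite ltr_wpDl // mulr_ge0 // !addr_ge0.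
pose e := Num.min 1 (eps / K).
have e0 : 0 < e by rewrite lt_min ltr01 divr_gt0.
have eK : e * K <= eps by rewrite -ler_pdivlMr // ge_min lexx orbT.
have e1 : e <= 1 by rewrite ge_min lexx.
have [d d0 hd] := h _ e0; have [d' d'0 hd'] := h' _ e0; have [d2 d20 hd2] := vel_cont h' e0.
exists (Num.min d (Num.min d' d2)); first by rewrite !lt_min d0 d'0.
move=> s; rewrite !lt_min => /and3P[/hd A /hd' A' /hd2 A2].
have -> : B (c s) (c' s) - B (c t) (c' t) - (s - t) *: (B v (c' t) + B (c t) v')
   = B (c s - c t - (s - t) *: v) (c' s) + (s - t) *: B v (c' s - c' t)
     + B (c t) (c' s - c' t - (s - t) *: v').
  rewrite !BDl !BDr !BZl !BZr scalerDr scalerBr subrKA.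
  rewrite -[B (c t) (c' s) - _ - _]addrA [X in _ = X + _]addrAC subrKA opprD !addrA.
  by congr (_ - _); rewrite addrAC.
apply: le_trans (ler_normD _ _) _; apply: le_trans (lerD (ler_normD _ _) (lexx _)) _.
rewrite normrZ.
have cs : `|c' s| <= `|c' t| + 1.
  by rewrite -(subrK (c' t) (c' s)) addrC (le_trans (ler_normD _ _)) // lerD // ltW // (lt_le_trans A2).
have n0 := normr_ge0 (s - t).
have B1 : `|B (c s - c t - (s - t) *: v) (c' s)| <= M * (e * `|s - t|) * (`|c' t| + 1).
  apply: le_trans (BM _ _) _; apply: ler_pM => //; first by rewrite mulr_ge0.
  by rewrite ler_wpM2l.
have B2 : `|s - t| * `|B v (c' s - c' t)| <= `|s - t| * (M * `|v| * e).
  by rewrite ler_wpM2l // (le_trans (BM _ _)) // ler_wpM2l ?mulr_ge0 // ltW.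
have B3 : `|B (c t) (c' s - c' t - (s - t) *: v')| <= M * `|c t| * (e * `|s - t|).
  by apply: le_trans (BM _ _) _; rewrite ler_wpM2l ?mulr_ge0.
apply: le_trans (lerD (lerD B1 B2) B3) _.
rewrite (_ : _ + _ = (M * (1 + `|c' t| + `|c t| + `|v|)) * e * `|s - t|); last by ring.
rewrite ler_wpM2r // (le_trans _ eK) // mulrC ler_wpM2l ?(ltW e0) // /K.
by rewrite lerDl.
Qed.

End Bilinear.

Lemma vel_dot (c c' : R -> 'rV[R]_3) t v v' : vel c t v -> vel c' t v' ->
  vel (fun s => c s *d c' s : R^o) t (v *d c' t + c t *d v').
Proof.
apply: (vel_bilinear (B := fun x y => x *d y : R^o) (M := 3)) => //.
- by move=> *; rewrite dotBl.
- by move=> *; rewrite dotBr.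
- by move=> *; rewrite dotZl.
- by move=> *; rewrite dotZr.
- exact: dot_le_norm.
Qed.

Lemma vel_scale (V : normedModType R) (f : R -> R^o) (c : R -> V) t (f' : R) v :
  vel f t f' -> vel c t v -> vel (fun s => f s *: c s) t (f' *: c t + f t *: v).
Proof.
apply: (vel_bilinear (B := fun (x : R^o) (y : V) => x *: y) (M := 1)) => //.
- by move=> *; rewrite scalerBl.
- by move=> *; rewrite scalerBr.
- by move=> *; rewrite scalerA.
- by move=> *; rewrite !scalerA mulrC.
- by move=> *; rewrite mul1r normrZ.
Qed.

Lemma velZ (V : normedModType R) a (c : R -> V) t v : vel c t v -> vel (fun s => a *: c s) t (a *: v).
Proof.
move=> h; have := vel_scale (vel_cst (a : R^o) t) h.
by rewrite scale0r add0r.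
Qed.

Lemma vel_mul (f g : R -> R^o) t (f' g' : R) : vel f t f' -> vel g t g' ->
  vel (fun s => f s * g s : R^o) t (f' * g t + f t * g').
Proof. exact: vel_scale. Qed.

Lemma vel_dotl (c : R -> 'rV[R]_3) t v w : vel c t v -> vel (fun s => c s *d w : R^o) t (v *d w).
Proof. by move=> h; have := vel_dot h (vel_cst w t); rewrite dot0r addr0. Qed.

(** Differentiability relative to [P]: the normal of a surface is controlled on the surface only, so
    increments are tested at points of [P]. *)
Definition fdiff (V W : normedModType R) (P : set V) (g : V -> W) (x : V) (L : V -> W) :=
  forall eps, 0 < eps -> exists2 d : R, 0 < d &
    forall y, P y -> `|y - x| < d -> `|g y - g x - L (y - x)| <= eps * `|y - x|.

Lemma vel_comp (V W : normedModType R) (P : set V) (g : V -> W) (c : R -> V) t v (L : V -> W) (M d : R) :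
  (forall x y, L (x - y) = L x - L y) -> (forall k x, L (k *: x) = k *: L x) ->
  0 <= M -> (forall x, `|L x| <= M * `|x|) ->
  0 < d -> (forall s, `|s - t| < d -> P (c s)) ->
  fdiff P g (c t) L -> vel c t v -> vel (fun s => g (c s)) t (L v).
Proof.
move=> LB LZ M0 LM d0 hP hg hc eps eps0.
have K0 : 0 < 1 + `|v| + M by rewrite -addrA ltr_wpDr // addr_ge0.
pose e := eps / (1 + `|v| + M).
have e0 : 0 < e by rewrite divr_gt0.
have [d1 d10 h1] := hg _ e0; have [d2 d20 h2] := hc _ e0.
have [d3 d30 h3] := vel_cont hc d10; have [d4 d40 h4] := vel_lip hc.
exists (Num.min d (Num.min d2 (Num.min d3 d4))); first by rewrite !lt_min d0 d20 d30 d40.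
move=> s; rewrite !lt_min => /and4P[/hP Ps /h2 H2 /h3 H3 /h4 H4].
rewrite (_ : _ - _ = (g (c s) - g (c t) - L (c s - c t)) + L (c s - c t - (s - t) *: v)); last first.
  by rewrite [L (_ - _ *: _)]LB LZ addrA subrK.
apply: le_trans (ler_normD _ _) _.
apply: le_trans (lerD (h1 _ Ps H3) (LM _)) _.
apply: le_trans (lerD (ler_wpM2l (ltW e0) H4) (ler_wpM2l M0 H2)) _.
by apply/eq_ler; rewrite /e; field; lra.
Qed.

Lemma vel_coord n (c : R -> 'rV[R]_n) t v i : vel c t v -> vel (fun s => c s 0 i : R^o) t (v 0 i).
Proof.
move=> h; apply: (@vel_comp 'rV[R]_n R^o setT (fun u => u 0 i) c t v (fun u => u 0 i) 1 1) => //.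
- by move=> x y; rewrite !mxE.
- by move=> x y; rewrite !mxE.
- by move=> x; rewrite mul1r coord_le_norm.
- by move=> eps eps0; exists 1 => // y _ _; rewrite !mxE subrr normr0 mulr_ge0 // ltW.
Qed.

Lemma coord_vel n (c : R -> 'rV[R]_n) t (v : 'rV[R]_n) :
  (forall i, vel (fun s => c s 0 i : R^o) t (v 0 i)) -> vel c t v.
Proof.
move=> h eps eps0.
have /choice[f hf] i : exists d, 0 < d /\ forall s, `|s - t| < d ->
    `|c s 0 i - c t 0 i - (s - t) * v 0 i| <= eps * `|s - t|.
  by have [d d0 hd] := h i _ eps0; exists d.
exists (\big[Num.min/1]_i f i).
  by apply: lt_bigmin => // i _; have [] := hf i.
move=> s hs'; have hs i : `|s - t| < f i by apply: lt_le_trans hs' (bigmin_le_cond _ _ _).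
apply: norm_le_coord => [|i]; first by rewrite mulr_ge0 // ltW.
by rewrite !mxE; have [_] := hf i; apply.
Qed.

Lemma mean_value (f df : R -> R) a b : a < b ->
  (forall t, a <= t <= b -> vel (f : R -> R^o) t (df t)) ->
  exists2 t, a < t < b & f b - f a = (b - a) * df t.
Proof.
move=> ab h.
have h1 t : t \in `]a, b[%R -> is_derive t 1 f (df t).
  by rewrite in_itv /= => /andP[h1 h2]; apply: vel_is_derive; apply: h; rewrite !ltW.
have h2 : {within `[a, b], continuous f}.
  apply: continuous_in_subspaceT => t /set_mem; rewrite /= in_itv /= => /h.
  exact: vel_continuous.
by have [t tab e] := MVT ab h1 h2; exists t; rewrite 1?mulrC //; move: tab; rewrite in_itv.
Qed.

Lemma vel0_real (f : R -> R^o) a b : a <= b -> (forall t, a <= t <= b -> vel f t 0) -> f a = f b.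
Proof.
rewrite le_eqVlt => /predU1P[->//|ab h].
have [t _ e] := mean_value ab h.
by apply/eqP; rewrite eq_sym -subr_eq0 e mulr0.
Qed.

Lemma vel0_cst_real (f : R -> R^o) tau s t : (forall t, `|t| < tau -> vel f t 0) ->
  `|s| < tau -> `|t| < tau -> f s = f t.
Proof.
move=> h hs ht.
wlog st : s t hs ht / s <= t => [hw|].
  by have [/hw->|/ltW/hw->] := leP s t.
apply: vel0_real => // u /andP[h1 h2]; apply: h.
by move: hs ht; rewrite !ltr_norml; lra.
Qed.

Lemma vel0_cst n (f : R -> 'rV[R]_n) tau s t : (forall t, `|t| < tau -> vel f t 0) ->
  `|s| < tau -> `|t| < tau -> f s = f t.
Proof.
move=> h hs ht; apply/rowP => i.
apply: (@vel0_cst_real (fun s => f s 0 i) tau) => // u hu.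
by have := vel_coord i (h u hu); rewrite mxE.
Qed.

Lemma ivt (f : R -> R) a b y : a <= b ->
  (forall t, a <= t <= b -> {for t, continuous (f : R^o -> R^o)}) ->
  f a <= y <= f b -> exists2 t, a <= t <= b & f t = y.
Proof.
move=> ab hf /andP[h1 h2].
have h12 := le_trans h1 h2.
have hc : {within `[a, b], continuous f}.
  by apply: continuous_in_subspaceT => t /set_mem; rewrite /= in_itv /= => /hf.
have [|t tI ft] := @IVT R f a b y ab hc; first by rewrite (min_idPl h12) (max_idPr h12) h1 h2.
by exists t => //; move: tI; rewrite in_itv.
Qed.

End Velocity.

(** * Peano existence *)

Section Peano.
Variables (R : realType) (n : nat).
Implicit Types (s t a b e d h eps : R) (x y z : 'rV[R]_n).

(** This replaces the Arzela-Ascoli extraction: one fixed ultrafilter makes bounded Euler polygons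
    converge at all times at once, with no subsequence to choose. *)
Lemma ultra_limit (U : set_system nat) (f : nat -> 'rV[R]_n) B : UltraFilter U ->
  (forall m, `|f m| <= B) ->
  exists p, forall eps, 0 < eps -> U [set m | `|f m - p| < eps].
Proof.
move=> UF fB; pose A := [set x : 'rV[R]_n | `|x| <= B].
have cA : compact A.
  apply: bounded_closed_compact.
    by exists B; split=> [|M BM x /= /le_trans]; [exact: num_real | apply; exact: ltW].
  rewrite (_ : A = (fun x : 'rV[R]_n => `|x|) @^-1` [set t : R | t <= B]) //.
  by apply: closed_comp => [x _|]; [exact: norm_continuous | exact: closed_le].
have FF : ProperFilter (f @ U) by apply: fmap_proper_filter.
have FA : U (f @^-1` A).
  by rewrite (_ : f @^-1` A = setT); [exact: filterT | apply/seteqP; split=> // m _; exact: fB].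
have [p [_ clp]] := cA _ FF FA; exists p => eps eps0.
have [//|hC] := in_ultra_setVsetC [set m | `|f m - p| < eps] UF.
have hB : U (f @^-1` (~` ball p eps)).
  by apply: filterS hC => m /= h1 h2; apply: h1; rewrite distrC; move: h2; rewrite -ball_normE.
by have [x [/= h1 h2]] := clp _ _ hB (nbhsx_ballx p eps eps0).
Qed.

Variables (F : 'rV[R]_n -> 'rV[R]_n) (M : R).
Hypothesis (FM : forall z, `|F z| <= M).

Let euler (h : R) y k := iter k (fun z => z + h *: F z) y.

Let euler_lip h y k j : 0 <= h -> `|euler h y (k + j) - euler h y k| <= j%:R * h * M.
Proof.
move=> h0; elim: j => [|j IH]; first by rewrite addn0 subrr normr0 !mul0r.
rewrite addnS /= addrAC -/(euler _ _ _); apply: le_trans (ler_normD _ _) _.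
by rewrite -[j.+1%:R]natr1 !mulrDl mul1r lerD // normrZ ger0_norm // ler_wpM2l.
Qed.

Let euler_slope h y k j g eps : 0 <= h ->
  (forall i, (i < j)%N -> `|F (euler h y (k + i)) - g| <= eps) ->
  `|euler h y (k + j) - euler h y k - (j%:R * h) *: g| <= j%:R * h * eps.
Proof.
move=> h0; elim: j => [|j IH] H.
  by rewrite addn0 subrr !mul0r scale0r subr0 normr0.
rewrite addnS /= -/(euler _ _ _) -[j.+1%:R]natr1 !mulrDl mul1r scalerDl.
rewrite (_ : _ - _ = (euler h y (k + j) - euler h y k - (j%:R * h) *: g)
  + h *: (F (euler h y (k + j)) - g)); last first.
  by apply/rowP => i; rewrite !mxE; ring.
apply: le_trans (ler_normD _ _) _; apply: lerD.
  by apply: IH => i ij; apply: H; exact: ltnW.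
by rewrite normrZ ger0_norm // ler_wpM2l // H.
Qed.

Let M0 : 0 <= M. Proof. exact: le_trans (FM 0). Qed.

(** [F] is only bounded, and the equation is claimed at the times where [F] is continuous at the
    current point; a field cut off discontinuously at the edge of a region can thus be used as it
    stands. The solution is the ultrafilter limit of Euler polygons of step [1 / (m + 1)]. *)
Lemma peano_pos y : exists x : R -> 'rV[R]_n, [/\ x 0 = y,
  (forall s t, 0 <= s <= t -> `|x t - x s| <= M * (t - s)) &
  forall s, 0 <= s -> {for x s, continuous F} -> forall eps, 0 < eps -> exists2 d : R, 0 < d &
    forall t, 0 <= t -> `|t - s| < d -> `|x t - x s - (t - s) *: F (x s)| <= eps * `|t - s|].
Proof.
have [U [UF Uoo]] := ultraFilterLemma (_ : ProperFilter (\oo : set_system nat)).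
pose h m : R := m.+1%:R^-1; pose idx m t := Num.truncn (t * m.+1%:R).
pose X m t := euler (h m) y (idx m t).
have h0 m : 0 < h m by rewrite invr_gt0.
have Uh eps : 0 < eps -> U [set m | h m < eps].
  move=> e0; apply: Uoo; have := near_infty_natSinv_lt (PosNum e0); exact.
have idxP m t : 0 <= t -> (idx m t)%:R * h m <= t < (idx m t)%:R * h m + h m.
  move=> t0; have := truncn_itv (mulr_ge0 t0 (ler0n R m.+1)).
  rewrite -/(idx m t) -[(idx m t).+1%:R]natr1 /h => /andP[h1 h2].
  rewrite ler_pdivrMr // h1 /=.
  by rewrite -[X in _ + X]mul1r -mulrDl ltr_pdivlMr.
have idxS m s t : 0 <= s <= t -> exists2 j, idx m t = (idx m s + j)%N &
    `|j%:R * h m - (t - s)| <= h m.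
  case/andP=> s0 st; have le : (idx m s <= idx m t)%N.
    by apply: le_truncn; rewrite ler_wpM2r.
  exists (idx m t - idx m s)%N; first by rewrite subnKC.
  rewrite natrB // mulrBl ler_norml.
  by have /andP[] := idxP m s s0; have /andP[] := idxP m t (le_trans s0 st); lra.
have Xb m t : 0 <= t -> `|X m t| <= `|y| + (t + 1) * M.
  move=> t0; have /andP[h1 _] := idxP m t t0.
  rewrite -[X m t](subrK y) addrC (le_trans (ler_normD _ _)) // lerD //.
  apply: le_trans (euler_lip y 0 (idx m t) (ltW (h0 m))) _; rewrite ler_wpM2r //; lra.
have /choice[x hx] t : exists p, 0 <= t -> forall eps, 0 < eps -> U [set m | `|X m t - p| < eps].
  have [t0|_] := leP 0 t; last by exists y.
  by have [p hp] := ultra_limit UF (fun m => Xb m t t0); exists p.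
have UFF : ProperFilter U by exact: ultra_proper.
(* Estimates on the polygons pass to the limit when their error is a multiple of [h m + e]: were the
   limit to violate the bound by [gap], the choice of [e] as a small fraction of [gap] would be
   contradicted at some [m]. *)
have lim_le s t (G : 'rV[R]_n) (K : R) : 0 <= s -> 0 <= t ->
    (exists C, forall e, 0 < e -> U [set m | `|X m t - X m s - G| <= K + C * (h m + e)]) ->
    `|x t - x s - G| <= K.
  move=> s0 t0 [C hC]; rewrite leNgt; apply/negP => lt.
  pose gap := `|x t - x s - G| - K.
  have gap0 : 0 < gap by rewrite subr_gt0.
  have C0 : 0 < `|C| + 1 by rewrite ltr_wpDl.
  pose e := gap / (4 * (`|C| + 1)).
  have e0 : 0 < e by rewrite divr_gt0 // mulr_gt0.
  have eE : e * (4 * (`|C| + 1)) = gap by rewrite /e divfK //; lra.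
  have [m [[[/= A1 A2] A3] A4]] := filter_ex (filterI (filterI (filterI
    (hx t t0 e e0) (hx s s0 e e0)) (Uh e e0)) (hC e e0)).
  have : `|x t - x s - G| <= `|X m t - x t| + `|X m s - x s| + `|X m t - X m s - G|.
    rewrite (_ : x t - x s - G = - (X m t - x t) + (X m s - x s) + (X m t - X m s - G)); last first.
      by apply/rowP => i; rewrite !mxE; ring.
    by rewrite (le_trans (ler_normD _ _)) // lerD // (le_trans (ler_normD _ _)) // normrN.
  have : C * (h m + e) <= `|C| * (e + e).
    apply: le_trans (ler_norm _) _; rewrite normrM ler_wpM2l // ger0_norm ?addr_ge0 ?(ltW (h0 _)) ?(ltW e0) //.
    by rewrite lerD2r ltW.
  have C1 := normr_ge0 C; have gE : `|x t - x s - G| = K + gap by rewrite /gap; ring.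
  have hg : e * 2 + 2 * `|C| * e < gap by rewrite -eE; nra.
  move: gE A1 A2 A4; clear -hg; lra.
have xlip s t : 0 <= s <= t -> `|x t - x s| <= M * (t - s).
  move=> /andP[s0 st]; rewrite -[x t - x s]subr0; apply: lim_le => //; first lra.
  exists M => e e0; apply: filterS filterT => m _ /=; rewrite subr0.
  have [j jE hj] := idxS m s t (introT andP (conj s0 st)); rewrite /X jE.
  apply: le_trans (euler_lip _ _ _ (ltW (h0 m))) _.
  by move: hj; rewrite ler_norml => /andP[_ hj]; rewrite -mulrDr mulrC ler_wpM2l //; lra.
exists x; split=> //.
  apply/eqP; rewrite -subr_eq0 -normr_le0 leNgt; apply/negP => lt.
  have [m] := filter_ex (hx 0 (lexx 0) _ lt).
  rewrite /= /X /idx mul0r truncn0 /= distrC ltxx //.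
move=> s s0 cF eps eps0.
have [d d0 hd] : exists2 d : R, 0 < d & forall z, `|z - x s| < d -> `|F z - F (x s)| <= eps.
  by have /continuous_eps/(_ _ eps0)[d d0 hd] := cF; exists d => // z /hd/ltW.
(* At speed at most [M] the polygon covers less than [d / 2] in this time. The rest of [d] absorbs
   one step [h m] and the distance [e'] to the limit, so every vertex stays where [F] is [eps]-close
   to [F (x s)]. *)
exists (d / (2 * (M + 1))); first by rewrite divr_gt0 // mulr_gt0 // ltr_wpDl.
have slope a b : 0 <= a <= b -> `|b - a| < d / (2 * (M + 1)) -> (a = s \/ b = s) ->
    `|x b - x a - (b - a) *: F (x s)| <= eps * (b - a).
  move=> /andP[a0 ab]; rewrite ltr_pdivlMr; last by rewrite mulr_gt0 // ltr_wpDl.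
  rewrite ger0_norm ?subr_ge0 // => abd hs.
  have b0 := le_trans a0 ab.
  apply: lim_le => //; exists (eps + `|F (x s)|) => e e0.
  pose e' := Num.min e (d / (4 * (M + 1))).
  have e'0 : 0 < e' by rewrite lt_min e0 divr_gt0 // mulr_gt0 // ltr_wpDl.
  have e'd : e' * (4 * (M + 1)) <= d.
    by rewrite -ler_pdivlMr ?mulr_gt0 ?ltr_wpDl // ge_min lexx orbT.
  apply: filterS (filterI (filterI (hx a a0 e' e'0) (hx b b0 e' e'0)) (Uh e' e'0)) => m [[/= A1 A2] A3].
  have [j jE hj] := idxS m a b (introT andP (conj a0 ab)).
  have hj' : j%:R * h m <= b - a + h m by move: hj; rewrite ler_norml => /andP[_]; lra.
  have hm0 := h0 m.
  have small p : p <= b - a + h m -> p * M + e' < d.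
    move=> hp; have := ler_wpM2r M0 hp; move: abd e'd A3 (M0) e'0; clear; nra.
  have key i : (i < j)%N -> `|F (euler (h m) y (idx m a + i)) - F (x s)| <= eps.
    move=> ij; apply: hd; case: hs => <-.
      rewrite -(subrKA (X m a)); apply: le_lt_trans (ler_normD _ _) _.
      apply: le_lt_trans (lerD (euler_lip _ _ _ (ltW (h0 m))) (ltW A1)) _.
      have : i%:R * h m <= j%:R * h m by rewrite ler_wpM2r ?(ltW hm0) // ler_nat ltnW.
      move=> /le_trans /(_ hj'); exact: small.
    rewrite -(subrKA (X m b)); apply: le_lt_trans (ler_normD _ _) _.
    apply: le_lt_trans (lerD (lexx _) (ltW A2)) _; rewrite distrC /X jE.
    rewrite -(subnKC (ltnW ij)) addnA.
    apply: le_lt_trans (lerD (euler_lip _ _ _ (ltW (h0 m))) (lexx _)) _.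
    have : (j - i)%:R * h m <= j%:R * h m by rewrite ler_wpM2r ?(ltW hm0) // ler_nat leq_subr.
    move=> /le_trans /(_ hj'); exact: small.
  have := euler_slope (ltW hm0) key; rewrite -jE -/(X m b) -/(X m a) => H.
  rewrite /= (_ : _ - _ = (X m b - X m a - (j%:R * h m) *: F (x s))
     + (j%:R * h m - (b - a)) *: F (x s)); last by apply/rowP => i; rewrite !mxE; ring.
  apply: le_trans (ler_normD _ _) _; apply: le_trans (lerD H (lexx _)) _.
  rewrite normrZ.
  have : `|j%:R * h m - (b - a)| * `|F (x s)| <= h m * `|F (x s)| by rewrite ler_wpM2r.
  have : j%:R * h m * eps <= (b - a + h m) * eps by rewrite ler_wpM2r // ltW.
  have : 0 <= (eps + `|F (x s)|) * e by rewrite mulr_ge0 ?addr_ge0 // ltW.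
  by move: (`|_| * _) (j%:R * h m * eps); clear; move=> *; lra.
move=> t t0; have [st|ts] := leP s t.
  by move=> std; have := slope s t (introT andP (conj s0 st)) std (or_introl erefl);
     rewrite (ger0_norm (_ : 0 <= t - s)) // subr_ge0.
rewrite distrC => std.
have := slope t s (introT andP (conj t0 (ltW ts))) std (or_intror erefl).
have -> : `|s - t| = s - t by rewrite ger0_norm // subr_ge0 ltW.
rewrite -normrN => H.
apply: le_trans H; apply/eq_ler; congr (`|_|).
by apply/rowP => i; rewrite !mxE; ring.
Qed.

End Peano.

Section PeanoTwoSided.
Variables (R : realType) (n : nat) (F : 'rV[R]_n -> 'rV[R]_n) (M : R).
Hypothesis (FM : forall z, `|F z| <= M).
Implicit Types (s t d eps : R).

(** Two forward solutions are glued at time 0, one for [F] and one for [- F] run backwards; at 0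
    both one-sided estimates have slope [F y]. *)
Lemma peano y : exists x : R -> 'rV[R]_n, [/\ x 0 = y,
  (forall t, `|x t - y| <= M * `|t|) &
  forall t, {for x t, continuous F} -> vel x t (F (x t))].
Proof.
have [x [x0 xM xF]] := peano_pos FM y.
have FM' z : `|- F z| <= M by rewrite normrN.
have [x' [x'0 x'M x'F]] := peano_pos FM' y.
pose z t := if 0 <= t then x t else x' (- t).
have z0 : z 0 = y by rewrite /z lexx.
have zN t : t <= 0 -> z t = x' (- t).
  by rewrite le_eqVlt /z => /predU1P[->|]; rewrite ?lexx ?oppr0 ?x0 ?x'0 // ltNge => /negbTE->.
have zP t : 0 <= t -> z t = x t by rewrite /z => ->.
exists z; split=> // [t|t cF eps eps0].
  have [t0|/ltW t0] := leP 0 t.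
    by rewrite zP // -x0 ger0_norm // -[X in M * X]subr0 xM // lexx.
  by rewrite zN // -x'0 ler0_norm // -[X in M * X]subr0 x'M // lexx oppr_ge0.
have posE : 0 <= t -> exists2 d : R, 0 < d & forall s, 0 <= s -> `|s - t| < d ->
    `|z s - z t - (s - t) *: F (z t)| <= eps * `|s - t|.
  move=> t0; have := xF t t0; rewrite -(zP t t0) => /(_ cF _ eps0)[d d0 hd].
  by exists d => // s s0; rewrite (zP s s0); exact: hd.
have negE : t <= 0 -> exists2 d : R, 0 < d & forall s, s <= 0 -> `|s - t| < d ->
    `|z s - z t - (s - t) *: F (z t)| <= eps * `|s - t|.
  move=> t0; have := x'F (- t); rewrite oppr_ge0 -(zN t t0) => /(_ t0).
  have cF' : {for z t, continuous (fun z => - F z)} by apply: continuousN.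
  move=> /(_ cF' _ eps0)[d d0 hd].
  exists d => // s s0 std; rewrite (zN s s0).
  have := hd (- s); rewrite oppr_ge0 => /(_ s0).
  rewrite (_ : - s - - t = - (s - t)); last by ring.
  by rewrite normrN scalerN scaleNr opprK => /(_ std).
have [t0|t0|t0] := ltgtP t 0.
- have [d d0 hd] := negE (ltW t0); exists (Num.min d (- t)); first by rewrite lt_min d0 oppr_gt0.
  move=> s; rewrite lt_min => /andP[h1 h2]; apply: hd => //.
  by move: h2; rewrite ltr_norml => /andP[_]; lra.
- have [d d0 hd] := posE (ltW t0); exists (Num.min d t); first by rewrite lt_min d0.
  move=> s; rewrite lt_min => /andP[h1 h2]; apply: hd => //.
  by move: h2; rewrite ltr_norml => /andP[+ _]; lra.
- have [|d d0 hd] := posE; first by rewrite t0.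
  have [|d' d'0 hd'] := negE; first by rewrite t0.
  exists (Num.min d d'); first by rewrite lt_min d0.
  move=> s; rewrite lt_min => /andP[h1 h2].
  by have [s0|/ltW s0] := leP 0 s; [apply: hd | apply: hd'].
Qed.

End PeanoTwoSided.

(** * Functions of class C^2 *)

Section Continuity.
Variables (R : realType) (V : normedModType R).
Implicit Types (eps d : R) (x : V).

Lemma cont_coord n (g : V -> 'rV[R]_n) x : {for x, continuous g} ->
  forall i, {for x, continuous (fun y => g y 0 i : R^o)}.
Proof.
move=> /continuous_eps h i; apply/continuous_eps => eps /h[d d0 hd]; exists d => // y /hd.
by apply: le_lt_trans; have := coord_le_norm (g y - g x) i; rewrite !mxE.
Qed.

Lemma coord_cont n (g : V -> 'rV[R]_n) x :
  (forall i, {for x, continuous (fun y => g y 0 i : R^o)}) -> {for x, continuous g}.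
Proof.
move=> h; apply/continuous_eps => eps eps0.
have e20 : 0 < eps / 2 by rewrite divr_gt0.
have /choice[e he] i : exists d, 0 < d /\ forall y, `|y - x| < d -> `|g y 0 i - g x 0 i| < eps / 2.
  by have /continuous_eps/(_ _ e20)[d] := h i; exists d.
exists (\big[Num.min/1]_i e i).
  by apply: lt_bigmin => // i _; have [] := he i.
move=> y hy; apply: (@le_lt_trans _ _ (eps / 2)); last by lra.
apply: norm_le_coord => [|i]; first exact: ltW.
rewrite !mxE; have [_ hi] := he i; apply: ltW; apply: hi.
exact: lt_le_trans hy (bigmin_le_cond _ _ _).
Qed.

Lemma cont_dot (g h : V -> 'rV[R]_3) x : {for x, continuous g} -> {for x, continuous h} ->
  {for x, continuous (fun y => g y *d h y : R^o)}.
Proof.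
move=> /cont_coord hg /cont_coord hh.
have -> : (fun y => g y *d h y) = (fun y => g y 0 0 * h y 0 0 + g y 0 1 * h y 0 1
   + g y 0 (2:'I_3) * h y 0 (2:'I_3)) by apply/funext => y; rewrite dotE.
by apply: cvgD; [apply: cvgD|]; apply: cvgM; (exact: hg || exact: hh).
Qed.

Lemma cont_mulmx (g : V -> 'rV[R]_3) (A : V -> 'M[R]_3) x : {for x, continuous g} ->
  (forall i j, {for x, continuous (fun y => A y i j : R^o)}) ->
  {for x, continuous (fun y => g y *m A y)}.
Proof.
move=> /cont_coord hg hA; apply: coord_cont => j.
have -> : (fun y => (g y *m A y) 0 j) = (fun y => g y *d (\row_i A y i j) : R^o).
  by apply/funext => y; rewrite mxE /dotv; apply: eq_bigr => i _; rewrite mxE.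
apply: cont_dot; first by apply: coord_cont.
apply: coord_cont => i; have -> : (fun y => (\row_i A y i j) 0 i) = (fun y => A y i j) => //.
by apply/funext => y; rewrite mxE.
Qed.

End Continuity.

(** * Strict differentiability of C^1 functions and symmetry of the Hessian *)

Section StrictDerivative.
Variable R : realType.
Implicit Types (x y z u v w : 'rV[R]_3) (eps d s t : R) (i j : 'I_3) (g f : 'rV[R]_3 -> R^o).

Definition bvec i : 'rV[R]_3 := delta_mx 0 i.
Definition grad g x : 'rV[R]_3 := \row_i 'D_(bvec i) g x.
Definition hess g x : 'M[R]_3 := \matrix_(i, j) 'D_(bvec i) ('D_(bvec j) g) x.

Lemma vel_line g x v s : derivable g (x + s *: v) v ->
  vel (fun t => g (x + t *: v)) s ('D_v g (x + s *: v)).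
Proof.
move=> dg eps eps0.
have /cvgrPdist_le /(_ _ eps0)/nbhs_eps[d d0 hd] := dg; exists d => // t.
have [->|ts] := eqVneq t s.
  by move=> _; rewrite !subrr scale0r subr0 !normr0 mulr0.
have ts0 : t - s != 0 by rewrite subr_eq0.
move=> td; have := hd (t - s); rewrite subr0 => /(_ td ts0).
rewrite distrC norm_slope // ler_pdivrMr ?normr_gt0 //= /shift /=.
by rewrite (_ : (t - s) *: v + (x + s *: v) = x + t *: v) // scalerBl addrC addrA addrAC addrK.
Qed.

Lemma mean_value_line g x v s :
  (forall t, 0 <= t <= 1 -> derivable g (x + (s * t) *: v) v) ->
  exists2 t, 0 <= t <= 1 & g (x + s *: v) - g x = s * 'D_v g (x + (s * t) *: v).
Proof.
move=> h; pose phi t := g (x + t *: v).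
have [|t /andP[t0 t1]] := @mean_value R (fun t => phi (s * t + 0)) (fun t => s * 'D_v g (x + (s * t) *: v)) 0 1 ltr01.
  move=> t t01; apply: (@vel_affine _ _ phi) ; rewrite addr0; apply: vel_line; exact: h.
rewrite /phi !addr0 mulr1 mulr0 scale0r addr0 subr0 mul1r => e; exists t => //.
by rewrite !ltW.
Qed.

Lemma norm_between u v t d : 0 <= t <= 1 -> `|u| < d -> `|v| < d -> `|u + t *: (v - u)| < d.
Proof.
move=> /andP[t0 t1] ud vd.
rewrite (_ : _ + _ = (1 - t) *: u + t *: v); last by apply/rowP => i; rewrite !mxE; ring.
have ht : `|1 - t| = 1 - t by rewrite ger0_norm // subr_ge0.
apply: le_lt_trans (ler_normD _ _) _; rewrite !normrZ ht (ger0_norm t0).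
have : Num.max `|u| `|v| < d by rewrite gt_max ud.
have A : `|u| <= Num.max `|u| `|v| by rewrite le_max lexx.
have B : `|v| <= Num.max `|u| `|v| by rewrite le_max lexx orbT.
apply: le_lt_trans.
have t1' : 0 <= 1 - t by rewrite subr_ge0.
by apply: le_trans (lerD (ler_wpM2l t1' A) (ler_wpM2l t0 B)) _; apply/eq_ler; ring.
Qed.

(** Strict differentiability: both [y] and [z] move near [x]. Unlike differentiability at [x], it
    constrains the increments between nearby points, hence also derivatives at those points. *)
Definition sdiff (W : normedModType R) (g : 'rV[R]_3 -> W) x (L : 'rV[R]_3 -> W) :=
  forall eps, 0 < eps -> exists2 d, 0 < d & forall y z, `|y - x| < d -> `|z - x| < d ->
    `|g y - g z - L (y - z)| <= eps * `|y - z|.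

Lemma bvecE i j : bvec i 0 j = (j == i)%:R.
Proof. by rewrite mxE eqxx. Qed.

(** One goes from [z] to [y] through the corners [z1], [z2] of a box, changing one coordinate at a
    time. On each edge the mean value theorem applies, with a partial derivative within [eps / 3] of
    its value at [x]. Balls of the sup norm contain the corners. *)
Lemma sdiff_grad (U : set 'rV[R]_3) g x : open U -> Ck 1 U g -> U x ->
  sdiff g x (fun u => u *d grad g x).
Proof.
move=> oU [cg [dg Cg]] Ux eps eps0.
have e30 : 0 < eps / 3 by rewrite divr_gt0.
have /nbhs_eps[d1 d10 hd1] : nbhs x U by exact: open_nbhs_nbhs.
have /choice[e he] i : exists d, 0 < d /\ forall y, `|y - x| < d ->
    `|'D_(bvec i) g y - 'D_(bvec i) g x| < eps / 3.
  have [/(_ x Ux) /continuous_eps /(_ _ e30)[d] d0 hd _] := Cg (bvec i); by exists d.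
pose d := Num.min d1 (Num.min (e 0) (Num.min (e 1) (e (2:'I_3)))).
have [e0 h0] := he 0; have [e1 h1] := he 1; have [e2 h2] := he (2 : 'I_3).
exists d; first by rewrite /d !lt_min d10 e0 e1.
have step i w s : `|w - x| < d -> `|w + s *: bvec i - x| < d ->
    `|g (w + s *: bvec i) - g w - s * 'D_(bvec i) g x| <= eps / 3 * `|s|.
  move=> wd wd'.
  have ball t : 0 <= t <= 1 -> `|w + (s * t) *: bvec i - x| < d.
    move=> t01; have := norm_between t01 wd wd'; apply: le_lt_trans; apply/eq_ler; congr (`|_|).
    by apply/rowP => j; rewrite !mxE; ring.
  have [t t01|t t01 ->] := @mean_value_line g w (bvec i) s.
    by apply: dg; apply: hd1; apply: lt_le_trans (ball t t01) _; rewrite /d ge_min lexx.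
  have [_ hi] := he i.
  rewrite -mulrBr normrM mulrC ler_wpM2r //; apply: ltW; apply: hi.
  apply: lt_le_trans (ball t t01) _; rewrite /d !ge_min.
  by rewrite /d; clear; move: i; apply: I3P; rewrite lexx ?orbT.
move=> y z yd zd.
pose z1 := z + (y 0 0 - z 0 0) *: bvec 0.
pose z2 := z1 + (y 0 1 - z 0 1) *: bvec 1.
have e3 : y = z2 + (y 0 (2:'I_3) - z 0 (2:'I_3)) *: bvec 2.
  by apply: row3P; rewrite /z2 /z1 /bvec !mxE /=; ring.
have zball w : (forall i, w 0 i = y 0 i \/ w 0 i = z 0 i) -> `|w - x| < d.
  move=> hw; apply: le_lt_trans (_ : Num.max `|y - x| `|z - x| < d); last by rewrite gt_max yd.
  apply: norm_le_coord => [|i]; first by rewrite le_max normr_ge0.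
  have A := coord_le_norm (y - x) i; have B := coord_le_norm (z - x) i.
  by rewrite le_max; case: (hw i); move: A B; rewrite !mxE => A B ->; rewrite ?A ?B ?orbT.
have z1d : `|z1 - x| < d.
  by apply: zball; apply: I3P; [left | right | right]; rewrite /z1 /bvec !mxE /=; ring.
have z2d : `|z2 - x| < d.
  by apply: zball; apply: I3P; [left | left | right]; rewrite /z2 /z1 /bvec !mxE /=; ring.
have s0 := step 0 z _ zd z1d; have s1 := step 1 z1 _ z1d z2d.
have s2 := step 2 z2 (y 0 (2:'I_3) - z 0 (2:'I_3)) z2d.
rewrite -e3 in s2; have {}s2 := s2 yd.
rewrite dotE (_ : _ - _ = (g z1 - g z - (y 0 0 - z 0 0) * 'D_(bvec 0) g x)
 + (g z2 - g z1 - (y 0 1 - z 0 1) * 'D_(bvec 1) g x)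
 + (g y - g z2 - (y 0 (2:'I_3) - z 0 (2:'I_3)) * 'D_(bvec 2) g x)); last by rewrite !mxE; ring.
clear -s0 s1 s2 e30.
have c0 := coord_le_norm (y - z) 0; have c1 := coord_le_norm (y - z) 1.
have c2 := coord_le_norm (y - z) (2:'I_3); move: c0 c1 c2; rewrite !mxE => c0 c1 c2.
apply: le_trans (ler_normD _ _) _; apply: le_trans (lerD (ler_normD _ _) (lexx _)) _.
apply: le_trans (lerD (lerD (le_trans s0 (ler_wpM2l (ltW e30) c0))
  (le_trans s1 (ler_wpM2l (ltW e30) c1))) (le_trans s2 (ler_wpM2l (ltW e30) c2))) _.
by apply/eq_ler; move: (`|y - z|) => n; field.
Qed.

Lemma sdiff_row (F : 'rV[R]_3 -> 'rV[R]_3) x (A : 'M[R]_3) :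
  (forall i, sdiff (fun y => F y 0 i : R^o) x (fun u => u *d (\row_j A j i))) ->
  sdiff F x (fun u => u *m A).
Proof.
move=> h eps eps0.
have /choice[e he] i : exists d, 0 < d /\ forall y z, `|y - x| < d -> `|z - x| < d ->
    `|F y 0 i - F z 0 i - (y - z) *d (\row_j A j i)| <= eps * `|y - z|.
  by have [d] := h i _ eps0; exists d.
exists (\big[Num.min/1]_i e i).
  by apply: lt_bigmin => // i _; have [] := he i.
move=> y z yd zd; apply: norm_le_coord => [|i]; first by rewrite mulr_ge0 // ltW.
have [_ hi] := he i; have := hi y z (lt_le_trans yd (bigmin_le_cond _ _ _)) (lt_le_trans zd (bigmin_le_cond _ _ _)).
move=> /(_ isT isT); apply: le_trans; apply/eq_ler; congr (`|_|).
rewrite !mxE; congr (_ - _); rewrite /dotv; apply: eq_bigr => j _.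
by rewrite !mxE.
Qed.

Variables (U : set 'rV[R]_3) (f : 'rV[R]_3 -> R^o).
Hypotheses (oU : open U) (f2 : Ck 2 U f).

Lemma Ck2_Ck1 : Ck 1 U f.
Proof. by case: f2 => ? [? h]; split=> //; split=> // v; case: (h v). Qed.

Lemma sdiff_hess x : U x -> sdiff (grad f) x (fun u => u *m hess f x).
Proof.
move=> Ux; apply: sdiff_row => i; case: f2 => _ [_ h].
have := sdiff_grad oU (h (bvec i)) Ux => H eps /H[d d0 hd]; exists d => // y z yd zd.
have := hd y z yd zd; rewrite !mxE; apply: le_trans; apply/eq_ler; congr (`| _ - _ |).
by congr (_ *d _); apply/rowP => j; rewrite !mxE.
Qed.

Lemma hess_cont x i j : U x -> {for x, continuous (fun y => hess f y i j : R^o)}.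
Proof.
move=> Ux; case: f2 => _ [_ h]; have [_ [_ /(_ (bvec i)) [/(_ x Ux) c _]]] := h (bvec j).
by rewrite (_ : (fun y => hess f y i j) = 'D_(bvec i) ('D_(bvec j) f)) //; apply/funext => y; rewrite mxE.
Qed.

Lemma mixed_difference (a b c e q P Q eps : R) : 0 < q ->
  `|e - c - (b - a) - q * P| <= eps / 2 * q -> `|e - b - (c - a) - q * Q| <= eps / 2 * q ->
  `|P - Q| <= eps.
Proof.
move=> q0; rewrite !ler_norml => /andP[h1 h2] /andP[h3 h4].
by apply/andP; split; rewrite -(ler_pM2l q0) mulrBr ?mulrN; lra.
Qed.

(** The second difference of [f] over a square of side [s] is symmetric in the two directions. By
    the mean value theorem it is a first difference of one partial derivative, so by strict
    differentiability it is [s * s] times either mixed derivative, up to [eps / 2 * (s * s)]. *)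
Lemma hess_sym x : U x -> (hess f x)^T = hess f x.
Proof.
move=> Ux; apply/matrixP => i j; rewrite !mxE.
apply/eqP; rewrite -subr_eq0 -normr_le0; apply/ler_addgt0Pl => eps eps0; rewrite addr0.
have e20 : 0 < eps / 2 by rewrite divr_gt0.
case: f2 => cf [df h].
have /nbhs_eps[d1 d10 hd1] : nbhs x U by exact: open_nbhs_nbhs.
have key k l : exists2 d, 0 < d & forall s, 0 < s < d ->
  `|f (x + s *: bvec k + s *: bvec l) - f (x + s *: bvec k) - (f (x + s *: bvec l) - f x)
    - s * s * 'D_(bvec k) ('D_(bvec l) f) x| <= eps / 2 * (s * s).
  have [d2 d20 hd2] := sdiff_grad oU (h (bvec l)) Ux e20.
  pose d := Num.min d1 d2; exists (d / 2); first by rewrite divr_gt0 // lt_min d10.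
  move=> s /andP[s0 sd].
  have b1 m : `|bvec m| <= 1.
    by apply: norm_le_coord => // n; rewrite bvecE; case: eqP; rewrite ?normr1 ?normr0.
  have bd a b m n : 0 <= a <= s -> 0 <= b <= s -> `|x + a *: bvec m + b *: bvec n - x| < d.
    move=> /andP[a0 a1] /andP[b0 b2]; rewrite (_ : _ - x = a *: bvec m + b *: bvec n); last by apply/rowP => q; rewrite !mxE; ring.
    apply: le_lt_trans (ler_normD _ _) _; rewrite !normrZ !ger0_norm //.
    have := ler_wpM2l a0 (b1 m); have := ler_wpM2l b0 (b1 n); lra.
  pose phi (y : 'rV[R]_3) := f (y + s *: bvec k) - f y.
  have st t : 0 <= t <= 1 -> 0 <= s * t <= s.
    by move=> /andP[t0 t1]; rewrite mulr_ge0 ?ler_piMr // ltW.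
  have dphi y : `|y - x| < d -> `|y + s *: bvec k - x| < d ->
      is_derive y (bvec l) phi ('D_(bvec l) f (y + s *: bvec k) - 'D_(bvec l) f y).
    move=> yd ysd; apply: is_deriveB; last first.
      by apply: derivableP; apply: df; apply: hd1; apply: lt_le_trans yd _; rewrite ge_min lexx.
    have [] : is_derive (y + s *: bvec k) (bvec l) f ('D_(bvec l) f (y + s *: bvec k)).
      by apply: derivableP; apply: df; apply: hd1; apply: lt_le_trans ysd _; rewrite ge_min lexx.
    rewrite /derivable /derive /shift /= => e1 e2; split; rewrite /derivable /derive /shift /=.
      by under eq_fun do rewrite -addrA; exact: e1.
    by under eq_fun do rewrite -addrA.
  have [t t01|t t01] := @mean_value_line phi x (bvec l) s.
    have [h1 h2] := (st _ t01, lexx s).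
    have := bd (s * t) 0 l l (st _ t01); rewrite scale0r addr0 lexx (ltW s0) => /(_ isT) B1.
    have := bd (s * t) s l k (st _ t01); rewrite lexx (ltW s0) => /(_ isT) B2.
    by have [] := dphi _ B1 B2.
  have := bd (s * t) 0 l l (st _ t01); rewrite scale0r addr0 lexx (ltW s0) => /(_ isT) B1.
  have := bd (s * t) s l k (st _ t01); rewrite lexx (ltW s0) => /(_ isT) B2.
  have [_ ->] := dphi _ B1 B2.
  rewrite {1}/phi {1}/phi (addrAC x) => e.
  have := hd2 (x + (s * t) *: bvec l + s *: bvec k) (x + (s * t) *: bvec l).
  rewrite (lt_le_trans B2) ?ge_min ?lexx ?orbT // (lt_le_trans B1) ?ge_min ?lexx ?orbT //.
  move=> /(_ isT isT); rewrite (addrAC _ (s *: _)) subrr add0r dotZl.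
  have -> : bvec k *d grad ('D_(bvec l) f) x = 'D_(bvec k) ('D_(bvec l) f) x.
    rewrite /dotv (bigD1 k) //= bvecE eqxx mul1r mxE big1 ?addr0 // => m mk.
    by rewrite bvecE (negbTE mk) mul0r.
  rewrite normrZ (ger0_norm (ltW s0)) => H.
  rewrite (_ : _ - _ = s * ('D_(bvec l) f (x + (s * t) *: bvec l + s *: bvec k) -
     'D_(bvec l) f (x + (s * t) *: bvec l) - s * 'D_(bvec k) ('D_(bvec l) f) x)); last first.
    by rewrite mulrBr -e; ring.
  rewrite normrM (ger0_norm (ltW s0)) mulrA mulrAC [X in _ <= X]mulrC ler_wpM2l ?(ltW s0) //.
  apply: le_trans H _; rewrite ler_wpM2l ?(ltW e20) //.
  by have := ler_wpM2l (ltW s0) (b1 k); rewrite mulr1.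
have [d d0 hd] := key i j; have [d' d'0 hd'] := key j i.
pose s := Num.min d d' / 2.
have m0 : 0 < Num.min d d' by rewrite lt_min d0.
have s0 : 0 < s by rewrite divr_gt0.
have sd : s < Num.min d d' by rewrite /s; lra.
move: (sd); rewrite lt_min => /andP[sd1 sd2].
have := hd s; rewrite s0 sd1 => /(_ isT); have := hd' s; rewrite s0 sd2 => /(_ isT).
rewrite (addrAC x); have ss0 : 0 < s * s by rewrite mulr_gt0.
move: (f _) (f _) (f _) (f _) ('D__ ('D__ f) x) ('D__ ('D__ f) x) => a b c e Q P h1 h2.
exact: (@mixed_difference a b c e (s * s) P Q eps ss0 h1 h2).
Qed.

End StrictDerivative.

(** * Charts and their geodesics *)

Section Chart.
Variable R : realType.
Implicit Types (p x y u v w n : 'rV[R]_3) (eps d s t : R) (i j : 'I_3) (K : set 'rV[R]_3)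
  (f : 'rV[R]_3 -> R^o) (G : 'rV[R]_3 -> 'rV[R]_3) (H : 'rV[R]_3 -> 'M[R]_3).

(** [f] is a local equation, [G] its gradient and [H] its Hessian. Everything is required at each
    point of the ball, so that a chart can be recentred at a nearby point with a smaller radius. *)
Definition is_chart K p f G H d :=
  0 < d /\ forall x, `|x - p| < d ->
  [/\ K x <-> f x = 0, sdiff f x (fun u => u *d G x), sdiff G x (fun u => u *m H x) &
  [/\ (H x)^T = H x, G x != 0 & forall i j, {for x, continuous (fun y => H y i j : R^o)}]].

Lemma sdiff_continuous (W : normedModType R) (g : 'rV[R]_3 -> W) x L M : 0 <= M ->
  (forall u, `|L u| <= M * `|u|) -> sdiff g x L -> {for x, continuous g}.
Proof.
move=> M0 LM /(_ 1 ltr01)[d d0 hd]; apply/continuous_eps => eps eps0.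
have M1 : 0 < 1 + M by rewrite ltr_wpDr.
exists (Num.min d (eps / (1 + M))); first by rewrite lt_min d0 divr_gt0.
move=> y; rewrite lt_min => /andP[yd]; rewrite ltr_pdivlMr // => ye.
rewrite -[g y - g x](subrK (L (y - x))); apply: le_lt_trans (ler_normD _ _) _.
apply: le_lt_trans (lerD (hd y x yd _) (LM _)) _; first by rewrite subrr normr0.
by rewrite -mulrDl mulrC.
Qed.

Lemma sdiff_dot_continuous g x w : sdiff (g : 'rV[R]_3 -> R^o) x (fun u => u *d w) -> {for x, continuous g}.
Proof.
apply: (sdiff_continuous (M := 3 * `|w|)) => [|u]; first by rewrite mulr_ge0.
by rewrite mulrAC; exact: dot_le_norm.
Qed.

Lemma sdiff_mulmx_continuous G x A : sdiff G x (fun u => u *m A) -> {for x, continuous G}.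
Proof.
apply: (sdiff_continuous (M := 3 * `|A|)) => [|u]; first by rewrite mulr_ge0.
by rewrite mulrAC; exact: mulmx_le_norm.
Qed.

Lemma sdiff_neq0 f x w v : sdiff f x (fun u => u *d w) -> derivable f x v -> 'D_v f x != 0 -> w != 0.
Proof.
move=> sf df; apply: contraNneq => w0.
have dl : derivable f (x + 0 *: v) v by rewrite scale0r addr0.
have := vel_line dl; rewrite scale0r addr0 => h1.
apply/eqP; apply: (vel_unique h1) => eps eps0.
have V0 : 0 < 1 + `|v| by rewrite ltr_pwDl.
have [d d0 hd] := sf (eps / (1 + `|v|)) (divr_gt0 eps0 V0).
exists (d / (1 + `|v|)); first by rewrite divr_gt0.
move=> s; rewrite subr0 ltr_pdivlMr // => sd.
have sv : `|s *: v| < d by rewrite normrZ; apply: le_lt_trans sd; rewrite ler_wpM2l // lerDr.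
have := hd (x + s *: v) x; rewrite addrAC subrr add0r normr0 => /(_ sv d0).
rewrite w0 dot0r scaler0 !subr0 scale0r addr0 => /le_trans; apply.
rewrite normrZ (_ : eps / _ * _ = (eps * `|s|) * (`|v| / (1 + `|v|))); last by ring.
rewrite -[leRHS]mulr1 ler_wpM2l ?mulr_ge0 ?(ltW eps0) //.
by rewrite ler_pdivrMr // mul1r lerDr.
Qed.

Lemma C2_chart K p : C2_surface K -> K p -> exists f G H d, is_chart K p f G H d.
Proof.
move=> [_ /[apply]] [U [f [oU Up f2 fK [v0 Dv0]]]].
have f1 := Ck2_Ck1 f2.
have sd x : U x -> sdiff f x (fun u => u *d grad f x) by exact: sdiff_grad f1.
have Gp : grad f p != 0.
  by apply: (sdiff_neq0 (sd _ Up)) Dv0; case: f1 => _ [h _]; exact: h.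
have /continuous_eps cG : {for p, continuous (grad f)}.
  by apply: sdiff_mulmx_continuous (sdiff_hess oU f2 Up).
have G0 : 0 < `|grad f p| by rewrite normr_gt0.
have [d1 d10 hd1] := cG _ G0.
have /nbhs_eps[d2 d20 hd2] : nbhs p U by exact: open_nbhs_nbhs.
exists f, (grad f), (hess f), (Num.min d1 d2); split; first by rewrite lt_min d10.
move=> x; rewrite lt_min => /andP[/hd1 xG /hd2 Ux]; split.
- exact: fK.
- exact: sd.
- exact (sdiff_hess oU f2 Ux).
split; first exact: (hess_sym oU f2).
- by apply: contraTneq xG => ->; rewrite sub0r normrN ltxx.
- by move=> i j; apply hess_cont with U.
Qed.

Lemma is_chartN K p f G H d : is_chart K p f G H d ->
  is_chart K p (fun x => - f x) (fun x => - G x) (fun x => - H x) d.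
Proof.
move=> [d0 h]; split=> // x /h[fK sf sG [Hs G0 cH]]; split.
- by rewrite fK; split=> [->|/eqP]; rewrite ?oppr0 // oppr_eq0 => /eqP.
- move=> eps /sf[e e0 he]; exists e => // y z yd zd.
  by rewrite dotNr -!opprD normrN; exact: he.
- move=> eps /sG[e e0 he]; exists e => // y z yd zd.
  by rewrite mulmxN -!opprD normrN; exact: he.
split; first by rewrite linearN /= Hs.
- by rewrite oppr_eq0.
- move=> i j; rewrite (_ : (fun y => _) = (fun y => - (H y i j) : R^o)); first exact: continuousN.
  by apply/funext => y; rewrite mxE.
Qed.

Lemma norm_lsubmx (k l : nat) (z : 'rV[R]_(k + l)) : `|lsubmx z| <= `|z|.
Proof. by apply: norm_le_coord => // i; rewrite mxE coord_le_norm. Qed.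
Lemma norm_rsubmx (k l : nat) (z : 'rV[R]_(k + l)) : `|rsubmx z| <= `|z|.
Proof. by apply: norm_le_coord => // i; rewrite mxE coord_le_norm. Qed.
Lemma norm_row_mx (k l : nat) (a : 'rV[R]_k) (b : 'rV[R]_l) e : 0 <= e -> `|a| <= e -> `|b| <= e -> `|row_mx a b| <= e.
Proof.
move=> e0 ae be; apply: norm_le_coord => // i; rewrite mxE.
by case: splitP => j _; [apply: le_trans ae | apply: le_trans be]; exact: coord_le_norm.
Qed.

Lemma vel_lsubmx (k l : nat) (c : R -> 'rV[R]_(k + l)) t (v : 'rV[R]_(k + l)) :
  vel c t v -> vel (fun s => lsubmx (c s)) t (lsubmx v).
Proof.
move=> h; apply: coord_vel => i; rewrite mxE.
by rewrite (_ : (fun s => _) = (fun s => c s 0 (lshift l i))); [exact: vel_coord | apply/funext => s; rewrite mxE].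
Qed.
Lemma vel_rsubmx (k l : nat) (c : R -> 'rV[R]_(k + l)) t (v : 'rV[R]_(k + l)) :
  vel c t v -> vel (fun s => rsubmx (c s)) t (rsubmx v).
Proof.
move=> h; apply: coord_vel => i; rewrite mxE.
by rewrite (_ : (fun s => _) = (fun s => c s 0 (rshift k i))); [exact: vel_coord | apply/funext => s; rewrite mxE].
Qed.

Lemma sdiff_fdiff (W : normedModType R) (P : set 'rV[R]_3) (g : 'rV[R]_3 -> W) x L :
  P x -> sdiff g x L -> fdiff P g x L.
Proof.
move=> Px sg eps /sg[d d0 hd]; exists d => // y _ yd.
by apply: hd => //; rewrite subrr normr0.
Qed.

Lemma vel_mulmx (P : set 'rV[R]_3) G (c : R -> 'rV[R]_3) t v A d : 0 < d ->
  (forall s, `|s - t| < d -> P (c s)) -> fdiff P G (c t) (fun u => u *m A) ->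
  vel c t v -> vel (fun s => G (c s)) t (v *m A).
Proof.
move=> d0 hP hG hc; apply: (@vel_comp _ _ _ P G c t v (fun u => u *m A) (3 * `|A|) d) => //.
- by move=> *; rewrite mulmxBl.
- by move=> *; rewrite scalemxAl.
- by move=> u; rewrite mulrAC; exact: mulmx_le_norm.
Qed.

Lemma vel_dotr (P : set 'rV[R]_3) f (c : R -> 'rV[R]_3) t v w d : 0 < d ->
  (forall s, `|s - t| < d -> P (c s)) -> fdiff P f (c t) (fun u => u *d w) ->
  vel c t v -> vel (fun s => f (c s)) t (v *d w : R^o).
Proof.
move=> d0 hP hG hc; apply: (@vel_comp _ _ _ P f c t v (fun u => u *d w) (3 * `|w|) d) => //.
- by move=> *; rewrite dotBl.
- by move=> *; rewrite dotZl.
- by move=> u; rewrite mulrAC; exact: dot_le_norm.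
Qed.

(** An acceleration along [G] that keeps [w *d G c = 0] must be [acc]: differentiate that relation
    once. This is a first-order system for position and velocity, in dimension 6, to which [peano]
    applies. The constants do not depend on [y] and [v], which later arguments need. *)
Lemma chart_geodesic K p f G H d : is_chart K p f G H d ->
  exists d1 tau M, [/\ 0 < d1, 0 < tau, 0 <= M & forall y v, `|y - p| < d1 -> K y ->
    v *d v = 1 -> v *d G y = 0 -> exists c w a : R -> 'rV[R]_3,
    [/\ c 0 = y, w 0 = v, forall t, `|c t - y| <= M * `|t|, forall t, `|w t - v| <= M * `|t| &
     forall t, `|t| < tau -> [/\ `|c t - p| < d, K (c t), vel c t (w t), vel w t (a t) &
       [/\ {for t, continuous (a : R^o -> 'rV[R]_3)}, exists k, a t = k *: G (c t),
         w t *d w t = 1 & w t *d G (c t) = 0]]]].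
Proof.
move=> [d0 hch].
have [fKp sfp sGp [Hsp Gp cHp]] := hch p ltac:(by rewrite subrr normr0).
have cG x : `|x - p| < d -> {for x, continuous G}.
  by move=> /hch[_ _ /sdiff_mulmx_continuous].
have cGG x : `|x - p| < d -> {for x, continuous (fun y => G y *d G y : R^o)}.
  by move=> /cG c; apply: cont_dot.
have pp : `|p - p| < d by rewrite subrr normr0.
have c0 : 0 < G p *d G p := dot_gt0 Gp.
pose c1 := (G p *d G p) / 2; have c10 : 0 < c1 by rewrite divr_gt0.
have /continuous_eps/(_ _ c10)[d1 d10 hd1] := cGG p pp.
have /continuous_eps/(_ _ ltr01)[d2 d20 hd2] := cG p pp.
have /choice[e he] ij : exists e, 0 < e /\ forall y, `|y - p| < e -> `|H y ij.1 ij.2 - H p ij.1 ij.2| < 1.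
  by have /continuous_eps/(_ _ ltr01)[e] := cHp ij.1 ij.2; exists e.
pose d3 := \big[Num.min/1]_ij e ij.
have d30 : 0 < d3 by apply: lt_bigmin => // i _; have [] := he i.
pose d' := Num.min d (Num.min d1 (Num.min d2 d3)).
have d'0 : 0 < d' by rewrite !lt_min d0 d10 d20.
have dd x : `|x - p| < d' -> `|x - p| < d by move=> h; apply: lt_le_trans h _; rewrite ge_min lexx.
pose B := `|G p| + 1; pose C := `|H p| + 1.
have GB x : `|x - p| < d' -> `|G x| <= B.
  rewrite !lt_min => /and4P[_ _ /hd2 h _]; rewrite -(subrK (G p) (G x)) addrC.
  by apply: le_trans (ler_normD _ _) _; rewrite lerD2l ltW.
have GGc x : `|x - p| < d' -> c1 <= G x *d G x.
  rewrite !lt_min => /and4P[_ /hd1 + _ _]; rewrite ltr_norml => /andP[+ _].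
  rewrite /c1; move: (G p *d G p) => a; lra.
have HC x : `|x - p| < d' -> `|H x| <= C.
  rewrite !lt_min => /and4P[_ _ _ h]; rewrite [leLHS]mx_normrE; apply: bigmax_le => [|ij _].
    by rewrite addr_ge0.
  have [_ /(_ x)] := he ij; rewrite (lt_le_trans h (bigmin_le_cond _ _ _)) // => /(_ isT) h1.
  rewrite -(subrK (H p ij.1 ij.2) (H x _ _)) addrC; apply: le_trans (ler_normD _ _) _.
  rewrite lerD ?(ltW h1) // [leRHS]mx_normrE.
  exact: (le_bigmax_cond _ (fun ij => `|H p ij.1 ij.2|)).
pose acc (z : 'rV[R]_(3 + 3)) := let x := lsubmx z in let v := rsubmx z in
  - ((v *m H x) *d v / (G x *d G x)) *: G x.
(* Setting the field to 0 outside this region makes it bounded everywhere. The jump at the edge is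
   harmless: trajectories stay inside until time [tau]. *)
pose reg (z : 'rV[R]_(3 + 3)) := (`|lsubmx z - p| < d') && (`|rsubmx z| < 2).
pose F (z : 'rV[R]_(3 + 3)) : 'rV[R]_(3 + 3) := if reg z then row_mx (rsubmx z) (acc z) else 0.
pose M := 2 + 3 * (3 * 2 * C) * 2 / c1 * B.
have B0 : 0 <= B by rewrite addr_ge0.
have C0 : 0 <= C by rewrite addr_ge0.
have M20 : 0 <= 3 * (3 * 2 * C) * 2 / c1 * B.
  by rewrite mulr_ge0 // divr_ge0 ?(ltW c10) // !mulr_ge0.
have M0 : 0 <= M by rewrite addr_ge0.
have FM z : `|F z| <= M.
  rewrite /F; case: ifP => [/andP[h1 h2]|_]; last by rewrite normr0.
  apply: norm_row_mx => //; first by rewrite (le_trans (ltW h2)) // lerDl.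
  rewrite (le_trans (_ : _ <= 3 * (3 * 2 * C) * 2 / c1 * B)) //; last by rewrite lerDr.
  rewrite /acc /= normrZ normrN normrM ler_pM // ?GB //.
  rewrite ler_pM //; last first.
    rewrite ger0_norm ?invr_ge0 ?dot_ge0 // lef_pV2 ?GGc // posrE.
    by apply: lt_le_trans (GGc _ h1).
  apply: le_trans (dot_le_norm _ _) _; rewrite ler_pM ?(ltW h2) // ?mulr_ge0 //.
  rewrite ler_wpM2l //; apply: le_trans (mulmx_le_norm _ _) _.
  by rewrite ler_pM ?mulr_ge0 // ?HC // ler_wpM2l // ltW.
have cl z : {for z, continuous (fun z : 'rV[R]_(3+3) => lsubmx z)}.
  apply/continuous_eps => eps eps0; exists eps => // y; rewrite -linearB /=.
  exact: le_lt_trans (norm_lsubmx _).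
have cr z : {for z, continuous (fun z : 'rV[R]_(3+3) => rsubmx z)}.
  apply/continuous_eps => eps eps0; exists eps => // y; rewrite -linearB /=.
  exact: le_lt_trans (norm_rsubmx _).
have cacc z : reg z -> {for z, continuous acc}.
  move=> /andP[/[dup] xd' /dd xd vd].
  have cGz : {for z, continuous (fun z => G (lsubmx z))}.
    exact: (@continuous_comp _ _ _ (fun z : 'rV[R]_(3+3) => lsubmx z) G z (cl z) (cG _ xd)).
  have c3 : {for z, continuous (fun z : 'rV[R]_(3 + 3) => rsubmx z *m H (lsubmx z) *d rsubmx z : R^o)}.
    have [_ _ _ [_ _ cH]] := hch _ xd.
    have cHz i j : {for z, continuous (fun z : 'rV[R]_(3 + 3) => H (lsubmx z) i j : R^o)}.
      exact: (@continuous_comp _ _ _ (fun z : 'rV[R]_(3+3) => lsubmx z) (fun x => H x i j : R^o) z (cl z) (cH i j)).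
    exact (@cont_dot R _ _ _ z (@cont_mulmx R _ _ (fun z => H (lsubmx z)) z (cr z) cHz) (cr z)).
  have g0 : G (lsubmx z) *d G (lsubmx z) != 0 by rewrite gt_eqF //; apply: lt_le_trans (GGc _ xd').
  exact: cvgZ (cvgN (cvgM c3 (cvgV g0 (cont_dot cGz cGz)))) cGz.
have cF z : reg z -> {for z, continuous F}.
  move=> /[dup] rz /andP[h1 h2]; apply/continuous_eps => eps eps0.
  have /continuous_eps/(_ _ (ltac:(exact: divr_gt0) : 0 < eps / 2))[e1 e10 he1] := cacc z rz.
  have /continuous_eps/(_ (d' - `|lsubmx z - p|))[|e2 e20 he2] := cl z; first by rewrite subr_gt0.
  have /continuous_eps/(_ (2 - `|rsubmx z|))[|e3 e30 he3] := cr z; first by rewrite subr_gt0.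
  exists (Num.min (eps / 2) (Num.min e1 (Num.min e2 e3))).
    by rewrite !lt_min e10 e20 e30 divr_gt0.
  move=> y; rewrite !lt_min => /and4P[y0 /he1 y1 /he2 y2 /he3 y3].
  have ry : reg y.
    apply/andP; split.
      rewrite -(subrKA (lsubmx z)); apply: le_lt_trans (ler_normD _ _) _; lra.
    rewrite -(subrK (rsubmx z) (rsubmx y)); apply: le_lt_trans (ler_normD _ _) _; lra.
  rewrite /F ry rz opp_row_mx add_row_mx.
  apply: le_lt_trans (_ : eps / 2 < _); last by lra.
  apply: norm_row_mx; [lra | | exact: ltW].
  by rewrite -linearB /= (le_trans (norm_rsubmx _)) // ltW.
(* Starting within [d' / 2] of [p] with a unit velocity, by time [tau] the position moves by less
   than [d' / 4] and the velocity by less than [1 / 4]. *)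
pose d1' := d' / 2; pose tau := Num.min (d' / (4 * (M + 1))) (1 / (4 * (M + 1))).
have M10 : 0 < 4 * (M + 1) by rewrite mulr_gt0 // ltr_wpDl.
exists d1', tau, M; split=> //.
  by rewrite /d1' divr_gt0.
  by rewrite /tau lt_min !divr_gt0.
move=> y v yd Ky v1 vG.
have [x [x0 xM xF]] := peano FM (row_mx y v).
have xc t : `|lsubmx (x t) - y| <= M * `|t|.
  apply: le_trans (xM t); rewrite (_ : lsubmx (x t) - y = lsubmx (x t - row_mx y v)).
    exact: norm_lsubmx.
  by rewrite linearB /= row_mxKl.
have xw t : `|rsubmx (x t) - v| <= M * `|t|.
  apply: le_trans (xM t); rewrite (_ : rsubmx (x t) - v = rsubmx (x t - row_mx y v)).
    exact: norm_rsubmx.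
  by rewrite linearB /= row_mxKr.
pose c t := lsubmx (x t); pose w t := rsubmx (x t).
have rx t : `|t| < tau -> reg (x t).
  rewrite lt_min !ltr_pdivlMr // => /andP[t1 t2].
  have hM : M * `|t| <= (M + 1) * `|t| by rewrite ler_wpM2r // lerDl.
  apply/andP; split.
    rewrite -(subrKA y); apply: le_lt_trans (ler_normD _ _) _.
    apply: le_lt_trans (lerD (xc t) (ltW yd)) _; rewrite /d1'; lra.
  rewrite -(subrK v (rsubmx _)); apply: le_lt_trans (ler_normD _ _) _.
  have hv : `|v| <= 1 by rewrite -((enorm_unit v).1 v1) norm_le_enorm.
  apply: le_lt_trans (lerD (xw t) hv) _; lra.
have velx t : `|t| < tau -> vel x t (row_mx (w t) (acc (x t))).
  by move=> ht; have := xF t (cF _ (rx t ht)); rewrite /F rx.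
have velc t : `|t| < tau -> vel c t (w t).
  by move=> /velx/vel_lsubmx; rewrite row_mxKl.
have velw t : `|t| < tau -> vel w t (acc (x t)).
  by move=> /velx/vel_rsubmx; rewrite row_mxKr.
have t0 : `|0 : R| < tau by rewrite normr0 lt_min !divr_gt0.
have cd t : `|t| < tau -> `|c t - p| < d by move=> /rx/andP[/dd].
have GG0 t : `|t| < tau -> G (c t) *d G (c t) != 0.
  by move=> /rx/andP[/GGc h _]; rewrite gt_eqF // (lt_le_trans c10).
have velG t : `|t| < tau -> vel (fun t => G (c t)) t (w t *m H (c t)).
  move=> ht; have [_ _ sG _] := hch _ (cd t ht).
  exact: (vel_mulmx (P := setT) ltr01 _ (sdiff_fdiff _ sG) (velc t ht)).
(* Three conserved quantities, proved in this order because the last two rest on the first: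
   [w *d G c = 0], [w *d w = 1], and [f c = 0], which keeps the curve on the surface. *)
have wG t : `|t| < tau -> w t *d G (c t) = 0.
  move=> ht; rewrite (_ : w t *d G (c t) = w 0 *d G (c 0)).
    by rewrite /w /c x0 row_mxKl row_mxKr.
  apply: (@vel0_cst_real _ (fun t => w t *d G (c t)) tau) => // s hs.
  have := vel_dot (velw s hs) (velG s hs).
  rewrite /acc /= -/(c s) -/(w s) dotZl mulNr mulfVK ?GG0 //.
  by rewrite (dotC (w s)) addNr.
have ww t : `|t| < tau -> w t *d w t = 1.
  move=> ht; rewrite (_ : w t *d w t = w 0 *d w 0); first by rewrite /w x0 row_mxKr.
  apply: (@vel0_cst_real _ (fun t => w t *d w t) tau) => // s hs.
  have := vel_dot (velw s hs) (velw s hs).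
  by rewrite /acc /= -/(c s) !dotL (dotC (G _)) wG // mulr0 addr0.
have fc t : `|t| < tau -> f (c t) = 0.
  move=> ht; rewrite (_ : f (c t) = f (c 0)).
    rewrite /c x0 row_mxKl; have yd' : `|y - p| < d by apply: dd; apply: lt_trans yd _; rewrite /d1'; lra.
    by have [<- _ _ _] := hch y yd'.
  apply: (@vel0_cst_real _ (fun t => f (c t)) tau) => // s hs.
  rewrite -(wG s hs); have [_ sf _ _] := hch _ (cd s hs).
  exact: (vel_dotr (P := setT) ltr01 _ (sdiff_fdiff _ sf) (velc s hs)).
exists c, w, (fun t => acc (x t)); split.
- by rewrite /c x0 row_mxKl.
- by rewrite /w x0 row_mxKr.
- exact: xc.
- exact: xw.
move=> t ht; split; [exact: cd | | exact: velc | exact: velw |].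
  by have [-> _ _ _] := hch _ (cd t ht); exact: fc.
split; [ | by eexists | exact: ww | exact: wG].
apply: continuous_comp; last exact: cacc (rx t ht).
exact: vel_continuous (velx t ht).
Qed.

(** Along the normal line through [p + u], at heights [|u|] and [- |u|], the linear part of [f]
    dominates: the strict estimate errs by [|b| / 2] per unit of displacement, and the displacement
    is at most [2 |u|]. A zero lies in between; the factor [b] in [phi] fixes the sign. *)
Lemma chart_graph K p f G H d n : is_chart K p f G H d -> K p -> n *d n = 1 ->
  (exists a, n = a *: G p) -> exists2 e, 0 < e & forall u, u *d n = 0 -> `|u| < e ->
  exists2 h, `|h| <= `|u| & K (p + u + h *: n).
Proof.
move=> [d0 hch] Kp n1 [a na].
have [fKp sf _ [_ Gp _]] := hch p ltac:(by rewrite subrr normr0).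
pose b := n *d G p.
have a0 : a != 0.
  by apply: contra_eq_neq n1 => a0; rewrite na a0 scale0r dot0l eq_sym oner_neq0.
have b0 : b != 0 by rewrite /b na dotZl mulf_neq0 // gt_eqF // dot_gt0.
have nn : `|n| <= 1 by rewrite -((enorm_unit n).1 n1) norm_le_enorm.
have fp : f p = 0 by apply/fKp.
have be0 : 0 < `|b| / 2 by rewrite divr_gt0 // normr_gt0.
have [e e0 he] := sf _ be0.
exists (Num.min e d / 2); first by rewrite divr_gt0 // lt_min e0.
move=> u un ud.
have ed : `|u| * 2 < Num.min e d by rewrite -ltr_pdivlMr.
have near h : `|h| <= `|u| -> `|p + u + h *: n - p| < Num.min e d.
  move=> hu; rewrite addrAC (addrC p) addrK; apply: le_lt_trans (ler_normD _ _) _.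
  rewrite normrZ; have : `|h| * `|n| <= `|u| * 1 by rewrite ler_pM.
  by move: ed; lra.
have [u0|u0] := eqVneq u 0.
  by exists 0; rewrite ?u0 ?normr0 // scale0r !addr0.
have nu0 : 0 < `|u| by rewrite normr_gt0.
pose phi h := b * f (p + u + h *: n).
have est h : `|h| = `|u| -> `|f (p + u + h *: n) - h * b| <= `|b| * `|u|.
  move=> hu; have hh := near h ltac:(by rewrite hu).
  move: (hh); rewrite lt_min => /andP[h1 _].
  have := he (p + u + h *: n) p h1; rewrite subrr normr0 => /(_ e0).
  rewrite fp subr0 (_ : p + u + h *: n - p = u + h *: n); last by rewrite addrAC (addrC p) addrK.
  have -> : (u + h *: n) *d G p = h * b.
    rewrite dotDl dotZl -/b; suff -> : u *d G p = 0 by rewrite add0r.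
    by move: un; rewrite na dotZr => /eqP; rewrite mulf_eq0 (negbTE a0) => /eqP.
  move=> /le_trans; apply; rewrite -mulrA ler_wpM2l //.
  rewrite mulrC ler_pdivrMr //; apply: le_trans (ler_normD _ _) _.
  rewrite normrZ hu; have : `|u| * `|n| <= `|u| * 1 by rewrite ler_wpM2l.
  lra.
have bb : `|b| * `|b| = b * b by rewrite -normrM ger0_norm // -expr2 sqr_ge0.
have [| | |h /andP[h1 h2] hf] := @ivt R phi (- `|u|) `|u| 0.
- lra.
- move=> h /andP[h1 h2].
  have hu : `|h| <= `|u| by rewrite ler_norml h1.
  have := near h hu; rewrite lt_min => /andP[_ hd].
  have [_ /sdiff_dot_continuous cf _ _] := hch _ hd.
  apply: cvgM; first exact: cvg_cst.
  apply: (@continuous_comp _ _ _ (fun h : R^o => p + u + h *: n) f h _ cf).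
  apply: (@vel_continuous _ _ _ h (0 + (1 *: n + h *: 0))).
  apply: velD; first exact: vel_cst.
  by apply: (@vel_scale _ _ (fun h => h : R^o) (fun=> n)); [exact: vel_id | exact: vel_cst].
- have := est (- `|u|); rewrite normrN normr_id => /(_ erefl).
  have := est `|u|; rewrite normr_id => /(_ erefl).
  rewrite /phi; move: (f _) (f _) => f1 f2; rewrite !ler_norml => /andP[A1 A2] /andP[B1 B2].
  have {}be0 : 0 < `|b| by rewrite normr_gt0.
  move: A1 A2 B1 B2 bb be0 nu0; clear; move: (`|b|) (`|u|) => b' u'; clear u; move: b => b A1 A2 B1 B2 bb b0 u0.
  have [hb|hb] := leP 0 b.
    have e : b' = b by nra.
    subst b'; apply/andP; split; nra.
  have e : b' = - b by nra.
  subst b'; apply/andP; split; nra.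
- exists h; first by rewrite ler_norml h1.
  have hu : `|h| <= `|u| by rewrite ler_norml h1.
  have := near h hu; rewrite lt_min => /andP[_ hd].
  have [-> _ _ _] := hch _ hd; move/eqP: hf; rewrite mulf_eq0 (negbTE b0) => /eqP.
  by [].
Qed.

End Chart.

(** * Convex bodies, spheres, cylinders and planes *)

Section Convex.
Variable R : realType.
Implicit Types (a b e m n p q u v w x y z : 'rV[R]_3) (rho s t d : R) (C H : set 'rV[R]_3).

Lemma convex_segment C x y t : convex_set C -> C x -> C y -> 0 <= t <= 1 -> C (x + t *: (y - x)).
Proof.
move=> cC Cx Cy /andP[t0 t1].
have := cC y x (Itv01 t0 t1); rewrite !inE => /(_ Cy Cx).
have E : t *: y + (1 - t) *: x = x + t *: (y - x).
  by apply/rowP => i; rewrite !mxE; ring.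
by rewrite -E.
Qed.

Lemma convex_mid C x v : convex_set C -> C (x + v) -> C (x - v) -> C x.
Proof.
move=> cC h1 h2; have := convex_segment cC h1 h2 (_ : 0 <= 2^-1 <= 1).
rewrite (_ : _ + _ = x); last by apply/rowP => i; rewrite !mxE; field.
by apply; apply/andP; split; lra.
Qed.

Lemma closed_far C x : closed C -> ~ C x -> exists2 d, 0 < d & forall y, `|y - x| < d -> ~ C y.
Proof.
move=> cC nC; have oC : open (~` C) by exact: closed_openC.
by have /nbhs_eps[d d0 hd] : nbhs x (~` C) by [exact: open_nbhs_nbhs]; exists d.
Qed.

Lemma interiorP C x : C° x <-> exists2 d, 0 < d & forall y, `|y - x| < d -> C y.
Proof. exact: nbhs_eps. Qed.

Lemma closureP C x : (forall d, 0 < d -> exists2 y, C y & `|y - x| < d) -> closure C x.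
Proof.
move=> h B /nbhs_eps[d d0 hd]; have [y Cy yd] := h d d0.
by exists y; split=> //; exact: hd.
Qed.

Lemma boundary_closed C x : closed C -> boundary C x <-> C x /\ ~ C° x.
Proof.
move=> cC; split=> -[h1 h2]; split=> //; first by rewrite (closure_id C).1.
exact: subset_closure.
Qed.

(** The parameter is the supremum of those whose point lies in [C]. *)
Lemma segment_boundary C u w : closed C -> C u -> ~ C w ->
  exists2 t, 0 <= t < 1 & boundary C (u + t *: (w - u)).
Proof.
move=> cC Cu Cw; pose z t := u + t *: (w - u).
pose E : set R := [set t | 0 <= t <= 1 /\ C (z t)].
have E0 : E 0 by split; rewrite ?lexx ?ler01 // /z scale0r addr0.
have hE : has_sup E by split; [exists 0 | exists 1 => t [/andP[]]].
have s0 : 0 <= sup E by apply: ub_le_sup => //; exact: hE.2.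
have s1 : sup E <= 1 by apply: ge_sup; [exists 0 | move=> t [/andP[]]].
have V0 : 0 < 1 + `|w - u| by rewrite ltr_pwDl.
have zd s t d : `|s - t| < d / (1 + `|w - u|) -> `|z s - z t| < d.
  rewrite ltr_pdivlMr // => h; rewrite (_ : z s - z t = (s - t) *: (w - u)); last first.
    by apply/rowP => i; rewrite !mxE; ring.
  rewrite normrZ; apply: le_lt_trans h; rewrite ler_wpM2l // lerDr //.
have Cs : C (z (sup E)).
  apply: contrapT => /(closed_far cC)[d d0 hd].
  have [t Et lt] := sup_adherent (divr_gt0 d0 V0) hE.
  have ts : t <= sup E by apply: ub_le_sup => //; exact: hE.2.
  apply: (hd (z t)); last by case: Et.
  apply: zd; rewrite ltr_norml; apply/andP; split; first by lra.
  by apply: le_lt_trans (_ : 0 < _); [lra | rewrite divr_gt0].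
have s1' : sup E < 1.
  rewrite lt_neqAle s1 andbT; apply: contra_notN Cw => /eqP e.
  by move: Cs; rewrite /z e scale1r addrC subrK.
exists (sup E); first by rewrite s0.
apply/boundary_closed => //; split=> // /interiorP[d d0 hd].
pose r := Num.min (1 - sup E) (d / (1 + `|w - u|) / 2).
have r0 : 0 < r by rewrite lt_min subr_gt0 s1' !divr_gt0.
have : E (sup E + r).
  split; first by rewrite addr_ge0 ?(ltW r0) //= -lerBrDl ge_min lexx.
  apply: hd; apply: zd; rewrite addrC addKr gtr0_norm //.
  apply: le_lt_trans (_ : d / (1 + `|w - u|) / 2 < _); first by rewrite ge_min lexx orbT.
  by have := divr_gt0 d0 V0; lra.
move=> /(ub_le_sup hE.2); lra.
Qed.

Definition segment_closed H := forall x y t, H x -> H y -> 0 <= t <= 1 -> H (x + t *: (y - x)).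

(** A segment from [y] to a point outside [C] would cross the boundary inside [H]. *)
Lemma segment_closed_sub C H y : closed C -> segment_closed H ->
  (forall x, H x -> ~ boundary C x) -> H y -> C y -> H `<=` C.
Proof.
move=> cC hH avoid Hy Cy w Hw; apply: contrapT => Cw.
have [t /andP[t0 t1]] := segment_boundary cC Cy Cw.
by apply: avoid; apply: hH => //; rewrite t0 ltW.
Qed.

(* The degenerate axis 0 makes [perp 0] the identity, so that [tube a 0 rho] is a sphere while [tube a e rho],
   for a unit vector e, is a round cylinder. *)
Definition axis e := e = 0 \/ e *d e = 1.
Definition perp e v := v - (v *d e) *: e.

Lemma perpD e u v : perp e (u + v) = perp e u + perp e v.
Proof. by apply/rowP => i; rewrite /perp dotDl !mxE; ring. Qed.
Lemma perpZ e s v : perp e (s *: v) = s *: perp e v.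
Proof. by apply/rowP => i; rewrite /perp dotZl !mxE; ring. Qed.
Lemma perpB e u v : perp e (u - v) = perp e u - perp e v.
Proof. by apply/rowP => i; rewrite /perp dotBl !mxE; ring. Qed.
Lemma perp_id e v : v *d e = 0 -> perp e v = v.
Proof. by rewrite /perp => ->; rewrite scale0r subr0. Qed.
Lemma perp_dot e v : axis e -> perp e v *d e = 0.
Proof. by case=> he; rewrite /perp; [rewrite he dot0r | rewrite dotBl dotZl he mulr1 subrr]. Qed.
Lemma perp_axis e : axis e -> perp e e = 0.
Proof. by case=> he; rewrite /perp; [rewrite he scaler0 subr0 | rewrite he scale1r subrr]. Qed.
Lemma dot_perp e u v : u *d e = 0 -> u *d perp e v = u *d v.
Proof. by move=> h; rewrite /perp dotBr dotZr h mulr0 subr0. Qed.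
Lemma perp_perp e v : axis e -> perp e (perp e v) = perp e v.
Proof. by move=> he; rewrite perp_id // perp_dot. Qed.

Lemma enorm_perp_le e v : axis e -> enorm (perp e v) <= enorm v.
Proof.
move=> he; rewrite enorm_le ?enorm_ge0 // enorm2 dot_perp ?perp_dot //.
rewrite /perp dotBl dotZl (dotC e).
by have := sqr_ge0 (v *d e); lra.
Qed.

Definition tube a e rho : set 'rV[R]_3 := [set x | enorm (perp e (x - a)) = rho].

Lemma tubeP a e rho x : 0 <= rho -> tube a e rho x <-> perp e (x - a) *d perp e (x - a) = rho ^+ 2.
Proof. by move=> r0; split=> [<-|h]; [rewrite enorm2 | apply: enorm_eq]. Qed.

Lemma exists_unit_perp e u : axis e -> u *d e = 0 -> u *d u = 1 ->
  exists v, [/\ v *d v = 1, v *d e = 0 & v *d u = 0].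
Proof.
move=> [->|he] hu uu.
  by have [v [_ [hv _ _ [_ ? _]]]] := exists_perp uu; exists v; rewrite dot0r.
have [_ _ h [_ h1 h2]] := cross_orthonormal uu he hu.
by exists (cross u e); split=> //; rewrite dotC.
Qed.

Lemma exists_unit e : axis e -> exists2 u, u *d u = 1 & u *d e = 0.
Proof.
move=> [->|he]; last by have [u [v [? _ _ [_ ? _]]]] := exists_perp he; exists u.
exists (bvec R 0); last by rewrite dot0r.
by rewrite dotE !bvecE /=; ring.
Qed.

(** The half-spaces [H u] beyond the tube, with [u] orthogonal to [e], are free of boundary points,
    so each one that meets [C] lies in [C]. The one containing [y] does; half-spaces of non-opposite
    directions overlap, so by way of [v] the opposite one does too. Every point is the midpoint of
    points of two opposite half-spaces. *)
Lemma boundary_sub_tube_full C a e rho y : closed C -> convex_set C -> axis e -> 0 <= rho ->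
  boundary C `<=` tube a e rho -> C y -> rho < enorm (perp e (y - a)) -> forall z, C z.
Proof.
move=> cC vC he r0 bC Cy ylt.
pose H u : set 'rV[R]_3 := [set z | rho < (z - a) *d u].
have Hs u : segment_closed (H u).
  move=> x z t /= hx hz /andP[t0 t1].
  rewrite /H /=.
  have -> : (x + t *: (z - x) - a) *d u = (1 - t) * ((x - a) *d u) + t * ((z - a) *d u).
    by rewrite !dotL; ring.
  have : rho < Num.min ((x - a) *d u) ((z - a) *d u) by rewrite lt_min hx.
  have A : Num.min ((x - a) *d u) ((z - a) *d u) <= (x - a) *d u by rewrite ge_min lexx.
  have B : Num.min ((x - a) *d u) ((z - a) *d u) <= (z - a) *d u by rewrite ge_min lexx orbT.
  move=> /lt_le_trans; apply; have t1' : 0 <= 1 - t by rewrite subr_ge0.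
  by apply: le_trans (lerD (ler_wpM2l t1' A) (ler_wpM2l t0 B)); apply/eq_ler; ring.
have avoid u : u *d u = 1 -> u *d e = 0 -> forall x, H u x -> ~ boundary C x.
  move=> uu ue x /= hx /bC; rewrite /tube /= => hr; move: hx.
  rewrite /H /= dotC -(dot_perp _ ue) ltNge => /negP; apply.
  by have := dot_le_enorm u (perp e (x - a)); rewrite ((enorm_unit u).1 uu) mul1r hr.
have HC u x : u *d u = 1 -> u *d e = 0 -> H u x -> C x -> H u `<=` C.
  by move=> uu ue; apply: segment_closed_sub => //; exact: avoid.
pose q := perp e (y - a).
have q0 : q != 0.
  by apply: contraTneq ylt => h; rewrite -/q h /enorm dot0l sqrtr0 -leNgt.
pose u0 := normalize q.
have u0u : u0 *d u0 = 1 by exact: normalize_unit.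
have u0e : u0 *d e = 0 by rewrite dotZl perp_dot // mulr0.
have H0 : H u0 `<=` C.
  apply: (HC u0 y) => //; rewrite /H /= dotC -(dot_perp _ u0e) -/q dotZl -enorm2.
  by rewrite expr2 mulKf // gt_eqF // enorm_gt0.
(* The point [a + s *: (u + v)] has height [rho + 1] in both directions, so it lies in both
   half-spaces; such an [s] exists as long as [v] is not [- u]. *)
have step u v : u *d u = 1 -> u *d e = 0 -> v *d v = 1 -> v *d e = 0 -> -1 < u *d v ->
    H u `<=` C -> H v `<=` C.
  move=> uu ue vv ve uv hu; pose s := (rho + 1) / (1 + u *d v).
  have uv0 : 0 < 1 + u *d v by lra.
  have sE : s * (1 + u *d v) = rho + 1 by rewrite divfK // gt_eqF.
  have h : C (a + s *: (u + v)).
    by apply: hu; rewrite /H /= (addrC a) addrK dotZl dotDl uu (dotC v) sE; lra.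
  apply: HC h => //.
  by rewrite /H /= (addrC a) addrK dotZl dotDl vv (addrC _ 1) sE; lra.
have [v [vv ve vu]] := exists_unit_perp he u0e u0u.
have Nu : - u0 *d - u0 = 1 by rewrite dotNl dotNr opprK.
have Ne : - u0 *d e = 0 by rewrite dotNl u0e oppr0.
have Hv : H v `<=` C by apply: (step u0) => //; rewrite dotC vu; lra.
have HN : H (- u0) `<=` C by apply: (step v) => //; rewrite dotNr vu; lra.
clearbody u0; move=> z; pose s := rho + 1 + `|(z - a) *d u0|.
apply: (convex_mid (v := s *: u0) vC).
  apply: H0; rewrite /H /= !dotL u0u; have := ler_norm (- ((z - a) *d u0)).
  by rewrite normrN /s !dotL; lra.
apply: HN; rewrite /H /= !dotL u0u; have := ler_norm ((z - a) *d u0).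
by rewrite /s !dotL; lra.
Qed.

Lemma full_boundary C : (forall z, C z) -> boundary C = set0.
Proof.
move=> h; apply/seteqP; split=> // x [_]; apply.
by apply/interiorP; exists 1.
Qed.

Lemma perp_shift a e s x : axis e ->
  perp e (x + s *: perp e (x - a) - a) = (1 + s) *: perp e (x - a).
Proof.
move=> he; rewrite addrAC (perpD e (x - a)) perpZ perp_perp //.
by rewrite scalerDl scale1r.
Qed.

Lemma small_scale d v : 0 < d -> exists2 s, 0 < s < 1 & `|s *: v| < d.
Proof.
move=> d0; have V0 : 0 < 1 + `|v| by rewrite ltr_pwDl.
pose s := Num.min (1 / 2) (d / (1 + `|v|) / 2); exists s.
  by rewrite lt_min !divr_gt0 //= gt_min; apply/orP; left; lra.
have s0 : 0 <= s by rewrite le_min !divr_ge0 // ltW.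
rewrite normrZ ger0_norm //; apply: le_lt_trans (_ : s * (1 + `|v|) < _).
  by rewrite ler_wpM2l // lerDr.
rewrite -ltr_pdivlMr //; apply: le_lt_trans (_ : d / (1 + `|v|) / 2 < _).
  by rewrite ge_min lexx orbT.
by have := divr_gt0 d0 V0; lra.
Qed.

Lemma ball_scale C x v : C° x -> exists2 s, 0 < s < 1 & C (x + s *: v) /\ C (x - s *: v).
Proof.
move=> /interiorP[d d0 hd]; have [s s01 sd] := small_scale v d0; exists s => //.
by split; apply: hd; rewrite addrC addrA ?addNr ?add0r ?normrN //= addrAC addNr sub0r normrN.
Qed.

(** [C] stays in the solid tube, otherwise it is the whole space and has no boundary. Hence points
    of the tube are not interior, since an interior point could be pushed outwards. The open solid
    tube is free of boundary points, so it lies in [C], and each point of the tube is a limit of its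
    points. *)
Lemma boundary_sub_tube C a e rho : convex_body C -> axis e -> 0 < rho -> boundary C !=set0 ->
  boundary C `<=` tube a e rho -> boundary C = tube a e rho.
Proof.
move=> [cC vC [m im]] he r0 [b0 bb0] bC.
have Cin y : C y -> enorm (perp e (y - a)) <= rho.
  move=> Cy; rewrite leNgt; apply/negP => lt.
  have := full_boundary (boundary_sub_tube_full cC vC he (ltW r0) bC Cy lt).
  by move=> E; move: bb0; rewrite E.
have scaleN s x : 0 <= 1 + s -> enorm (perp e (x + s *: perp e (x - a) - a)) = (1 + s) * enorm (perp e (x - a)).
  by move=> s0; rewrite perp_shift // enormZ ger0_norm.
have out x : tube a e rho x -> ~ C° x.
  rewrite /tube /= => hx /(ball_scale (perp e (x - a)))[s /andP[s0 s1] [/Cin + _]].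
  rewrite scaleN; last by lra.
  rewrite hx; have : 0 < s * rho by rewrite mulr_gt0.
  lra.
pose D : set 'rV[R]_3 := [set x | enorm (perp e (x - a)) < rho].
have Dm : D m.
  rewrite /D /= lt_neqAle Cin ?andbT; last by have /interior_subset := im.
  by apply/negP => /eqP h; exact: out h im.
have Ds : segment_closed D.
  move=> x y t hx hy /andP[t0 t1]; rewrite /D /=.
  rewrite (_ : _ - a = (1 - t) *: (x - a) + t *: (y - a)); last by apply/rowP => i; rewrite !mxE; ring.
  rewrite perpD !perpZ; apply: le_lt_trans (ler_enormD _ _) _.
  have t1' : 0 <= 1 - t by rewrite subr_ge0.
  rewrite !enormZ !ger0_norm //.
  have : Num.max (enorm (perp e (x - a))) (enorm (perp e (y - a))) < rho by rewrite gt_max hx.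
  have A : enorm (perp e (x - a)) <= Num.max (enorm (perp e (x - a))) (enorm (perp e (y - a))) by rewrite le_max lexx.
  have B : enorm (perp e (y - a)) <= Num.max (enorm (perp e (x - a))) (enorm (perp e (y - a))) by rewrite le_max lexx orbT.
  apply: le_lt_trans; apply: le_trans (lerD (ler_wpM2l t1' A) (ler_wpM2l t0 B)) _.
  by apply/eq_ler; ring.
have DC : D `<=` C.
  apply: (segment_closed_sub (y := m)) => //; last by have /interior_subset := im.
  by move=> x hx /bC; rewrite /tube /= => E; move: hx; rewrite /D /= E ltxx.
apply/seteqP; split=> // x xZ; split; last exact: out.
apply: closureP => d d0; have [s /andP[s0 s1] sd] := small_scale (perp e (x - a)) d0.
exists (x + (- s) *: perp e (x - a)); last by rewrite addrAC subrr add0r scaleNr normrN.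
apply: DC; rewrite /D /= scaleN; last by lra.
rewrite xZ; have : 0 < s * rho by rewrite mulr_gt0.
lra.
Qed.

(** Each point of the solid tube lies on a chord with both ends on the tube, hence in [C]. If [C]
    had a point [y] outside, the homothety of centre [y] and ratio [l] would carry a ball about the
    axis point [y - q] onto a neighbourhood of the tube point [z], making [z] interior. *)
Lemma tube_sub_boundary C a e rho : convex_body C -> axis e -> 0 < rho ->
  tube a e rho `<=` boundary C -> boundary C = tube a e rho.
Proof.
move=> [cC vC _] he r0 bC; apply/seteqP; split=> //.
have ZC x : tube a e rho x -> C x by move=> /bC /(boundary_closed _ cC)[].
have DC x : enorm (perp e (x - a)) <= rho -> C x.
  move=> hx; set q := perp e (x - a); pose k := enorm q.
  have [u [uu ue qE]] : exists u, [/\ u *d u = 1, u *d e = 0 & q = k *: u].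
    have [q0|q0] := eqVneq q 0.
      have [u uu ue] := exists_unit he; exists u; split=> //.
      by rewrite /k q0 /enorm dot0l sqrtr0 scale0r.
    exists (normalize q); rewrite normalize_unit // normalizeK //; split=> //.
    by rewrite dotZl perp_dot // mulr0.
  have k0 : 0 <= k by exact: enorm_ge0.
  have inZ s : `|k + s| = rho -> C (x + s *: u).
    move=> hs; apply: ZC; rewrite /tube /= addrAC perpD perpZ -/q qE (perp_id ue) -scalerDl.
    by rewrite enormZ ((enorm_unit u).1 uu) mulr1.
  have h1 : C (x + (rho - k) *: u) by apply: inZ; rewrite addrC subrK gtr0_norm.
  have h2 : C (x + (- (rho + k)) *: u).
    by apply: inZ; rewrite opprD addrCA subrr addr0 normrN gtr0_norm.
  have t0 : 0 <= (rho - k) / (2 * rho) <= 1.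
    rewrite divr_ge0 /= ?subr_ge0 ?mulr_ge0 ?(ltW r0) // ler_pdivrMr ?mulr_gt0 //; lra.
  have := convex_segment vC h1 h2 t0; congr C.
  by apply/rowP => i; rewrite !mxE; field; lra.
have CD y : C y -> enorm (perp e (y - a)) <= rho.
  move=> Cy; rewrite leNgt; apply/negP => lt.
  set q := perp e (y - a) in lt; pose k := enorm q.
  have k0 : 0 < k by apply: lt_trans lt.
  pose z := y + (- (1 - rho / k)) *: q.
  have rk : 0 < rho / k by rewrite divr_gt0.
  have rk1 : rho / k < 1 by rewrite ltr_pdivrMr // mul1r.
  have zZ : tube a e rho z.
    rewrite /tube /= /z perp_shift // enormZ -/q -/k (_ : 1 + _ = rho / k); last by ring.
    by rewrite gtr0_norm // divfK // gt_eqF.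
  have [_ []] := (boundary_closed z cC).1 (bC _ zZ).
  apply/interiorP; pose l := 1 - rho / k; have l0 : 0 < l by rewrite /l; lra.
  exists (rho * l / 4); first by rewrite divr_gt0 ?mulr_gt0.
  move=> z' zd; pose w := y - q + l^-1 *: (z' - z).
  have Cw : C w.
    apply: DC; rewrite /w addrAC perpD (_ : perp e (y - q - a) = 0) ?add0r; last first.
      by rewrite addrAC perpB /q perp_perp // subrr.
    rewrite perpZ enormZ (ger0_norm (_ : 0 <= l^-1)) ?invr_ge0 ?(ltW l0) //.
    rewrite mulrC ler_pdivrMr //.
    apply: le_trans (enorm_perp_le _ he) _; apply: le_trans (enorm_le_norm _) _.
    have := ltW zd; have : 0 <= rho * l by rewrite mulr_ge0 // ltW.
    lra.
  have l01 : 0 <= l <= 1 by rewrite (ltW l0) /l; lra.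
  have := convex_segment vC Cy Cw l01; congr C.
  rewrite /w (_ : _ + _ = y - l *: q + (l / l) *: (z' - z)); last by apply/rowP => i; rewrite !mxE; ring.
  by rewrite divff ?gt_eqF // scale1r /z -/l scaleNr addrC subrK.
move=> x /(boundary_closed _ cC)[/CD hx nx]; apply/eqP; rewrite eq_le hx /= leNgt.
apply/negP => lt; apply: nx; apply/interiorP.
exists ((rho - enorm (perp e (x - a))) / 4); first by rewrite divr_gt0 ?subr_gt0.
move=> y yd; apply: DC; rewrite (_ : y - a = (x - a) + (y - x)); last first.
  by apply/rowP => i; rewrite !mxE; ring.
rewrite perpD; apply: le_trans (ler_enormD _ _) _.
have := le_trans (enorm_perp_le (y - x) he) (enorm_le_norm _); lra.
Qed.

Lemma halfspace_segment_closed a n : segment_closed [set z | 0 < (z - a) *d n].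
Proof.
move=> x z t /= hx hz /andP[t0 t1].
have -> : (x + t *: (z - x) - a) *d n = (1 - t) * ((x - a) *d n) + t * ((z - a) *d n).
  by rewrite !dotL; ring.
have [->|t1'] := eqVneq t 1; first by rewrite subrr mul0r add0r mul1r.
have : 0 < 1 - t by rewrite subr_gt0 lt_neqAle t1'.
by move=> h; rewrite ltr_wpDr ?mulr_gt0 // mulr_ge0 // ltW.
Qed.

(** With [n] oriented towards a point of [C] off the plane, the open half-space on that side lies in
    [C]. A point of [C] on the other side would add the opposite half-space, and by midpoints the
    whole space, leaving no boundary. *)
Lemma boundary_sub_plane C a n : convex_body C -> n *d n = 1 -> boundary C !=set0 ->
  boundary C `<=` [set z | (z - a) *d n = 0] -> boundary C = [set z | (z - a) *d n = 0].
Proof.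
move=> [cC vC [m im]] + [b0 bb0] bC; wlog hm : n bC / exists2 m', C m' & 0 < (m' - a) *d n => [hw nn|].
  have [s /andP[s0 s1] [h1 h2]] := ball_scale n im.
  have [h|h] := ltP 0 ((m - a) *d n + s).
    by apply: hw => //; exists (m + s *: n) => //; rewrite !dotL nn in h *; lra.
  have E : [set z | (z - a) *d - n = 0] = [set z | (z - a) *d n = 0].
    by apply/seteqP; split=> z /=; rewrite dotNr => ?; lra.
  rewrite -E; apply: hw; rewrite ?E // ?dotNl ?dotNr ?opprK //.
  by exists (m - s *: n) => //; rewrite !dotL nn in h *; lra.
move=> nn; case: hm => m' Cm' hm.
have HC : [set z | 0 < (z - a) *d n] `<=` C.
  apply: (segment_closed_sub (y := m')) => //; first exact: halfspace_segment_closed.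
  by move=> x /= + /bC /= => + E; rewrite E ltxx.
have CH y : C y -> 0 <= (y - a) *d n.
  move=> Cy; rewrite leNgt; apply/negP => lt.
  have HC' : [set z | 0 < (z - a) *d - n] `<=` C.
    apply: (segment_closed_sub (y := y)) => //; first exact: halfspace_segment_closed.
    - by move=> x /= + /bC /= => + E; rewrite dotNr E oppr0 ltxx.
    - by rewrite /= dotNr oppr_gt0.
  have : forall z, C z.
    move=> z; pose s := 1 + `|(z - a) *d n|.
    apply: (convex_mid (v := s *: n) vC).
      apply: HC; rewrite /= !dotL nn; have := ler_norm (- ((z - a) *d n)).
      by rewrite normrN /s !dotL; lra.
    apply: HC'; rewrite /= !dotL nn; have := ler_norm ((z - a) *d n).
    by rewrite /s !dotL; lra.
  by move=> /full_boundary E; move: bb0; rewrite E.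
apply/seteqP; split=> // z /= hz; split.
  apply: closureP => d d0; have [s /andP[s0 s1] sd] := small_scale n d0.
  exists (z + s *: n); last by rewrite addrAC subrr add0r.
  by apply: HC; rewrite /= addrAC dotDl hz dotZl nn add0r mulr1.
move=> /(ball_scale n)[s /andP[s0 s1] [_ /CH]].
by rewrite addrAC dotDl hz dotNl dotZl nn; lra.
Qed.

(** The body could be a slab between two planes; connectedness of the boundary excludes this.
    Everything above the level [h] of an interior point [m], up to the plane, lies in [C], so there
    is no boundary point strictly between these levels and the plane is open and closed in the
    boundary. *)
Lemma plane_sub_boundary C b n : convex_body C -> connected (boundary C) -> n *d n = 1 ->
  (forall y, C y -> (y - b) *d n <= 0) ->
  [set z | (z - b) *d n = 0] `<=` boundary C -> boundary C = [set z | (z - b) *d n = 0].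
Proof.
move=> [cC vC [m im]] cb nn Cle PC; set P := [set z | _].
have Cm : C m by have /interior_subset := im.
have hm : (m - b) *d n < 0.
  have [s /andP[s0 s1] [/Cle + _]] := ball_scale n im.
  by rewrite !dotL nn; lra.
set h := (m - b) *d n in hm.
have slab y : h < (y - b) *d n <= 0 -> C y.
  move=> /andP[y1 y2]; pose t := ((y - b) *d n) / h.
  have tE : t * h = (y - b) *d n by rewrite /t divfK // lt_eqF.
  have t01 : 0 <= t <= 1.
    by apply/andP; split; rewrite -(ler_nM2r hm) tE; lra.
  have t1 : t < 1 by rewrite -(ltr_nM2r hm) tE; lra.
  (* The line from [m] through [y] meets the plane at [q], and [y = q + t (m - q)]. *)
  pose q := y + (t / (1 - t)) *: (y - m).
  have Cq : C q.
    have qP : P q.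
      rewrite /P /= /q (_ : _ - b = (1 + t / (1 - t)) *: (y - b) - (t / (1 - t)) *: (m - b)); last first.
        by apply/rowP => i; rewrite !mxE; ring.
      rewrite dotBl !dotZl -/h -tE.
      by field; lra.
    by have [] := (boundary_closed q cC).1 (PC _ qP).
  have := convex_segment vC Cq Cm t01; congr C.
  by apply/rowP => i; rewrite /q !mxE; field; lra.
have dotlip y z : `|(y - b) *d n - (z - b) *d n| <= 3 * `|y - z|.
  rewrite -dotBl (_ : y - b - (z - b) = y - z); last by apply/rowP => i; rewrite !mxE; ring.
  apply: le_trans (dot_le_norm _ _) _; rewrite ler_piMr ?mulr_ge0 //.
  by rewrite -((enorm_unit n).1 nn) norm_le_enorm.
apply/esym; apply: cb.
- exists b; rewrite /P /= subrr dot0l //.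
- exists [set z | h < (z - b) *d n].
    rewrite openE => y /= hy; apply/interiorP.
    exists (((y - b) *d n - h) / 3); first by rewrite divr_gt0 // subr_gt0.
    move=> z; rewrite ltr_pdivlMr // => zd; rewrite /=.
    by have := dotlip z y; rewrite ler_norml => /andP[A _]; lra.
  apply/seteqP; split=> [z hz|z [/[dup] bz /(boundary_closed _ cC)[Cz nz] /= hz]].
    by split; [exact: PC | rewrite /=; rewrite hz].
  rewrite /P /=; apply/eqP; rewrite eq_le Cle //= leNgt; apply/negP => lt; apply: nz.
  apply/interiorP; exists (Num.min (((z - b) *d n - h) / 3) (- ((z - b) *d n) / 3)).
    by rewrite lt_min !divr_gt0 ?subr_gt0 ?oppr_gt0.
  move=> y; rewrite lt_min !ltr_pdivlMr // => /andP[y1 y2]; apply: slab.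
  by have := dotlip y z; rewrite ler_norml => /andP[A B]; apply/andP; split; lra.
- exists [set z | 0 <= (z - b) *d n].
    rewrite -[X in closed X]setCK; apply: open_closedC; rewrite openE => y /= hy.
    apply/interiorP; have {}hy : (y - b) *d n < 0 by rewrite ltNge; apply/negP.
    exists (- ((y - b) *d n) / 3); first by rewrite divr_gt0 // oppr_gt0.
    move=> z; rewrite ltr_pdivlMr // => zd; apply/negP; rewrite -ltNge.
    by have := dotlip z y; rewrite ler_norml => /andP[_ A]; lra.
  apply/seteqP; split=> [z hz|z [/(boundary_closed _ cC)[Cz nz] /= hz]].
    by split; [exact: PC | rewrite /=; rewrite hz].
  by rewrite /P /=; apply/eqP; rewrite eq_le hz Cle.
Qed.

Lemma clopen_local C (P : set 'rV[R]_3) p : connected C -> C p -> P p ->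
  (forall x, C x -> P x -> exists2 d, 0 < d & forall y, C y -> `|y - x| < d -> P y) ->
  (forall x, C x -> ~ P x -> exists2 d, 0 < d & forall y, C y -> `|y - x| < d -> ~ P y) ->
  forall x, C x -> P x.
Proof.
move=> cC Cp Pp hP hN x Cx.
pose U (Q : set 'rV[R]_3) : set 'rV[R]_3 :=
  [set z | exists2 d : R, 0 < d & forall y, C y -> `|y - z| < d -> Q y].
have oU Q : open (U Q).
  rewrite openE => z [d d0 hd]; apply/interiorP; exists (d / 2); first by rewrite divr_gt0.
  move=> z' zd; exists (d / 2); first by rewrite divr_gt0.
  move=> y Cy yd; apply: hd => //; rewrite -(subrKA z').
  by apply: le_lt_trans (ler_normD _ _) _; lra.
suff E : C `&` P = C by have [] : (C `&` P) x by rewrite E.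
apply: cC.
- by exists p.
- exists (U P) => //; apply/seteqP; split=> [y [Cy /(hP y Cy) h]|y [Cy [d d0 hd]]]; split=> //.
  by apply: hd; rewrite ?subrr ?normr0.
- exists (~` U (~` P)); first exact: open_closedC.
  apply/seteqP; split=> [y [Cy Py]|y [Cy nU]]; split=> //.
    by move=> [d d0 hd]; apply: (hd y) => //; rewrite subrr normr0.
  by apply: contrapT => /(hN y Cy).
Qed.

End Convex.

(** * Curves and strict estimates *)

Section CurveTools.
Variable R : realType.
Implicit Types (s t d eps tau : R).

Lemma vel_min (f : R -> R^o) (a : R) d : 0 < d -> (forall t, `|t| < d -> f 0 <= f t) -> vel f 0 a -> a = 0.
Proof.
move=> d0 hf hv; apply/eqP; rewrite -normr_le0 leNgt; apply/negP => a0.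
have e0 : 0 < `|a| / 2 by rewrite divr_gt0.
have [e e0' he] := hv _ e0.
pose t := Num.min d e / 2; have m0 : 0 < Num.min d e by rewrite lt_min d0.
have t0 : 0 < t by rewrite divr_gt0.
have : t < Num.min d e by rewrite /t; lra.
rewrite lt_min => /andP[td te].
have key s : `|s| = t -> 0 <= s * a + `|a| / 2 * t.
  move=> st; have h1 := hf s; rewrite st in h1; have {}h1 := h1 td.
  have := he s; rewrite subr0 st => /(_ te).
  have -> : s *: (a : R^o) = s * a by [].
  by rewrite ler_norml; move: (s * a) h1; move: (f s) (f 0) => x y c h1 /andP[_]; lra.
have k1 := key t (gtr0_norm t0); have k2 := key (- t) ltac:(by rewrite normrN gtr0_norm).
have : t * `|a| <= `|a| / 2 * t.
  by have [h|h] := leP 0 a; [rewrite ger0_norm // in k1 k2 * | rewrite ltr0_norm // in k1 k2 *]; lra.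
have : 0 < t * `|a| by rewrite mulr_gt0.
lra.
Qed.

(** [P t *d Q t] is [t ^+ 2 * (p *d q)] up to a smaller order: both curves vanish at 0, so first
    derivatives determine the product to second order. *)
Lemma vel_dot_ge0 (P Q : R -> 'rV[R]_3) (p q : 'rV[R]_3) d : 0 < d ->
  P 0 = 0 -> Q 0 = 0 -> vel P 0 p -> vel Q 0 q ->
  (forall t, `|t| < d -> 0 <= P t *d Q t) -> 0 <= p *d q.
Proof.
move=> d0 P0 Q0 hP hQ h; rewrite leNgt; apply/negP => lt.
pose M := 3 * (`|p| + `|q| + 1); have M0 : 0 < M by rewrite mulr_gt0 // ltr_wpDl // addr_ge0.
pose e := Num.min 1 (- (p *d q) / M / 2).
have e0 : 0 < e by rewrite lt_min ltr01 !divr_gt0 // oppr_gt0.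
have [d1 d10 h1] := hP _ e0; have [d2 d20 h2] := hQ _ e0.
pose t := Num.min d (Num.min d1 d2) / 2.
have m0 : 0 < Num.min d (Num.min d1 d2) by rewrite !lt_min d0 d10.
have t0 : 0 < t by rewrite divr_gt0.
have nt : `|t| = t by rewrite gtr0_norm.
have : t < Num.min d (Num.min d1 d2) by rewrite /t; lra.
rewrite !lt_min -{1 2 3}nt => /and3P[/h pos].
move: (h1 t) (h2 t); rewrite subr0 nt => + + /[dup] ? td1 td2.
move=> /(_ td1) A /(_ td2) B.
move: A B; rewrite P0 Q0 !subr0 => A B.
have e1 : e <= 1 by rewrite ge_min lexx.
have eM : e * M <= - (p *d q) / 2.
  by rewrite -ler_pdivlMr // mulrAC ge_min lexx orbT.
have E : P t *d Q t = t ^+ 2 * (p *d q) + t * (p *d (Q t - t *: q)) + t * ((P t - t *: p) *d q)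
   + (P t - t *: p) *d (Q t - t *: q) by rewrite !dotL; ring.
have b1 : p *d (Q t - t *: q) <= 3 * `|p| * (e * t).
  by apply: le_trans (ler_norm _) (le_trans (dot_le_norm _ _) _); rewrite ler_wpM2l // mulr_ge0.
have b2 : (P t - t *: p) *d q <= 3 * (e * t) * `|q|.
  by apply: le_trans (ler_norm _) (le_trans (dot_le_norm _ _) _); rewrite ler_wpM2r // ler_wpM2l.
have b3 : (P t - t *: p) *d (Q t - t *: q) <= 3 * (e * t) * (e * t).
  apply: le_trans (ler_norm _) (le_trans (dot_le_norm _ _) _).
  by rewrite ler_pM // ?mulr_ge0 // ler_wpM2l.
have T1 := ler_wpM2l (ltW t0) b1; have T2 := ler_wpM2l (ltW t0) b2.
have T3 : 3 * (e * t) * (e * t) <= 3 * e * t ^+ 2.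
  by rewrite (_ : _ * _ * (e * t) = 3 * e * t ^+ 2 * e); [rewrite ler_piMr // !mulr_ge0 // ltW | ring].
have : P t *d Q t <= t ^+ 2 * (p *d q + e * M).
  rewrite E (_ : t ^+ 2 * (_ + _) = t ^+ 2 * (p *d q) + t * (3 * `|p| * (e * t)) + t * (3 * (e * t) * `|q|)
    + 3 * e * t ^+ 2); last by rewrite /M; ring.
  by apply: lerD; [apply: lerD; [apply: lerD|]|apply: le_trans b3 T3].
have t20 : 0 < t ^+ 2 by rewrite exprn_gt0.
have : t ^+ 2 * (p *d q + e * M) < 0 by rewrite pmulr_rlt0 //; lra.
by move: pos; lra.
Qed.

Lemma vel_derive1 (V : normedModType R) (c : R -> V) t v : vel c t v -> derive1 c t = v.
Proof. by move=> /vel_is_derive[_ <-]; rewrite derive1E. Qed.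

Lemma derivable_vel (V : normedModType R) (c : R -> V) t :
  derivable (c : R^o -> V) t 1 -> vel c t (derive1 c t).
Proof. by move=> h; apply: is_derive_vel; rewrite derive1E; apply: derivableP. Qed.

Lemma vel_is_deriveZ (V : normedModType R) (c : R -> V) t (s : R^o) v : vel c t v ->
  is_derive (t : R^o) s (c : R^o -> V) (s *: v).
Proof.
move=> h; have : vel (fun h => c (s * h + t)) 0 (s *: v).
  by apply: vel_affine; rewrite mulr0 add0r.
move=> /vel_is_derive; rewrite /derivable => -[]; rewrite /derivable /derive /shift /= => h1 h2.
have E : (fun h0 : R => h0^-1 *: (c (s * (h0 *: 1 + 0) + t) - c (s * 0 + t))) =
   (fun h0 : R => h0^-1 *: (c (h0 *: s + t) - c t)).
  apply/funext => k; rewrite mulr0 add0r addr0 [k *: 1]mulr1.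
  by rewrite [k *: s]/(k * s) mulrC.
rewrite E in h1; rewrite E in h2.
by split.
Qed.

(** [Ck] quantifies over all directions [s] of the real line; the derivatives in direction [s] are
    the velocity and the acceleration multiplied by [s]. *)
Lemma Ck2_vel (I : set R) (c w a : R -> 'rV[R]_3) : open I ->
  (forall t, I t -> vel c t (w t)) -> (forall t, I t -> vel w t (a t)) ->
  (forall t, I t -> {for t, continuous (a : R^o -> 'rV[R]_3)}) ->
  Ck 2 (I : set R^o) (c : R^o -> 'rV[R]_3).
Proof.
move=> oI hc hw ha.
have nI t : I t -> exists2 d, 0 < d & forall s, `|s - t| < d -> I s.
  by move=> It; apply/(nbhs_eps (t : R^o)); exact: open_nbhs_nbhs.
have Dc s t : I t -> 'D_s (c : R^o -> 'rV[R]_3) t = s *: w t.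
  by move=> /hc /vel_is_deriveZ h; have [] := h s.
have vw (s : R^o) t : I t -> vel ('D_s (c : R^o -> 'rV[R]_3)) t (s *: a t).
  move=> It; have [d d0 hd] := nI t It.
  apply: (vel_near (c := fun t => s *: w t) d0); last exact: velZ (hw t It).
  by move=> u /hd Iu; rewrite Dc.
split; first by move=> t It; exact: vel_continuous (hc t It).
split; first by move=> t s /hc /vel_is_deriveZ h; have [] := h s.
move=> s; split; first by move=> t It; exact: vel_continuous (vw s t It).
split; first by move=> t u It; have [] := vel_is_deriveZ u (vw s t It).
move=> u; split=> // t It; have [d d0 hd] := nI t It.
have /continuous_eps ca := ha t It; apply/continuous_eps => eps eps0.
have K0 : 0 < 1 + `|u| * `|s| by rewrite ltr_pwDl // mulr_ge0.
have [e e0 he] := ca _ (divr_gt0 eps0 K0).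
exists (Num.min d e); first by rewrite lt_min d0.
move=> x; rewrite lt_min => /andP[/hd Ix /he]; rewrite ltr_pdivlMr // => xe.
have [_ ->] := vel_is_deriveZ u (vw s x Ix); have [_ ->] := vel_is_deriveZ u (vw s t It).
rewrite -!scalerBr !normrZ mulrA; apply: le_lt_trans xe.
by rewrite mulrC ler_wpM2l // lerDr.
Qed.

Lemma vel_chain (c : R -> 'rV[R]_3) (phi : R -> R) t a v :
  vel (phi : R -> R^o) t a -> vel c (phi t) v -> vel (fun s => c (phi s)) t (a *: v).
Proof.
move=> hp hc.
apply: (@vel_comp R (R^o) _ setT c phi t a (fun s : R^o => s *: v) `|v| 1) => //.
- by move=> x y; rewrite scalerBl.
- by move=> k x; rewrite scalerA.
- by move=> x; rewrite normrZ mulrC.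
- by move=> eps /hc[d d0 hd]; exists d => // y _ yd; exact: hd.
Qed.

(** One unit eigenvector in the plane suffices: by symmetry the vector orthogonal to it is another.
    [k] is the larger eigenvalue of the 2 by 2 block, and the characteristic equation [kE] makes [w]
    an eigenvector. *)
Lemma spectral_plane (A : 'M[R]_3) (n : 'rV[R]_3) : n *d n = 1 -> A^T = A -> n *m A = 0 ->
  exists e1 e2 k1 k2, [/\ orthonormal e1 e2 n, e1 *m A = k1 *: e1 & e2 *m A = k2 *: e2].
Proof.
move=> nn As nA.
have Adot u v : (u *m A) *d v = u *d (v *m A) by exact: dot_sym.
have An u : (u *m A) *d n = 0 by rewrite Adot nA dot0r.
suff [e1 [k1 [h1 h2 h3]]] : exists e1 k1, [/\ e1 *d e1 = 1, e1 *d n = 0 & e1 *m A = k1 *: e1].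
  have [e2 [E1 E2 E3 [E4 E5 E6]]] : exists e2, orthonormal e1 n e2.
    by exists (cross e1 n); exact: cross_orthonormal.
  exists e1, e2, k1, ((e2 *m A) *d e2).
  have o : orthonormal e1 e2 n by split=> //; split=> //; rewrite dotC.
  split=> //; rewrite {1}(orthonormal_expand (e2 *m A) o) An scale0r addr0.
  by rewrite Adot h3 dotZr (dotC e2) E5 mulr0 scale0r add0r.
have [u [v o]] := exists_perp nn; have [uu vv _ [uv un vn]] := o.
pose a := (u *m A) *d u; pose b := (u *m A) *d v; pose d := (v *m A) *d v.
have uA : u *m A = a *: u + b *: v by rewrite {1}(orthonormal_expand (u *m A) o) An scale0r addr0.
have vA : v *m A = b *: u + d *: v.
  by rewrite {1}(orthonormal_expand (v *m A) o) An scale0r addr0 Adot (dotC v).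
have [b0|b0] := eqVneq b 0.
  by exists u, a; split=> //; rewrite uA b0 scale0r addr0.
pose k := (a + d) / 2 + Num.sqrt (((a - d) / 2) ^+ 2 + b ^+ 2).
have kE : (k - a) * (k - d) = b ^+ 2.
  have /sqr_sqrtr : 0 <= ((a - d) / 2) ^+ 2 + b ^+ 2 by rewrite addr_ge0 // sqr_ge0.
  rewrite /k; move: (Num.sqrt _) => q hq.
  rewrite (_ : _ * _ = q ^+ 2 - ((a - d) / 2) ^+ 2); last by field.
  by rewrite hq; ring.
pose w := b *: u + (k - a) *: v.
have w0 : w != 0.
  apply: contraNneq b0 => w0; have : w *d u = 0 by rewrite w0 dot0l.
  by rewrite /w !dotL uu (dotC v) uv !mulr0 addr0 mulr1 => ->.
exists (normalize w), k; split; first exact: normalize_unit.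
  by rewrite /normalize /w !dotL un vn !mulr0 addr0 mulr0.
rewrite -scalemxAl /w mulmxDl -!scalemxAl uA vA !scalerA [k * _]mulrC -scalerA; congr (_ *: _).
rewrite !scalerDr !scalerA addrACA -!scalerDl.
by congr (_ *: _ + _ *: _); [ring | rewrite -expr2 -kE; ring].
Qed.

End CurveTools.

(** * Orders of magnitude for pairs of points moving on a surface *)

Section StrictEstimates.
Variables (R : realType) (K : set 'rV[R]_3) (p : 'rV[R]_3).
Implicit Types (d eps M : R) (y z : 'rV[R]_3).

(** Eventually, for pairs tending to [(p, p)] within [K]. The orders [small_o] and [big_O] are
    measured against [|y - z|], not against the distance to [p]. *)
Definition ev (Q : 'rV[R]_3 -> 'rV[R]_3 -> Prop) := exists2 d, 0 < d &
  forall y z, K y -> K z -> `|y - p| < d -> `|z - p| < d -> Q y z.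

Lemma ev_and (Q Q' : 'rV[R]_3 -> 'rV[R]_3 -> Prop) : ev Q -> ev Q' -> ev (fun y z => Q y z /\ Q' y z).
Proof.
move=> [d d0 h] [d' d'0 h']; exists (Num.min d d'); first by rewrite lt_min d0.
by move=> y z Ky Kz; rewrite !lt_min => /andP[y1 y2] /andP[z1 z2]; split; [exact: h | exact: h'].
Qed.

Lemma ev_mono (Q Q' : 'rV[R]_3 -> 'rV[R]_3 -> Prop) : (forall y z, Q y z -> Q' y z) -> ev Q -> ev Q'.
Proof. by move=> QQ [d d0 h]; exists d => // y z *; apply: QQ; exact: h. Qed.

Variables V V' W : normedModType R.

Definition tends0 (U : normedModType R) (F : 'rV[R]_3 -> 'rV[R]_3 -> U) :=
  forall eps, 0 < eps -> ev (fun y z => `|F y z| <= eps).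
Definition big_O (U : normedModType R) (F : 'rV[R]_3 -> 'rV[R]_3 -> U) :=
  exists2 M, 0 <= M & ev (fun y z => `|F y z| <= M * `|y - z|).
Definition small_o (U : normedModType R) (F : 'rV[R]_3 -> 'rV[R]_3 -> U) :=
  forall eps, 0 < eps -> ev (fun y z => `|F y z| <= eps * `|y - z|).

Lemma small_oD (F G : 'rV[R]_3 -> 'rV[R]_3 -> V) : small_o F -> small_o G -> small_o (fun y z => F y z + G y z).
Proof.
move=> hF hG eps eps0; have e0 : 0 < eps / 2 by rewrite divr_gt0.
apply: ev_mono (ev_and (hF _ e0) (hG _ e0)) => y z [h1 h2].
by apply: le_trans (ler_normD _ _) _; lra.
Qed.

Lemma small_oM (F : 'rV[R]_3 -> 'rV[R]_3 -> V) (G : 'rV[R]_3 -> 'rV[R]_3 -> V') (H : 'rV[R]_3 -> 'rV[R]_3 -> W) M :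
  0 <= M -> (forall y z, `|H y z| <= M * `|F y z| * `|G y z|) -> tends0 F -> big_O G -> small_o H.
Proof.
move=> M0 hH hF [C C0 hG] eps eps0; have MC : 0 < M * C + 1 by rewrite ltr_wpDl // mulr_ge0.
apply: ev_mono (ev_and (hF _ (divr_gt0 eps0 MC)) hG) => y z [h1 h2].
apply: le_trans (hH y z) _; apply: le_trans (_ : M * (eps / (M * C + 1)) * (C * `|y - z|) <= _).
  by rewrite ler_pM // ?mulr_ge0 // ler_wpM2l.
rewrite (_ : _ * _ = eps * `|y - z| * (M * C / (M * C + 1))); last by ring.
by rewrite ler_piMr ?mulr_ge0 // ?(ltW eps0) // ler_pdivrMr // mul1r lerDl.
Qed.

Lemma small_oZ (F : 'rV[R]_3 -> 'rV[R]_3 -> V) (H : 'rV[R]_3 -> 'rV[R]_3 -> W) M : 0 <= M ->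
  (forall y z, `|H y z| <= M * `|F y z|) -> small_o F -> small_o H.
Proof.
move=> M0 hH hF eps eps0; have M1 : 0 < M + 1 by rewrite ltr_wpDl.
apply: ev_mono (hF _ (divr_gt0 eps0 M1)) => y z h1.
apply: le_trans (hH y z) _; apply: le_trans (ler_wpM2l M0 h1) _.
rewrite (_ : M * (eps / (M + 1) * `|y - z|) = eps * `|y - z| * (M / (M + 1))); last by ring.
by rewrite ler_piMr ?mulr_ge0 // ?(ltW eps0) // ler_pdivrMr // mul1r lerDl.
Qed.

Lemma tends0D (F G : 'rV[R]_3 -> 'rV[R]_3 -> V) : tends0 F -> tends0 G -> tends0 (fun y z => F y z + G y z).
Proof.
move=> hF hG eps eps0; have e0 : 0 < eps / 2 by rewrite divr_gt0.
apply: ev_mono (ev_and (hF _ e0) (hG _ e0)) => y z [h1 h2].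
by apply: le_trans (ler_normD _ _) _; lra.
Qed.

Lemma big_OZ (F : 'rV[R]_3 -> 'rV[R]_3 -> V) (H : 'rV[R]_3 -> 'rV[R]_3 -> W) M : 0 <= M ->
  (ev (fun y z => `|H y z| <= M * `|F y z|)) -> big_O F -> big_O H.
Proof.
move=> M0 hH [C C0 hF]; exists (M * C); first exact: mulr_ge0.
apply: ev_mono (ev_and hH hF) => y z [h1 h2]; apply: le_trans h1 _.
by rewrite -mulrA ler_wpM2l.
Qed.

Lemma big_OD (F G : 'rV[R]_3 -> 'rV[R]_3 -> V) : big_O F -> big_O G -> big_O (fun y z => F y z + G y z).
Proof.
move=> [C C0 hF] [D D0 hG]; exists (C + D); first exact: addr_ge0.
apply: ev_mono (ev_and hF hG) => y z [h1 h2].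
by apply: le_trans (ler_normD _ _) _; rewrite mulrDl lerD.
Qed.

Lemma small_o_big_O (F : 'rV[R]_3 -> 'rV[R]_3 -> V) : small_o F -> big_O F.
Proof. by move=> h; exists 1 => //; exact: h. Qed.

End StrictEstimates.

(** * The outer parallel surface *)

(* N is a unit normal and A the shape operator, acting on row vectors. The strict estimates [ns_shape] and
   [ns_tan], in which both points vary, replace the C^1 regularity of N. *)
Record nsurf (R : realType) (r : R) (S : set 'rV[R]_3) (N : 'rV[R]_3 -> 'rV[R]_3)
    (A : 'rV[R]_3 -> 'M[R]_3) : Prop := {
  ns_unit : forall x, S x -> N x *d N x = 1;
  ns_sym : forall x, S x -> (A x)^T = A x;
  ns_null : forall x, S x -> N x *m A x = 0;
  ns_ge0 : forall x v, S x -> v *d N x = 0 -> 0 <= (v *m A x) *d v;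
  ns_lt : forall x v, S x -> v *d N x = 0 -> v *d v = 1 -> r * ((v *m A x) *d v) < 1;
  ns_shape : forall x, S x -> small_o S x (fun y z => N y - N z - (y - z) *m A x);
  ns_tan : forall x, S x -> small_o S x (fun y z => (y - z) *d N x : R^o);
  (* With B = 1 - r A, the angle between a geodesic velocity and its image under B is constant. *)
  ns_geo : forall x, S x -> exists d tau M, [/\ 0 < d, 0 < tau, 0 <= M &
    forall y v, `|y - x| < d -> S y -> v *d v = 1 -> v *d N y = 0 ->
    exists c w : R -> 'rV[R]_3, [/\ c 0 = y, w 0 = v,
      forall t, `|c t - y| <= M * `|t|, forall t, `|w t - v| <= M * `|t| &
      forall t, `|t| < tau -> [/\ S (c t), vel c t (w t), exists k, vel w t (k *: N (c t)),
        w t *d w t = 1 /\ w t *d N (c t) = 0 &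
        let b u x := u - r *: (u *m A x) in
        (w t *d b (w t) (c t)) ^+ 2 * (b v y *d b v y) = (v *d b v y) ^+ 2 * (b (w t) (c t) *d b (w t) (c t))]]];
  ns_graph : forall x, S x -> exists2 d, 0 < d & forall u, u *d N x = 0 -> `|u| < d ->
    exists2 h, `|h| <= `|u| & S (x + u + h *: N x);
  ns_connected : connected S }.

Lemma dot_sub_scale (R : realType) (q e : 'rV[R]_3) s :
  (q - s *: e) *d (q - s *: e) = q *d q - 2 * (s * (q *d e)) + s * s * (e *d e).
Proof. by rewrite !dotE !mxE; ring. Qed.

(** A chord of the unit sphere is orthogonal to the sum of its end points. Hence its component along
    a vector [n] near both ends is of smaller order than the chord. *)
Lemma chord_dot (R : realType) (a b n : 'rV[R]_3) : a *d a = 1 -> b *d b = 1 ->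
  (a - b) *d n = - 2^-1 * ((a - n + (b - n)) *d (a - b)).
Proof.
move=> aa bb.
have -> : (a - n + (b - n)) *d (a - b) = a *d a - b *d b - 2 * ((a - b) *d n).
  by rewrite !dotE !mxE; ring.
by rewrite aa bb; field.
Qed.

(** The bookkeeping of [shape_ex]: [a], [b], [c] stand for the ratio of the gradient to the unit
    normal at [p], [y], [z], and the right-hand side lists the error terms that are estimated
    there. *)
Lemma shape_algebra (R : realType) (a b c q1 q2 : R) (ny nz n u k : 'rV[R]_3) (H P : 'M[R]_3) :
  0 < a -> ny - nz = ny *m P - nz *m P + q1 *: n -> n *m P = 0 ->
  u *m (P *m H *m P) = u *m H *m P - q2 *: k ->
  ny - nz - u *m (a^-1 *: (P *m H *m P)) = a^-1 *: (a *: (q1 *: n) + (a - b) *: ((ny - nz) *m P)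
    + ((b *: ny - c *: nz - u *m H) *m P + -1 *: ((b - c) *: ((nz - n) *m P))) + q2 *: k).
Proof.
move=> a0 e1 e2 e3; rewrite -scalemxAr e3 !mulmxBl -!scalemxAl e2 subr0 [LHS]addrC e1.
move: (ny *m P) (nz *m P) (u *m H *m P) => x1 x2 x3.
by apply/rowP => i; rewrite !mxE; field; rewrite gt_eqF.
Qed.

Section ParallelSurface.
Variables (R : realType) (r : R) (C0 K0 Kr : set 'rV[R]_3).
Hypotheses (r_gt0 : 0 < r) (Kr_C2 : C2_surface Kr) (Kr_connected : connected Kr)
  (K0_convex : bounds_convex_body K0 C0) (Kr_outside : Kr `&` C0 = set0)
  (dist : regular_constant_distance Kr K0 r).
Implicit Types (x y z u v w : 'rV[R]_3) (s t d eps : R).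

Local Notation Pi := (projection K0).

Let C0_closed : closed C0. Proof. by case: K0_convex => -[]. Qed.
Let C0_convex : convex_set C0. Proof. by case: K0_convex => -[]. Qed.
Let K0E : K0 = boundary C0. Proof. by case: K0_convex. Qed.

Lemma K0_sub z : K0 z -> C0 z.
Proof. by rewrite K0E => /(boundary_closed _ C0_closed)[]. Qed.

Lemma projP x : Kr x -> [/\ K0 (Pi x), enorm (x - Pi x) = r & forall z, K0 z -> r <= enorm (x - z)].
Proof.
move=> /dist[hr [y hy]].
have [h1 h2] : proj_set K0 x (Pi x) by apply: getPex; exists y; rewrite hy.
have E : enorm (x - Pi x) = r.
  rewrite -hr; apply/eqP; rewrite eq_le; apply/andP; split.
    apply: lb_le_inf; first by exists (eudist x (Pi x)); exists (Pi x).
    by move=> _ [z Kz <-]; exact: h2.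
  apply: ge_inf; last by exists (Pi x).
  by exists 0 => _ [z _ <-]; exact: enorm_ge0.
by split=> // z /h2; rewrite -E.
Qed.

(** The segment from [c] to [x] leaves the body at a point of [K0] that is no farther from [x] than
    [c] is. *)
Lemma dist_C0 x c : Kr x -> C0 c -> r <= enorm (x - c).
Proof.
move=> Kx Cc; rewrite leNgt; apply/negP => lt.
have nx : ~ C0 x by move=> Cx; have : (Kr `&` C0) x by []; rewrite Kr_outside.
have [t /andP[t0 t1]] := segment_boundary C0_closed Cc nx.
rewrite -K0E => Kz; have [_ _ /(_ _ Kz)] := projP Kx; rewrite leNgt => /negP; apply.
rewrite (_ : x - _ = (1 - t) *: (x - c)); last by apply/rowP => i; rewrite !mxE; ring.
rewrite enormZ ger0_norm ?subr_ge0 ?(ltW t1) //; apply: le_lt_trans lt.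
by rewrite ler_piMl ?enorm_ge0 //; lra.
Qed.

(** Otherwise a step [s] from [Pi x] towards [c] stays in the body and comes closer to [x] than [r];
    [s] is small enough for the linear gain to beat the quadratic term. *)
Lemma proj_obtuse x c : Kr x -> C0 c -> (x - Pi x) *d (c - Pi x) <= 0.
Proof.
move=> Kx Cc; have [Kp xp _] := projP Kx; rewrite leNgt; apply/negP => lt.
set q := x - Pi x in xp lt; set e := c - Pi x in lt.
have qq : q *d q = r ^+ 2 by rewrite -enorm2 xp.
pose a := e *d e; have a0 : 0 <= a := dot_ge0 e.
pose s := Num.min 1 (q *d e / (a + 1)).
have a1 : 0 < a + 1 by rewrite ltr_wpDl.
have s0 : 0 < s by rewrite lt_min ltr01 divr_gt0.
have s1 : s <= 1 by rewrite ge_min lexx.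
have sa : s * (a + 1) <= q *d e by rewrite -ler_pdivlMr // ge_min lexx orbT.
have := convex_segment C0_convex (K0_sub Kp) Cc (introT andP (conj (ltW s0) s1)).
move=> /(dist_C0 Kx); rewrite -/e (_ : x - _ = q - s *: e); last first.
  by apply/rowP => i; rewrite !mxE; ring.
rewrite -ler_sqr ?nnegrE ?enorm_ge0 ?(ltW r_gt0) // enorm2 -qq dot_sub_scale -/a.
have : 0 < s * (q *d e) by rewrite mulr_gt0.
have := ler_wpM2l (ltW s0) sa; have := mulr_ge0 (ltW s0) (ltW s0).
clearbody s; lra.
Qed.

(** Firm nonexpansiveness, the sum of the obtuse angle inequalities at [x] and at [y]. *)
Lemma proj_firm x y : Kr x -> Kr y ->
  (Pi x - Pi y) *d (Pi x - Pi y) <= (Pi x - Pi y) *d (x - y).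
Proof.
move=> Kx Ky; have [px _ _] := projP Kx; have [py _ _] := projP Ky.
have := proj_obtuse Kx (K0_sub py); have := proj_obtuse Ky (K0_sub px).
move: (Pi x) (Pi y) => p q h1 h2.
have E : (p - q) *d (p - q) - (p - q) *d (x - y) = (y - q) *d (p - q) + (x - p) *d (q - p).
  by rewrite !dotE !mxE; ring.
lra.
Qed.

Definition nor x := r^-1 *: (x - Pi x).

Lemma nor_unit x : Kr x -> nor x *d nor x = 1.
Proof.
move=> /projP[_ h _]; by rewrite /nor dotZl dotZr -enorm2 h; field; rewrite gt_eqF.
Qed.

Lemma projE x : Pi x = x - r *: nor x.
Proof. by rewrite /nor scalerA divff ?gt_eqF // scale1r opprB addrC subrK. Qed.

Lemma nor_norm x : Kr x -> `|nor x| <= 1.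
Proof. by move=> /nor_unit/enorm_unit <-; exact: norm_le_enorm. Qed.

(** This is [proj_firm] with [Pi x = x - r N x] substituted: the Gauss map is cocoercive. It gives
    the Lipschitz bound [nor_lip] and, once differentiated, the sign of the curvatures. *)
Lemma nor_firm x y : Kr x -> Kr y ->
  r * ((nor x - nor y) *d (nor x - nor y)) <= (nor x - nor y) *d (x - y).
Proof.
move=> Kx Ky; have := proj_firm Kx Ky; rewrite !projE.
set m := nor x - nor y.
rewrite (_ : _ - _ = (x - y) - r *: m); last by apply/rowP => i; rewrite !mxE; ring.
move: (x - y) => w h; rewrite -(ler_pM2l r_gt0).
have E : (w - r *: m) *d w - (w - r *: m) *d (w - r *: m) = r * (m *d w) - r * (r * (m *d m)).
  by clearbody m; rewrite !dotE !mxE; ring.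
lra.
Qed.

Lemma nor_lip x y : Kr x -> Kr y -> `|nor x - nor y| <= 2 / r * `|x - y|.
Proof.
move=> Kx Ky; have := nor_firm Kx Ky; set m := nor x - nor y => h.
apply: le_trans (norm_le_enorm m) _; rewrite mulrAC ler_pdivlMr // mulrC.
apply: le_trans (_ : enorm (x - y) <= _); last exact: enorm_le_norm.
have [->|m0] := eqVneq (enorm m) 0; first by rewrite mulr0 enorm_ge0.
have mp : 0 < enorm m by rewrite lt0r m0 enorm_ge0.
rewrite -(ler_pM2l mp); apply: le_trans (dot_le_enorm m (x - y)).
by apply: le_trans h; rewrite -enorm2 expr2; apply/eq_ler; ring.
Qed.

(** The curve touches the sphere of radius [r] about [q] from outside, so the squared distance to
    [q] has a minimum at [t]. *)
Lemma tangent_to_ball (c : R -> 'rV[R]_3) t q x v : c t = x -> vel c t v ->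
  enorm (x - q) = r -> (exists2 d, 0 < d & forall s, `|s - t| < d -> r <= enorm (c s - q)) ->
  v *d (x - q) = 0.
Proof.
move=> ct hv hr [d d0 hd].
have : vel (fun s => (c (1 * s + t) - q) *d (c (1 * s + t) - q) : R^o) 0 (v *d (x - q) + (x - q) *d v).
  have hc : vel (fun s => c (1 * s + t) - q) 0 v.
    have h1 : vel (fun s => c (1 * s + t)) 0 (1 *: v) by apply: vel_affine; rewrite mulr0 add0r.
    by have := velB h1 (vel_cst q 0); rewrite scale1r subr0.
  by have := vel_dot hc hc; rewrite mulr0 add0r ct.
move=> /vel_min => /(_ _ d0) h.
have : v *d (x - q) + (x - q) *d v = 0.
  apply: h => s sd; rewrite mulr0 add0r ct -!enorm2 hr ler_sqr ?nnegrE ?enorm_ge0 ?(ltW r_gt0) //.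
  by apply: hd; rewrite mul1r addrK.
rewrite (dotC _ v); lra.
Qed.

Lemma tangent_nor x v : Kr x -> tangent Kr x v -> v *d nor x = 0.
Proof.
move=> Kx [c [c0 hc /is_derive_vel hv]]; have [Kp hr _] := projP Kx.
rewrite /nor dotZr (tangent_to_ball c0 hv hr) ?mulr0 //.
have /nbhs_eps[d d0 hd] := hc; exists d => // s /hd Kc.
by have [_ _ h] := projP Kc; apply: le_trans (dist_C0 Kc (K0_sub Kp)) _.
Qed.

(** Each unit vector orthogonal to [G x] is the velocity of a chart geodesic. That curve stays
    outside the ball of radius [r] about [Pi x], so the vector is orthogonal to [nor x] as well. *)
Lemma nor_chart p f G H d x : is_chart Kr p f G H d -> Kr x -> `|x - p| < d ->
  G x = (G x *d nor x) *: nor x.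
Proof.
move=> hch Kx xd; have [_ /(_ _ xd)[_ _ _ [_ G0 _]]] := hch.
have hch' : is_chart Kr x f G H (d - `|x - p|).
  case: hch => d0 h; split; first by rewrite subr_gt0.
  move=> y yd; apply: h; rewrite -(subrKA x); apply: le_lt_trans (ler_normD _ _) _; lra.
have [d1 [tau [M [d10 tau0 M0 hgeo]]]] := chart_geodesic hch'.
have [u [v o]] := exists_perp (normalize_unit G0).
have perpN w : w *d w = 1 -> w *d normalize (G x) = 0 -> w *d nor x = 0.
  move=> ww wn; have wG : w *d G x = 0 by rewrite -(normalizeK G0) dotZr wn mulr0.
  have [|c [w' [a [c0 w0 _ _ hc]]]] := hgeo x w _ Kx ww wG; first by rewrite subrr normr0.
  have t0 : `|0 : R| < tau by rewrite normr0.
  have [_ _ hv _ _] := hc 0 t0; have [Kp hr _] := projP Kx.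
  rewrite /nor dotZr (tangent_to_ball c0 (v := w) _ hr) ?mulr0 //.
    by rewrite -w0.
  exists tau => // s; rewrite subr0 => /hc[_ Kc _ _ _].
  exact: dist_C0 Kc (K0_sub Kp).
have [uu vv nn [uv un vn]] := o.
have E : nor x = (nor x *d normalize (G x)) *: normalize (G x).
  by rewrite {1}(orthonormal_expand (nor x) o) !(dotC (nor x)) perpN // perpN // !scale0r !add0r.
set k := nor x *d normalize (G x) in E.
have kk : k * k = 1 by have := nor_unit Kx; rewrite E dotZl dotZr nn mulr1.
have -> : G x *d nor x = enorm (G x) * k.
  by rewrite -{1}(normalizeK G0) dotZl dotC.
by rewrite E scalerA -mulrA kk mulr1 normalizeK.
Qed.

Lemma oriented_chart p : Kr p -> exists f G H d, is_chart Kr p f G H d /\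
  forall x, Kr x -> `|x - p| < d -> 0 < G x *d nor x.
Proof.
move=> Kp; have [f [G [H [d hch]]]] := C2_chart Kr_C2 Kp.
wlog pos : f G H hch / 0 < G p *d nor p => [hw|].
  have pd : `|p - p| < d by rewrite subrr normr0; case: hch.
  have [_ /(_ _ pd)[_ _ _ [_ G0 _]]] := hch.
  case: (ltgtP 0 (G p *d nor p)) => h.
  - exact: hw hch h.
  - by apply: (hw _ _ _ (is_chartN hch)); rewrite dotNl oppr_gt0.
  - by move: G0; rewrite (nor_chart hch Kp pd) -h scale0r eqxx.
have [d0 hd] := hch; have pd : `|p - p| < d by rewrite subrr normr0.
have [_ _ sG _] := hd p pd; have /continuous_eps cG := sdiff_mulmx_continuous sG.
set g := G p *d nor p in pos.
(* The last two terms of the decomposition [E] below are then at least [- g / 4], by the factor 3 of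
   [dot_le_norm], and [- g / 2]. *)
have [e e0 he] := cG (g / 12) (divr_gt0 pos (ltr0Sn _ _)).
have M0 : 0 < 3 * `|G p| * (2 / r) + 1 by rewrite ltr_wpDl // !mulr_ge0 // ?invr_ge0 ltW.
pose d' := Num.min d (Num.min e (g / 2 / (3 * `|G p| * (2 / r) + 1))).
exists f, G, H, d'; split.
  split; first by rewrite !lt_min d0 e0 !divr_gt0.
  by move=> x xd; apply: hd; apply: lt_le_trans xd _; rewrite ge_min lexx.
move=> x Kx; rewrite /d' 2!lt_min (ltr_pdivlMr _ _ M0) => /and3P[_ /he xe xd]; clear d' pd hd hch d0.
have E : G x *d nor x = g + (G x - G p) *d nor x + G p *d (nor x - nor p) by rewrite /g !dotL; ring.
have b1 : - ((G x - G p) *d nor x) <= 3 * (g / 12).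
  apply: le_trans (ler_norm _) _; rewrite normrN; apply: le_trans (dot_le_norm _ _) _.
  rewrite -[leRHS]mulr1 ler_pM ?mulr_ge0 ?nor_norm // ler_wpM2l //; exact: ltW.
have b2 : - (G p *d (nor x - nor p)) <= `|x - p| * (3 * `|G p| * (2 / r)).
  apply: le_trans (ler_norm _) _; rewrite normrN; apply: le_trans (dot_le_norm _ _) _.
  by rewrite [leRHS]mulrC -[leRHS]mulrA ler_wpM2l ?mulr_ge0 // nor_lip.
have := normr_ge0 (x - p); rewrite E; lra.
Qed.

(** With [G = g N] and [P] the projection onto the tangent plane at [p], the shape operator is
    [P H P / g]. The function [g] is never differentiated: a Lipschitz bound suffices, because
    [g y - g z] multiplies the tangential part of [N z], which tends to 0. The component of
    [N y - N z] along [N p] is handled by [chord_dot]. *)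
Lemma shape_ex p : Kr p -> exists A : 'M[R]_3, [/\ A^T = A, nor p *m A = 0,
  small_o Kr p (fun y z => nor y - nor z - (y - z) *m A) &
  small_o Kr p (fun y z => (y - z) *d nor p : R^o)].
Proof.
move=> Kp; have [f [G [H [d [hch pos]]]]] := oriented_chart Kp.
have [d0 hd] := hch; have pd : `|p - p| < d by rewrite subrr normr0.
have [_ sf sG [Hs _ _]] := hd p pd.
pose g x := G x *d nor x; pose n := nor p; have nn : n *d n = 1 := nor_unit Kp.
have gp0 : 0 < g p by apply: pos.
have Gp : G p = g p *: n := nor_chart hch Kp pd.
pose P : 'M[R]_3 := 1%:M - n^T *m n.
have dotM u v : (u *m v^T) 0 0 = u *d v.
  by rewrite mxE; apply: eq_bigr => i _; rewrite mxE.
have PE u : u *m P = u - (u *d n) *: n.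
  rewrite mulmxBr mulmx1 mulmxA; congr (_ - _).
  by rewrite (mx11_scalar (u *m n^T)) mul_scalar_mx dotM.
have Ps : P^T = P by rewrite linearB /= trmx1 trmx_mul trmxK.
have nP : n *m P = 0 by rewrite PE nn scale1r subrr.
have inball : ev Kr p (fun y z => [/\ Kr y, Kr z, `|y - p| < d & `|z - p| < d]).
  by exists d.
have O1 : big_O Kr p (fun y z => y - z) by exists 1 => //; exists 1 => // y z *; rewrite mul1r.
have ON : big_O Kr p (fun y z => nor y - nor z).
  exists (2 / r); first by rewrite divr_ge0 // ltW.
  by exists 1 => // y z Ky Kz _ _; exact: nor_lip.
have oE : small_o Kr p (fun y z => G y - G z - (y - z) *m H p).
  by move=> eps /sG[e e0 he]; exists e; first exact: e0; move=> y z _ _; exact: he.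
have OG : big_O Kr p (fun y z => G y - G z).
  have OH : big_O Kr p (fun y z => (y - z) *m H p).
    apply: (big_OZ (F := fun y z => y - z) (M := 3 * `|H p|)) O1; first by rewrite mulr_ge0.
    by exists 1; [exact: ltr01 | move=> y z _ _ _ _; rewrite mulrAC mulmx_le_norm].
  have := big_OD (small_o_big_O oE) OH; congr big_O.
  by apply/funext => y; apply/funext => z; rewrite subrK.
have tN : tends0 Kr p (fun y z => nor z - n).
  move=> eps eps0; have L0 : 0 < 2 / r by rewrite divr_gt0.
  exists (eps / (2 / r)); first by rewrite divr_gt0.
  move=> y z _ Kz _; rewrite ltr_pdivlMr // => /ltW zp; apply: le_trans zp.
  by rewrite mulrC; exact: nor_lip.
have tN' : tends0 Kr p (fun y z => nor y - n).
  by move=> eps /tN[e e0 he]; exists e; [exact: e0 | move=> y z Ky Kz yp zp; exact: (he z y)].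
have Og : big_O Kr p (fun y z => g y - g z : R^o).
  have [M M0 [e e0 hG]] : exists2 M, 0 <= M & ev Kr p (fun y z => `|G z| <= M).
    exists (`|G p| + 1); first by rewrite addr_ge0.
    have [e e0 he] := (continuous_eps _ _).1 (sdiff_mulmx_continuous sG) 1 ltr01.
    exists e; first exact: e0; move=> y z _ _ _ /he/ltW h; rewrite -(subrK (G p) (G z)) addrC.
    by apply: le_trans (ler_normD _ _) _; rewrite lerD2l.
  have -> : (fun y z => g y - g z : R^o) = (fun y z => (G y - G z) *d nor y + G z *d (nor y - nor z)).
    by apply/funext => y; apply/funext => z; rewrite /g dotBl dotBr addrA subrK.
  apply: big_OD.
    apply: (big_OZ (F := fun y z => G y - G z) (M := 3) _ _ OG); first exact: ler0n.
    exists 1; first exact: ltr01; move=> y z Ky _ _ _.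
    by apply: le_trans (dot_le_norm _ _) _; rewrite ler_piMr ?mulr_ge0 // nor_norm.
  apply: (big_OZ (F := fun y z => nor y - nor z) (M := 3 * M) _ _ ON); first by rewrite mulr_ge0.
  exists e; first exact: e0; move=> y z Ky Kz yp zp; apply: le_trans (dot_le_norm _ _) _.
  by rewrite ler_wpM2r // ler_wpM2l // (hG y z).
have tg : tends0 Kr p (fun y z => g p - g y : R^o).
  have [M M0 [e e0 he]] := Og; have M1 : 0 < M + 1 by rewrite ltr_wpDl.
  move=> eps eps0; exists (Num.min e (eps / (M + 1))); first by rewrite lt_min e0 divr_gt0.
  move=> y z Ky Kz; rewrite !lt_min !ltr_pdivlMr // => /andP[y1 y2] _.
  have pe : `|p - p| < e by rewrite subrr normr0.
  rewrite distrC; apply: le_trans (he y p Ky Kp y1 pe) _.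
  by have := normr_ge0 (y - p); lra.
have tan : small_o Kr p (fun y z => (y - z) *d n : R^o).
  apply: (small_oZ (F := fun y z => (y - z) *d G p : R^o) (M := (g p)^-1)); first by rewrite invr_ge0 ltW.
    move=> y z; have -> : (y - z) *d n = (g p)^-1 * ((y - z) *d G p).
      by rewrite Gp (dotZr (g p)) mulKf // gt_eqF.
    by rewrite normrM (ger0_norm (_ : 0 <= (g p)^-1)) // invr_ge0 ltW.
  move=> eps /sf[e e0 he]; exists (Num.min e d); first by rewrite lt_min e0.
  move=> y z Ky Kz; rewrite !lt_min => /andP[y1 y2] /andP[z1 z2].
  have [[/(_ Ky) fy _] _ _ _] := hd y y2; have [[/(_ Kz) fz _] _ _ _] := hd z z2.
  by have := he y z y1 z1; rewrite fy fz subrr sub0r normrN.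
exists ((g p)^-1 *: (P *m H p *m P)); split.
- by rewrite linearZ /= !trmx_mul Ps Hs mulmxA.
- by rewrite -scalemxAr !mulmxA nP !mul0mx scaler0.
- pose D y z := nor y - nor z.
  have oDn : small_o Kr p (fun y z => D y z *d n : R^o).
    pose h y z : 'rV[R]_3 := (nor y - n) + (nor z - n).
    have oh : small_o Kr p (fun y z => h y z *d D y z : R^o).
      apply: (small_oM (F := h) (M := 3) _ _ (tends0D tN' tN) ON) => [|y z]; first exact: ler0n.
      exact: dot_le_norm.
    have oh2 := small_oZ (M := 1) (H := fun y z => - 2^-1 * (h y z *d D y z) : R^o) ler01 _ oh.
    move=> eps /oh2 [y z|e e0 he].
      rewrite normrM ler_wpM2r // normrN ger0_norm ?invr_ge0 // invf_le1 //; exact: ler1n.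
    exists e; first exact: e0; move=> y z Ky Kz yp zp; have := he y z Ky Kz yp zp.
    rewrite (_ : D y z *d n = - 2^-1 * (h y z *d D y z)) //.
    exact: chord_dot (nor_unit Ky) (nor_unit Kz).
  have oZ F c : small_o Kr p F -> small_o Kr p (fun y z => c *: (F y z : 'rV[R]_3)).
    by move=> oF; apply: (small_oZ (M := `|c|) _ _ oF) => [|y z]; [exact: normr_ge0 | rewrite normrZ].
  have OD : forall A : 'M[R]_3, big_O Kr p (fun y z => D y z *m A).
    move=> A; apply: (big_OZ (M := 3 * `|A|) _ _ ON); first by rewrite mulr_ge0.
    by exists 1; [exact: ltr01 | move=> y z _ _ _ _; rewrite mulrAC mulmx_le_norm].
  have o1 : small_o Kr p (fun y z => (g p - g y) *: (D y z *m P)).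
    apply: (small_oM (M := 1) _ _ tg (OD P)) => [|y z]; first exact: ler01.
    by rewrite normrZ mul1r.
  have o2 : small_o Kr p (fun y z => (G y - G z - (y - z) *m H p) *m P).
    apply: (small_oZ (M := 3 * `|P|) _ _ oE) => [|y z]; first by rewrite mulr_ge0.
    by rewrite mulrAC mulmx_le_norm.
  have o3 : small_o Kr p (fun y z => (g y - g z) *: ((nor z - n) *m P)).
    apply: (small_oM (M := 3 * `|P|) _ _ tN Og) => [|y z]; first by rewrite mulr_ge0.
    rewrite normrZ [leRHS]mulrC ler_wpM2l // mulrAC; exact: mulmx_le_norm.
  have o4 : small_o Kr p (fun y z => ((y - z) *d n) *: (n *m H p *m P)).
    apply: (small_oZ (M := `|n *m H p *m P|) _ _ tan) => [|y z]; first exact: normr_ge0.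
    by rewrite normrZ mulrC.
  have o5 : small_o Kr p (fun y z => (D y z *d n) *: n).
    apply: (small_oZ (M := `|n|) _ _ oDn) => [|y z]; first exact: normr_ge0.
    by rewrite normrZ mulrC.
  have oSum := small_oD (small_oD (small_oD (oZ _ (g p) o5) o1) (small_oD o2 (oZ _ (-1) o3))) o4.
  have ev2 := oZ _ (g p)^-1 oSum.
  move=> eps eps0; have [e e0 he] := ev2 eps eps0.
  exists (Num.min e d); first by rewrite lt_min e0.
  move=> y z Ky Kz; rewrite !lt_min => /andP[y1 y2] /andP[z1 z2].
  have := he y z Ky Kz y1 z1; apply: le_trans; apply/eq_ler; congr (`|_|).
  have Gy : G y = g y *: nor y := nor_chart hch Ky y2.
  have Gz : G z = g z *: nor z := nor_chart hch Kz z2.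
  have D1 : D y z = nor y *m P - nor z *m P + (D y z *d n) *: n.
    by rewrite -mulmxBl -/(D y z) PE subrK.
  have u1 : (y - z) *m (P *m H p *m P) = (y - z) *m H p *m P - ((y - z) *d n) *: (n *m H p *m P).
    by move: (y - z) => u; rewrite !mulmxA (PE u) !mulmxBl -!scalemxAl.
  rewrite Gy Gz; exact (@shape_algebra R (g p) (g y) (g z) (D y z *d n) ((y - z) *d n) (nor y) (nor z) n (y - z)
    (n *m H p *m P) (H p) P gp0 D1 nP u1).
- exact: tan.
Qed.

End ParallelSurface.

(** * Preserved geodesics *)

Section PreservedGeodesics.
Variables (R : realType) (r : R) (C0 K0 Kr : set 'rV[R]_3).
Hypotheses (r_gt0 : 0 < r) (Kr_C2 : C2_surface Kr)
  (K0_convex : bounds_convex_body K0 C0) (Kr_outside : Kr `&` C0 = set0)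
  (dist : regular_constant_distance Kr K0 r).
Implicit Types (x y z u v w : 'rV[R]_3) (s t d eps tau : R).

Local Notation Pi := (projection K0).
Local Notation N := (nor r K0).

Lemma normal_geodesic p : Kr p -> exists d tau M, [/\ 0 < d, 0 < tau, 0 <= M &
  forall y v, `|y - p| < d -> Kr y -> v *d v = 1 -> v *d N y = 0 ->
  exists c w a : R -> 'rV[R]_3, [/\ c 0 = y, w 0 = v,
    forall t, `|c t - y| <= M * `|t|, forall t, `|w t - v| <= M * `|t| &
    forall t, `|t| < tau -> [/\ Kr (c t), vel c t (w t), vel w t (a t),
      {for t, continuous (a : R^o -> 'rV[R]_3)} &
      [/\ exists k, a t = k *: N (c t), w t *d w t = 1 & w t *d N (c t) = 0]]]].
Proof.
move=> Kp; have [f [G [H [d [hch pos]]]]] := oriented_chart r_gt0 Kr_C2 K0_convex Kr_outside dist Kp.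
have [d1 [tau [M [d10 tau0 M0 hg]]]] := chart_geodesic hch.
have d0 : 0 < d by case: hch.
have nG x : Kr x -> `|x - p| < d -> G x = (G x *d N x) *: N x.
  by move=> Kx xd; exact: (nor_chart r_gt0 K0_convex Kr_outside dist hch).
exists (Num.min d d1), tau, M; split=> //; first by rewrite lt_min d0.
move=> y v; rewrite lt_min => /andP[yd yd1] Ky vv vN.
have vG : v *d G y = 0 by rewrite nG // dotZr vN mulr0.
have [c [w [a [c0 w0 hc hw h]]]] := hg y v yd1 Ky vv vG.
exists c, w, a; split; [exact: c0 | exact: w0 | exact: hc | exact: hw |].
move=> t /h[cd Kc vc vw [ca [k ak] ww wG]].
split; [exact: Kc | exact: vc | exact: vw | exact: ca | split; [| exact: ww |]].
  by exists (k * (G (c t) *d N (c t))); rewrite ak {1}(nG _ Kc cd) scalerA.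
by move: wG; rewrite (nG _ Kc cd) dotZr => /eqP; rewrite mulf_eq0 (gt_eqF (pos _ Kc cd)) => /eqP.
Qed.

Variable A : 'rV[R]_3 -> 'M[R]_3.
Hypothesis hA : forall x, Kr x -> [/\ (A x)^T = A x, N x *m A x = 0,
  small_o Kr x (fun y z => N y - N z - (y - z) *m A x) &
  small_o Kr x (fun y z => (y - z) *d N x : R^o)].

Let b v x := v - r *: (v *m A x).

Lemma vel_nor (c : R -> 'rV[R]_3) t v d : 0 < d -> (forall s, `|s - t| < d -> Kr (c s)) ->
  vel c t v -> vel (fun s => N (c s)) t (v *m A (c t)).
Proof.
move=> d0 hK hv; have Kc : Kr (c t) by apply: hK; rewrite subrr normr0.
apply: (vel_mulmx d0 hK _ hv) => eps eps0.
have [_ _ /(_ _ eps0)[e e0 he] _] := hA Kc; exists e => // y Ky yd.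
by apply: he => //; rewrite subrr normr0.
Qed.

Lemma vel_projection (c : R -> 'rV[R]_3) t v d : 0 < d -> (forall s, `|s - t| < d -> Kr (c s)) ->
  vel c t v -> vel (fun s => Pi (c s)) t (b v (c t)).
Proof.
move=> d0 hK hv; have h := velB hv (velZ r (vel_nor d0 hK hv)).
by apply: (vel_near d0 _ h) => s _; rewrite -projE.
Qed.

Lemma near_dom t tau : `|t| < tau -> exists2 d, 0 < d & forall s, `|s - t| < d -> `|s| < tau.
Proof.
move=> ht; exists (tau - `|t|); first by rewrite subr_gt0.
move=> s sd; rewrite -(subrK t s); apply: le_lt_trans (ler_normD _ _) _; lra.
Qed.

Lemma open_interval_ball tau : 0 < tau -> open_interval [set t : R | `|t| < tau].
Proof.
move=> tau0; split.
- rewrite openE => t /= /near_dom[d d0 hd]; apply/(nbhs_eps (t : R^o)); exists d => //.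
- move=> x y /= hx hy z /andP[xz zy]; move: hx hy; rewrite !ltr_norml => /andP[h1 h2] /andP[h3 h4].
  by apply/andP; split; [apply: lt_le_trans xz | apply: le_lt_trans h4].
- by exists 0; rewrite /= normr0.
Qed.

Lemma normal_geodesic_is_geodesic (c w a : R -> 'rV[R]_3) tau : 0 < tau ->
  (forall t, `|t| < tau -> [/\ Kr (c t), vel c t (w t), vel w t (a t),
      {for t, continuous (a : R^o -> 'rV[R]_3)} &
      [/\ exists k, a t = k *: N (c t), w t *d w t = 1 & w t *d N (c t) = 0]]) ->
  geodesic Kr [set t | `|t| < tau] c.
Proof.
move=> tau0 h; have oI := open_interval_ball tau0; split=> //.
have vc t : `|t| < tau -> vel c t (w t) by case/h.
exists [set t | `|t| < tau], c, id; split.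
- split=> //.
  + apply: (@Ck2_vel R _ c w a); first by case: oI.
    * exact: vc.
    * by move=> t /h[].
    * by move=> t /h[].
  + by move=> t /h[].
  + by move=> t ht; rewrite (vel_derive1 (vc t ht)); apply/enorm_unit; have [_ _ _ _ []] := h t ht.
  + move=> t v ht tv; have [Kc _ vw _ [[k ak] _ _]] := h t ht.
    have [d d0 hd] := near_dom ht.
    have v2 : vel (derive1 c) t (a t).
      by apply: (vel_near d0 _ vw) => s /hd/vc/vel_derive1.
    rewrite (_ : derive1n 2 c t = derive1 (derive1 c) t) // (vel_derive1 v2) ak dotZl dotC.
    by rewrite (tangent_nor r_gt0 K0_convex Kr_outside dist Kc tv) mulr0.
- have vi (t : R^o) := vel_id t.
  split; first by move=> t _; exact: vel_continuous (vi t).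
  split; first by move=> t v _; have [] := vel_is_deriveZ v (vi t).
  move=> v; split=> // t _.
  have -> : (fun x : R^o => 'D_v (id : R^o -> R^o) x) = (fun=> v *: (1 : R^o)).
    by apply/funext => x; have [_ ->] := vel_is_deriveZ v (vi x).
  exact: cvg_cst.
- by move=> t _; rewrite (vel_derive1 (@vel_id R t)) oner_neq0.
- by apply/seteqP; split=> [_ [t ? <-]|t ?] //; exists t.
- by [].
Qed.

Hypothesis pres : preserves_geodesics Kr K0 Pi.

(** [T] is the velocity of the image in its own arc length, pulled back by [phi]. As [phi] is only
    C^1, no second derivative of [Pi (c t)] is at hand, but [T] is differentiable and its derivative
    is normal to [K0]. *)
Lemma image_geodesic (c w a : R -> 'rV[R]_3) tau : 0 < tau ->
  (forall t, `|t| < tau -> [/\ Kr (c t), vel c t (w t), vel w t (a t),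
      {for t, continuous (a : R^o -> 'rV[R]_3)} &
      [/\ exists k, a t = k *: N (c t), w t *d w t = 1 & w t *d N (c t) = 0]]) ->
  exists T q : R -> 'rV[R]_3, forall t, `|t| < tau -> [/\ T t *d T t = 1, vel T t (q t),
    exists2 f, f != 0 & b (w t) (c t) = f *: T t &
    forall v, tangent K0 (Pi (c t)) v -> q t *d v = 0].
Proof.
move=> tau0 h.
have [_ [J [s [phi [[oJ sC2 sK s1 sacc] phiC1 phi0 phiJ cs]]]]] := pres (normal_geodesic_is_geodesic tau0 h).
have vs (u : R) : J u -> vel s u (derive1 s u).
  by move=> Ju; apply: derivable_vel; case: sC2 => _ [/(_ u 1 Ju)].
have vs' (u : R) : J u -> vel (derive1 s) u (derive1n 2 s u).
  move=> Ju; have E : derive1 s = 'D_1 (s : R^o -> 'rV[R]_3) by apply/funext => x; exact: derive1E.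
  have ds : derivable (derive1 s : R^o -> 'rV[R]_3) u 1.
    by rewrite E; case: sC2 => _ [_ /(_ 1)[_ [/(_ u 1 Ju)]]].
  exact: derivable_vel ds.
have vphi t : `|t| < tau -> vel (phi : R -> R^o) t (derive1 phi t).
  by move=> ht; apply: derivable_vel; case: phiC1 => _ [/(_ t 1 ht)].
have Jphi t : `|t| < tau -> J (phi t) by move=> ht; rewrite -phiJ; exists t.
exists (fun t => derive1 s (phi t)), (fun t => derive1 phi t *: derive1n 2 s (phi t)) => t ht.
have Jt := Jphi t ht; split.
- exact/enorm_unit/s1.
- exact: vel_chain (vphi t ht) (vs' _ Jt).
- exists (derive1 phi t); first exact: phi0.
  have [d d0 hd] := near_dom ht.
  have [_ vc _ _ _] := h t ht.
  have hK (u : R) : `|u - t| < d -> Kr (c u) by move=> /hd/h[].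
  have e1 := vel_projection d0 hK vc.
  have e2 := vel_chain (vphi t ht) (vs _ Jt).
  apply: (vel_unique e1); apply: (vel_near d0 _ e2) => u /hd/cs <- //.
- move=> v tv; rewrite dotZl sacc ?mulr0 //.
  by rewrite -cs.
Qed.

(** The factor [f] is the speed of a reparametrization, hence nonzero: preserving geodesics makes
    the projection an immersion. *)
Lemma b_neq0 x v : Kr x -> v *d v = 1 -> v *d N x = 0 -> b v x != 0.
Proof.
move=> Kx vv vN; have [d [tau [M [d0 tau0 _ hg]]]] := normal_geodesic Kx.
have [|c [w [a [c0 w0 _ _ h]]]] := hg x v _ Kx vv vN; first by rewrite subrr normr0.
have [T [q /(_ 0)]] := image_geodesic tau0 h; rewrite normr0 => /(_ tau0)[TT _ [f f0 E] _].
rewrite -c0 -w0 E scaler_eq0 negb_or f0; apply: contra_eq_neq TT => ->.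
by rewrite dot0l eq_sym oner_neq0.
Qed.

Lemma tangent_image x v : Kr x -> v *d v = 1 -> v *d N x = 0 -> tangent K0 (Pi x) (b v x).
Proof.
move=> Kx vv vN; have [d [tau [M [d0 tau0 _ hg]]]] := normal_geodesic Kx.
have [|c [w [a [c0 w0 _ _ h]]]] := hg x v _ Kx vv vN; first by rewrite subrr normr0.
exists (fun t => Pi (c t)); split.
- by rewrite c0.
- apply/(nbhs_eps (0 : R^o)); exists tau => // t; rewrite subr0 => /h[Kc _ _ _ _].
  by have [] := projP dist Kc.
- apply: vel_is_derive; rewrite -c0 -w0; apply: (vel_projection tau0).
    by move=> s; rewrite subr0 => /h[].
  by have [|_ ? _ _ _] := h 0; rewrite ?normr0.
Qed.

Lemma shape_frame x : Kr x -> exists e1 e2 k1 k2,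
  [/\ orthonormal e1 e2 (N x), e1 *m A x = k1 *: e1 & e2 *m A x = k2 *: e2].
Proof.
by move=> Kx; have [As nA _ _] := hA Kx; apply: spectral_plane => //; exact: (nor_unit r_gt0 dist Kx).
Qed.

Lemma tangent_dot x q : Kr x -> (forall v, tangent K0 (Pi x) v -> q *d v = 0) ->
  forall v, v *d N x = 0 -> q *d v = 0.
Proof.
move=> Kx hq v vN; have [e1 [e2 [k1 [k2 [fr h1 h2]]]]] := shape_frame Kx.
have [e11 e22 _ [_ e1N e2N]] := fr.
have key e k : e *d e = 1 -> e *d N x = 0 -> e *m A x = k *: e -> q *d e = 0.
  move=> ee eN eA; have be : b e x = (1 - r * k) *: e by rewrite /b eA scalerA scalerBl scale1r.
  have := hq _ (tangent_image Kx ee eN); have := b_neq0 Kx ee eN.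
  rewrite be dotZr scaler_eq0 negb_or => /andP[h0 _] /eqP.
  by rewrite mulf_eq0 (negbTE h0) => /eqP.
rewrite (orthonormal_expand v fr) vN scale0r addr0 dotDr !dotZr.
by rewrite (key e1 k1) // (key e2 k2) // !mulr0 addr0.
Qed.

Lemma bN x v : Kr x -> v *d N x = 0 -> b v x *d N x = 0.
Proof.
move=> Kx vN; have [As nA _ _] := hA Kx.
by rewrite /b dotBl dotZl (dot_sym _ _ As) nA dot0r mulr0 vN subr0.
Qed.

(** The conserved quantity is [w *d T]: [w] has a derivative along [N], which is orthogonal to [T],
    and the derivative of [T] is orthogonal to [w]. The squared form without quotients avoids the
    sign of the reparametrization and square roots. *)
Lemma geodesic_angle p : Kr p -> exists d tau M, [/\ 0 < d, 0 < tau, 0 <= M &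
  forall y v, `|y - p| < d -> Kr y -> v *d v = 1 -> v *d N y = 0 ->
  exists c w : R -> 'rV[R]_3, [/\ c 0 = y, w 0 = v,
    forall t, `|c t - y| <= M * `|t|, forall t, `|w t - v| <= M * `|t| &
    forall t, `|t| < tau -> [/\ Kr (c t), vel c t (w t), exists k, vel w t (k *: N (c t)),
      w t *d w t = 1 /\ w t *d N (c t) = 0 &
      (w t *d b (w t) (c t)) ^+ 2 * (b v y *d b v y) = (v *d b v y) ^+ 2 * (b (w t) (c t) *d b (w t) (c t))]]].
Proof.
move=> Kp; have [d [tau [M [d0 tau0 M0 hg]]]] := normal_geodesic Kp.
exists d, tau, M; split=> // y v yd Ky vv vN.
have [c [w [a [c0 w0 cM wM h]]]] := hg y v yd Ky vv vN.
have [T [q hT]] := image_geodesic tau0 h.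
exists c, w; split; [exact: c0 | exact: w0 | exact: cM | exact: wM | move=> t ht].
have [Kc vc vw _ [[k ak] ww wN]] := h t ht.
split; [exact: Kc | exact: vc | by exists k; rewrite -ak | by [] |].
have wT s : `|s| < tau -> w s *d T s = v *d T 0.
  move=> hs; rewrite -w0; apply: (@vel0_cst_real R (fun s => w s *d T s) tau) => //; last by rewrite normr0.
  move=> u hu; have [Kcu _ vwu _ [[ku aku] _ wNu]] := h u hu; have [TT vT [f f0 E] hq] := hT u hu.
  have TN : T u *d N (c u) = 0.
    have := bN Kcu wNu; rewrite E dotZl => /eqP; rewrite mulf_eq0 (negbTE f0) => /eqP.
    by [].
  have qw : q u *d w u = 0 by apply: (tangent_dot Kcu hq).
  have := vel_dot vwu vT; rewrite aku dotZl (dotC (N _)) TN mulr0 add0r (dotC (w u)) qw.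
  by [].
have sq s : `|s| < tau -> exists2 f, (w s *d b (w s) (c s)) = f * (w s *d T s) & b (w s) (c s) *d b (w s) (c s) = f ^+ 2.
  move=> hs; have [TT _ [f _ ->] _] := hT s hs; exists f; first by rewrite dotZr.
  by rewrite dotZl dotZr TT mulr1 expr2.
have [f E1 E2] := sq t ht; have [|g E3 E4] := sq 0; first by rewrite normr0.
rewrite c0 w0 in E3 E4; rewrite E1 E2 E3 E4 wT //.
by ring.
Qed.

(** Differentiating firm nonexpansiveness along a geodesic gives [0 <= b v x *d u] with [u = v A].
    Then [u *d v] is this number plus [r (u *d u)], hence nonnegative; and [b v x *d b v x],
    positive by [b_neq0], equals [1 - r (u *d v) - r (b v x *d u)]. *)
Lemma shape_bounds x v : Kr x -> v *d N x = 0 -> v *d v = 1 ->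
  0 <= (v *m A x) *d v /\ r * ((v *m A x) *d v) < 1.
Proof.
move=> Kx vN vv; have [d [tau [M [d0 tau0 _ hg]]]] := normal_geodesic Kx.
have [|c [w [a [c0 w0 _ _ h]]]] := hg x v _ Kx vv vN; first by rewrite subrr normr0.
have t0 : `|0 : R| < tau by rewrite normr0.
have hK s : `|s - 0| < tau -> Kr (c s) by rewrite subr0 => /h[].
have vc : vel c 0 v by have [_ + _ _ _] := h 0 t0; rewrite w0.
have vn := vel_nor tau0 hK vc; have vp := vel_projection tau0 hK vc.
have vW := velB vn (vel_cst (N x) 0); have vP := velB vp (vel_cst (Pi x) 0).
rewrite !subr0 c0 in vW vP.
have := vel_dot_ge0 tau0 (P := fun s => Pi (c s) - Pi x) (Q := fun s => N (c s) - N x) _ _ vP vW.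
rewrite c0 !subrr => /(_ erefl erefl) H.
have {}H : 0 <= b v x *d (v *m A x).
  apply: H => s hs; have Ks : Kr (c s) by apply: hK; rewrite subr0.
  have := nor_firm r_gt0 K0_convex Kr_outside dist Ks Kx.
  rewrite !(@projE R r K0 r_gt0); set m := N (c s) - N x => hm.
  rewrite (_ : _ - _ - _ = (c s - x) - r *: m); last by apply/rowP => i; rewrite !mxE; ring.
  by rewrite dotBl dotZl (dotC _ m); lra.
set u := v *m A x in H *.
have uu := dot_ge0 u; have bb : 0 < b v x *d b v x by apply: dot_gt0; exact: b_neq0.
have E1 : b v x *d u = u *d v - r * (u *d u) by rewrite /b dotBl dotZl (dotC v).
have E2 : b v x *d b v x = 1 - r * (u *d v) - r * (b v x *d u).
  by rewrite E1 /b -/u dot_sub_scale vv (dotC v); ring.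
have ru : 0 <= r * (u *d u) by rewrite mulr_ge0 // ltW.
have rH : 0 <= r * (b v x *d u) by rewrite mulr_ge0 // ltW.
by split; lra.
Qed.

Hypothesis Kr_connected : connected Kr.

Lemma preserved_nsurf : nsurf r Kr N A.
Proof.
split=> //.
- by move=> x Kx; exact: (nor_unit r_gt0 dist Kx).
- by move=> x /hA[].
- by move=> x /hA[].
- move=> x v Kx vN; have [->|v0] := eqVneq v 0; first by rewrite dot0r.
  have hn : normalize v *d N x = 0 by rewrite dotZl vN mulr0.
  have [h _] := shape_bounds Kx hn (normalize_unit v0).
  rewrite -(normalizeK v0) -scalemxAl dotZl dotZr !mulr_ge0 ?enorm_ge0 //.
- by move=> x v Kx vN vv; have [] := shape_bounds Kx vN vv.
- by move=> x /hA[].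
- by move=> x /hA[].
- exact: geodesic_angle.
- move=> x Kx; have [f [G [H [d [hch pos]]]]] := oriented_chart r_gt0 Kr_C2 K0_convex Kr_outside dist Kx.
  have d0 : 0 < d by case: hch.
  have xd : `|x - x| < d by rewrite subrr normr0.
  have Gx := nor_chart r_gt0 K0_convex Kr_outside dist hch Kx xd.
  apply: (chart_graph hch Kx); first exact: (nor_unit r_gt0 dist Kx).
  exists (G x *d N x)^-1; rewrite Gx dotZl scalerA.
  have nn : N x *d N x = 1 by exact: (nor_unit r_gt0 dist Kx).
  by rewrite nn mulr1 mulVf ?scale1r // gt_eqF // pos.
Qed.

End PreservedGeodesics.

(** * Principal directions *)

Lemma unit_norm (R : realType) (v : 'rV[R]_3) : v *d v = 1 -> `|v| <= 1.
Proof. by move=> /enorm_unit <-; exact: norm_le_enorm. Qed.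

Lemma vel_bound (R : realType) (V W : normedModType R) (F : R -> V) (c : R -> W) p v (eps d : R) :
  0 < d -> 0 <= eps -> vel F 0 p -> vel c 0 v ->
  (forall t, `|t| < d -> `|F t - F 0| <= eps * `|c t - c 0|) -> `|p| <= eps * `|v|.
Proof.
move=> d0 eps0 hF hc h; apply/ler_addgt0Pl => eta eta0.
have E0 : 0 < eps + 1 by rewrite ltr_wpDl.
pose e := eta / (eps + 1); have e0 : 0 < e by rewrite divr_gt0.
have [d1 d10 h1] := hF _ e0; have [d2 d20 h2] := hc _ e0.
pose t := Num.min d (Num.min d1 d2) / 2.
have m0 : 0 < Num.min d (Num.min d1 d2) by rewrite !lt_min d0 d10.
have t0 : 0 < t by rewrite divr_gt0.
have nt : `|t| = t by rewrite gtr0_norm.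
have : t < Num.min d (Num.min d1 d2) by rewrite /t; lra.
rewrite !lt_min => /and3P[td td1 td2].
have := h t; rewrite nt => /(_ td) H.
have := h1 t; rewrite subr0 nt => /(_ td1) H1.
have := h2 t; rewrite subr0 nt => /(_ td2) H2.
rewrite -(ler_pM2l t0).
have A1 : t * `|p| <= `|F t - F 0| + e * t.
  have -> : t * `|p| = `|(F t - F 0) - (F t - F 0 - t *: p)| by rewrite subKr normrZ nt.
  by apply: le_trans (ler_normB _ _) _; rewrite lerD2l.
have A2 : `|c t - c 0| <= t * `|v| + e * t.
  have -> : c t - c 0 = t *: v + (c t - c 0 - t *: v) by rewrite [RHS]addrC subrK.
  by apply: le_trans (ler_normD _ _) _; rewrite normrZ nt lerD2l.
have A3 := ler_wpM2l eps0 A2.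
have ee : e * (eps + 1) = eta by rewrite /e divfK // gt_eqF.
have -> : t * (eta + eps * `|v|) = eps * (t * `|v| + e * t) + e * t by rewrite -ee; ring.
lra.
Qed.

Section Principal.
Variables (R : realType) (r : R) (S : set 'rV[R]_3) (N : 'rV[R]_3 -> 'rV[R]_3)
  (A : 'rV[R]_3 -> 'M[R]_3).
Hypotheses (r_gt0 : 0 < r) (ns : nsurf r S N A).
Implicit Types (p q x y z e u v w : 'rV[R]_3) (s t d eps tau k : R).

Let NN := ns_unit ns.
Let As := ns_sym ns.
Let NA := ns_null ns.

Definition kap x v := (v *m A x) *d v.

Lemma AN x v : S x -> (v *m A x) *d N x = 0.
Proof. by move=> Sx; rewrite (dot_sym _ _ (As Sx)) NA // dot0r. Qed.

Lemma vel_normal (c : R -> 'rV[R]_3) t v d : 0 < d -> (forall s, `|s - t| < d -> S (c s)) ->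
  vel c t v -> vel (fun s => N (c s)) t (v *m A (c t)).
Proof.
move=> d0 hK hv; have Kc : S (c t) by apply: hK; rewrite subrr normr0.
apply: (vel_mulmx d0 hK _ hv) => eps eps0.
have [e e0 he] := ns_shape ns Kc eps0; exists e => // y Ky yd.
by apply: he => //; rewrite subrr normr0.
Qed.

Lemma normal_cont x eps : S x -> 0 < eps -> exists2 d, 0 < d & forall y, S y -> `|y - x| < d -> `|N y - N x| < eps.
Proof.
move=> Sx eps0; have [d d0 hd] := ns_shape ns Sx ltr01.
have M0 : 0 < 1 + 3 * `|A x| by rewrite ltr_pwDl // mulr_ge0.
exists (Num.min d (eps / (1 + 3 * `|A x|))); first by rewrite lt_min d0 divr_gt0.
move=> y Sy; rewrite lt_min ltr_pdivlMr // => /andP[yd ye].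
have xd : `|x - x| < d by rewrite subrr normr0.
have := hd y x Sy Sx yd xd; rewrite mul1r => h.
rewrite -[N y - N x](subrK ((y - x) *m A x)); apply: le_lt_trans (ler_normD _ _) _.
apply: le_lt_trans (lerD h (mulmx_le_norm _ _)) _; move: ye; lra.
Qed.

(** The strict estimate at [x] controls derivatives at [y]: along a geodesic leaving [y] with
    velocity [v], the curve [N c - c A x] has velocity [v (A y - A x)] and moves by at most
    [eps / 16] times the displacement of [c]. The normal direction uses [N y *m A y = 0]. Three
    directions with coefficients at most [3 |v|] account for 16. *)
Lemma shape_cont x eps : S x -> 0 < eps -> exists2 d, 0 < d & forall y, S y -> `|y - x| < d ->
  forall v, `|v *m A y - v *m A x| <= eps * `|v|.
Proof.
move=> Sx eps0.
have e80 : 0 < eps / 16 by rewrite divr_gt0.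
have M0 : 0 < 3 * `|A x| + 1 by rewrite ltr_wpDl // mulr_ge0.
have [d d0 hd] := ns_shape ns Sx e80.
have [d' d'0 hd'] := normal_cont Sx (divr_gt0 e80 M0).
exists (Num.min d d'); first by rewrite lt_min d0.
move=> y Sy; rewrite lt_min => /andP[yd yd'].
have tang v : v *d v = 1 -> v *d N y = 0 -> `|v *m A y - v *m A x| <= eps / 16.
  move=> vv vN; have [e [tau [M [e0 tau0 M0' hg]]]] := ns_geo ns Sy.
  have [|c [w [c0 w0 cM _ hc]]] := hg y v _ Sy vv vN; first by rewrite subrr normr0.
  have t0 : `|0 : R| < tau by rewrite normr0.
  have hK s : `|s - 0| < tau -> S (c s) by rewrite subr0 => /hc[].
  have vc : vel c 0 v by have [_ + _ _ _] := hc 0 t0; rewrite w0.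
  have vn := vel_normal tau0 hK vc.
  have fm : fdiff setT (fun u => u *m A x) (c 0) (fun u => u *m A x).
    move=> eps1 eps10; exists 1 => // z _ _.
    by rewrite -mulmxBl subrr normr0 mulr_ge0 // ltW.
  have vF := velB vn (vel_mulmx ltr01 (fun _ _ => I) fm vc); rewrite c0 in vF.
  have M1 : 0 < M + 1 by rewrite ltr_wpDl.
  pose dd := Num.min tau ((d - `|y - x|) / (M + 1)).
  have dd0 : 0 < dd by rewrite lt_min tau0 divr_gt0 // subr_gt0.
  apply: (@le_trans _ _ (eps / 16 * `|v|)); last by rewrite ler_piMr ?(ltW e80) // unit_norm.
  apply: (vel_bound dd0 (ltW e80) vF vc).
  move=> t; rewrite lt_min ltr_pdivlMr // => /andP[ht1 ht2].
  have Kc : S (c t) by apply: hK; rewrite subr0.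
  have cd : `|c t - x| < d.
    rewrite -(subrKA y); apply: le_lt_trans (ler_normD _ _) _.
    by have := cM t; have := normr_ge0 t; lra.
  have := hd (c t) y Kc Sy cd yd; rewrite c0 mulmxBl; apply: le_trans; apply/eq_ler; congr (`|_|).
  by apply/rowP => i; rewrite !mxE; ring.
have norm_part : `|N y *m A y - N y *m A x| <= eps / 16.
  rewrite NA // sub0r normrN.
  have -> : N y *m A x = (N y - N x) *m A x by rewrite mulmxBl NA // subr0.
  apply: le_trans (mulmx_le_norm _ _) _.
  have := ltW (hd' y Sy yd'); rewrite ler_pdivlMr // => h.
  have n0 := normr_ge0 (N y - N x); lra.
move=> v; have [u1 [u2 fr]] := exists_perp (NN Sy).
have [h1 h2 h3 [_ h13 h23]] := fr.
have bnd w : w *d w = 1 -> `|w *m A y - w *m A x| <= eps / 16 ->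
    `|(v *d w) *: (w *m A y - w *m A x)| <= 3 * `|v| * (eps / 16).
  move=> ww hw; rewrite normrZ ler_pM //; apply: le_trans (dot_le_norm _ _) _.
  by rewrite ler_piMr ?mulr_ge0 // unit_norm.
have b1 := bnd u1 h1 (tang u1 h1 h13); have b2 := bnd u2 h2 (tang u2 h2 h23).
have b3 := bnd _ h3 norm_part.
have -> : v *m A y - v *m A x = (v *d u1) *: (u1 *m A y - u1 *m A x)
  + (v *d u2) *: (u2 *m A y - u2 *m A x) + (v *d N y) *: (N y *m A y - N y *m A x).
  rewrite {1 2}(orthonormal_expand v fr) !mulmxDl -!scalemxAl.
  by apply/rowP => i; rewrite !mxE; ring.
apply: le_trans (ler_normD _ _) _; apply: le_trans (lerD (ler_normD _ _) (lexx _)) _.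
by have := mulr_ge0 (normr_ge0 v) (ltW eps0); lra.
Qed.

Lemma kap_cont x v eps : S x -> 0 < eps -> exists2 d, 0 < d &
  forall y w, S y -> `|y - x| < d -> `|w - v| < d -> `|kap y w - kap x v| < eps.
Proof.
move=> Sx eps0.
pose V := `|v| + 1; have V0 : 0 < V by rewrite ltr_wpDl.
pose K := 3 * `|A x|; have K0 : 0 <= K by rewrite mulr_ge0.
pose e := eps / (6 * V * V * (K + 1) * 2).
have D0 : 0 < 6 * V * V * (K + 1) * 2 by rewrite !mulr_gt0 // ltr_wpDl.
have e0 : 0 < e by rewrite divr_gt0.
have eE : e * (6 * V * V * (K + 1) * 2) = eps by rewrite /e divfK // gt_eqF.
have [d d0 hd] := shape_cont Sx e0.
exists (Num.min d (Num.min e 1)); first by rewrite !lt_min d0 e0 ltr01.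
move=> y w Sy; rewrite !lt_min => /and3P[yd _ _] /and3P[_ we w1].
have wV : `|w| <= V by rewrite -(subrK v w) addrC; apply: le_trans (ler_normD _ _) _; rewrite lerD2l ltW.
have vV : `|v| <= V by rewrite /V lerDl.
have E : kap y w - kap x v = (w *m A y - w *m A x) *d w + ((w - v) *m A x) *d w + (v *m A x) *d (w - v).
  by rewrite /kap mulmxBl !dotBl !dotBr; ring.
have B1 : `|(w *m A y - w *m A x) *d w| <= 3 * (e * V) * V.
  apply: le_trans (dot_le_norm _ _) _; rewrite ler_pM ?mulr_ge0 //.
  by rewrite ler_wpM2l //; apply: le_trans (hd y Sy yd w) _; rewrite ler_wpM2l // ltW.
have B2 : `|((w - v) *m A x) *d w| <= 3 * (e * K) * V.
  apply: le_trans (dot_le_norm _ _) _; rewrite ler_pM ?mulr_ge0 //.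
  rewrite ler_wpM2l //; apply: le_trans (mulmx_le_norm _ _) _.
  by rewrite mulrAC mulrC ler_wpM2r // ltW.
have B3 : `|(v *m A x) *d (w - v)| <= 3 * (V * K) * e.
  apply: le_trans (dot_le_norm _ _) _; rewrite ler_pM ?mulr_ge0 ?(ltW we) //.
  rewrite ler_wpM2l //; apply: le_trans (mulmx_le_norm _ _) _.
  by rewrite mulrAC mulrC ler_wpM2r.
have V1 : 1 <= V by rewrite /V lerDr.
rewrite E; apply: le_lt_trans (ler_normD _ _) _; apply: le_lt_trans (lerD (ler_normD _ _) (lexx _)) _.
apply: le_lt_trans (lerD (lerD B1 B2) B3) _.
have eV : 0 < e * V by rewrite mulr_gt0.
have VK : V * K * 1 <= V * K * V by rewrite ler_wpM2l // mulr_ge0 // ltW.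
have h1 : 0 <= e * (V * K * V - V * K * 1) by rewrite mulr_ge0 ?subr_ge0 // ltW.
have h2 : 0 < e * V * V by rewrite mulr_gt0.
have h3 : 0 <= e * V * V * K by rewrite mulr_ge0 // ltW.
rewrite -eE; lra.
Qed.

Lemma principal_compl x w e k : S x -> w *m A x = k *: w -> orthonormal w e (N x) ->
  e *m A x = kap x e *: e.
Proof.
move=> Sx hw fr; have [ww ee _ [we wN eN]] := fr.
rewrite {1}(orthonormal_expand (e *m A x) fr) AN // scale0r addr0.
by rewrite (dot_sym _ _ (As Sx)) hw dotZr (dotC e) we mulr0 scale0r add0r.
Qed.

Lemma principal_kap x w k : S x -> w *d w = 1 -> w *m A x = k *: w -> kap x w = k.
Proof. by move=> Sx ww hw; rewrite /kap hw dotZl ww mulr1. Qed.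

(** The equality case of Cauchy-Schwarz, which turns a zero angle between [w] and its image into an
    eigenvector equation. *)
Lemma cauchy_eq (u v : 'rV[R]_3) : u *d u = 1 -> (u *d v) ^+ 2 = v *d v -> v = (u *d v) *: u.
Proof.
move=> uu h; apply/eqP; rewrite -subr_eq0; apply/eqP/dot_eq0.
rewrite dot_sub_scale uu (dotC v); lra.
Qed.

(** At the start [v] and its image are parallel, with the nonzero factor [1 - r k]. The angle stays
    0, so [w] stays principal. Then [w] and [N] rotate into each other at the common rate [kap],
    inside the plane of [v] and [N y]. *)
Lemma principal_geodesic p : S p -> exists d tau M, [/\ 0 < d, 0 < tau, 0 <= M &
  forall y v e k, `|y - p| < d -> S y -> orthonormal v e (N y) -> v *m A y = k *: v ->
  exists c w : R -> 'rV[R]_3, [/\ c 0 = y, w 0 = v,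
    forall t, `|c t - y| <= M * `|t|, forall t, `|w t - v| <= M * `|t| &
    forall t, `|t| < tau -> [/\ S (c t), vel c t (w t) /\ vel (fun t => N (c t)) t (kap (c t) (w t) *: w t),
      vel w t (- kap (c t) (w t) *: N (c t)), w t *m A (c t) = kap (c t) (w t) *: w t &
      [/\ orthonormal (w t) e (N (c t)), w t *d v = N (c t) *d N y & w t *d N y = - (N (c t) *d v)]]]].
Proof.
move=> Sp; have [d [tau [M [d0 tau0 M0 hg]]]] := ns_geo ns Sp.
exists d, tau, M; split=> // y v e k yd Sy fr vA.
have [vv ee _ [ve vN eN]] := fr.
have [c [w [c0 w0 cM wM h]]] := hg y v yd Sy vv vN.
exists c, w; split=> //.
have t0 : `|0 : R| < tau by rewrite normr0.
have wA t : `|t| < tau -> w t *m A (c t) = kap (c t) (w t) *: w t.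
  move=> ht; have [Sc vc _ [ww wN]] := h t ht; rewrite /= vA.
  have -> : v - r *: (k *: v) = (1 - r * k) *: v by rewrite scalerA scalerBl scale1r.
  rewrite !dotZl !dotZr vv !mulr1 => E.
  have rk : 0 < 1 - r * k.
    by rewrite subr_gt0; have := ns_lt ns Sy vN vv; rewrite vA dotZl vv mulr1.
  have E' : (w t *d (w t - r *: (w t *m A (c t)))) ^+ 2 =
     (w t - r *: (w t *m A (c t))) *d (w t - r *: (w t *m A (c t))).
    apply: (mulIf (x := (1 - r * k) * (1 - r * k))); first by rewrite mulf_neq0 // gt_eqF.
    by rewrite E expr2 mulrC.
  have := cauchy_eq ww E'; set m := w t *d _ => Em.
  have Ar : r *: (w t *m A (c t)) = (1 - m) *: w t by rewrite scalerBl scale1r -Em subKr.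
  have Aw : w t *m A (c t) = (r^-1 * (1 - m)) *: w t.
    by rewrite -scalerA -Ar scalerA mulVf ?scale1r // gt_eqF.
  by rewrite (principal_kap Sc ww Aw).
have vn t : `|t| < tau -> vel (fun t => N (c t)) t (kap (c t) (w t) *: w t).
  move=> ht; rewrite -wA //; have [dd dd0 hdd] := near_dom ht.
  have [_ vc _ _ _] := h t ht.
  by apply: (vel_normal dd0 _ vc) => s /hdd/h[].
have vw t : `|t| < tau -> vel w t (- kap (c t) (w t) *: N (c t)).
  move=> ht; have [Sc _ [k' vk] [ww wN] _] := h t ht.
  suff <- : k' = - kap (c t) (w t) by [].
  have [dd dd0 hdd] := near_dom ht.
  have := vel_dot vk (vn t ht); rewrite dotZl dotZr ww NN // !mulr1 => h1.
  have h2 : vel (fun s => w s *d N (c s) : R^o) t 0.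
    by apply: (vel_near dd0 _ (vel_cst (0 : R^o) t)) => s /hdd/h[_ _ _ [_ ->]].
  by have := vel_unique h1 h2 => ?; lra.
(* A pair with [f' = k' g] and [g' = - k' f] conserves [f^2 + g^2], whatever function of time [k']
   is. It is applied to the components along [e], then to two expressions that vanish when [(w, N)]
   is a rotation of [(v, N y)]. *)
have rot (f g : R -> R) : f 0 = 0 -> g 0 = 0 ->
    (forall t, `|t| < tau -> exists k', vel (f : R -> R^o) t (k' * g t) /\ vel (g : R -> R^o) t (- (k' * f t))) ->
    forall t, `|t| < tau -> f t = 0 /\ g t = 0.
  move=> f0 g0 hfg t ht.
  have : f t * f t + g t * g t = f 0 * f 0 + g 0 * g 0.
    apply: (@vel0_cst_real R (fun t => f t * f t + g t * g t) tau) => // s hs.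
    have [k' [h1 h2]] := hfg s hs.
    have := velD (vel_mul h1 h1) (vel_mul h2 h2).
    by rewrite [X in vel _ _ X](_ : _ = 0) //; move: (f s) (g s) => x z; ring.
  rewrite f0 g0 mulr0 addr0 -!expr2 => E.
  have := sqr_ge0 (f t); have := sqr_ge0 (g t) => h1 h2.
  by split; apply/eqP; rewrite -sqrf_eq0; apply/eqP; lra.
have We t : `|t| < tau -> N (c t) *d e = 0 /\ w t *d e = 0.
  apply: (rot (fun t => N (c t) *d e) (fun t => w t *d e)) => [||s hs].
  - by rewrite c0 dotC.
  - by rewrite w0.
  exists (kap (c s) (w s)); split; first by have := vel_dotl e (vn s hs); rewrite dotZl.
  by have := vel_dotl e (vw s hs); rewrite dotZl mulNr.
have Wv t : `|t| < tau -> w t *d N y + N (c t) *d v = 0 /\ w t *d v - N (c t) *d N y = 0.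
  apply: (rot (fun t => w t *d N y + N (c t) *d v) (fun t => w t *d v - N (c t) *d N y)) => [||s hs].
  - by rewrite w0 c0 vN dotC vN addr0.
  - by rewrite w0 c0 vv NN // subrr.
  exists (kap (c s) (w s)); split.
    have := velD (vel_dotl (N y) (vw s hs)) (vel_dotl v (vn s hs)); rewrite !dotZl.
    by congr vel; ring.
  have := velB (vel_dotl v (vw s hs)) (vel_dotl (N y) (vn s hs)); rewrite !dotZl.
  by congr vel; ring.
move=> t ht; have [Sc vc _ [ww wN] _] := h t ht.
have [Ne we] := We t ht; have [e1 e2] := Wv t ht.
split=> //; first by split=> //; exact: vn.
- exact: vw.
- exact: wA.
split; [|lra|lra].
split=> //; first exact: NN.
by split=> //; rewrite dotC.
Qed.

End Principal.

(** * Vanishing of one curvature *)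

Section Flatness.
Variables (R : realType) (r : R) (S : set 'rV[R]_3) (N : 'rV[R]_3 -> 'rV[R]_3)
  (A : 'rV[R]_3 -> 'M[R]_3).
Hypotheses (r_gt0 : 0 < r) (ns : nsurf r S N A).
Implicit Types (p q x y z e u v w : 'rV[R]_3) (s t d eps tau k beta : R).

Let NN := ns_unit ns.
Let As := ns_sym ns.
Local Notation kap := (kap A).

Lemma unit_near v w : v *d v = 1 -> `|w - v| <= 1 / 6 -> 1 / 2 <= w *d v.
Proof.
move=> vv h; have -> : w *d v = 1 + (w - v) *d v by rewrite dotBl vv; ring.
have : `|(w - v) *d v| <= 3 * (1 / 6) * 1.
  apply: le_trans (dot_le_norm _ _) _; rewrite ler_pM ?mulr_ge0 ?unit_norm //.
  by rewrite ler_wpM2l.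
by rewrite ler_norml => /andP[]; lra.
Qed.

(* Moving along the principal geodesic in direction v turns the normal within
   the plane of v and N y, through every small angle. *)
Lemma reach p v0 k0 eps : S p -> v0 *d v0 = 1 -> v0 *d N p = 0 -> v0 *m A p = k0 *: v0 -> 0 < k0 ->
  0 < eps -> exists2 eta, 0 < eta & forall y v e k beta, S y -> `|y - p| < eta -> `|v - v0| < eta ->
  orthonormal v e (N y) -> v *m A y = k *: v -> 0 <= beta <= eta ->
  exists q W al, [/\ S q, `|q - p| < eps, `|W - v0| < eps, W *m A q = kap q W *: W &
    [/\ 0 < al, al ^+ 2 + beta ^+ 2 = 1, N q = al *: N y + beta *: v, W = al *: v - beta *: N y &
      orthonormal W e (N q)]].
Proof.
move=> Sp vv0 vN0 vA0 k00 eps0.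
have [d [tau [M [d0 tau0 M0 hg]]]] := principal_geodesic r_gt0 ns Sp.
have k20 : 0 < k0 / 2 by rewrite divr_gt0.
have [dk dk0 hk] := kap_cont ns v0 Sp k20.
have kp : kap p v0 = k0 by exact: principal_kap vv0 vA0.
pose m := Num.min eps (Num.min dk 1).
have m0 : 0 < m by rewrite !lt_min eps0 dk0 ltr01.
have M1 : 0 < M + 1 by rewrite ltr_wpDl.
(* Up to [t1] the curvature stays above [k0 / 2] and, thanks to [1 / 6], [w *d v] above [1 / 2]. So
   [N (c t) *d v] grows at rate at least [k0 / 4] and takes every value up to [t1 * (k0 / 4)], which
   bounds [eta]. *)
pose t1 := Num.min (tau / 2) (Num.min (m / 2 / (M + 1)) (1 / 6 / (M + 1))).
have t10 : 0 < t1 by rewrite !lt_min !divr_gt0.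
have t1tau : t1 < tau.
  by apply: le_lt_trans (_ : tau / 2 < _); [rewrite ge_min lexx | lra].
have t1m : M * t1 <= m / 2.
  have : t1 * (M + 1) <= m / 2 by rewrite -ler_pdivlMr // /t1 !ge_min lexx orbT.
  by lra.
have t16 : M * t1 <= 1 / 6.
  have : t1 * (M + 1) <= 1 / 6 by rewrite -ler_pdivlMr // /t1 !ge_min lexx !orbT.
  by lra.
pose eta := Num.min d (Num.min (m / 2) (t1 * (k0 / 4))).
have eta0 : 0 < eta by rewrite !lt_min d0 !divr_gt0 //= mulr_gt0 // divr_gt0.
have etad : eta <= d by rewrite ge_min lexx.
have etam : eta <= m / 2 by rewrite !ge_min lexx orbT.
have etat : eta <= t1 * (k0 / 4) by rewrite !ge_min lexx !orbT.
clearbody eta t1; exists eta => // y v e k beta Sy yp vp fr vA /andP[b0 b1].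
have [vv _ _ [_ vN _]] := fr.
have [c [w [c0 w0 cM wM h]]] := hg y v e k (lt_le_trans yp etad) Sy fr vA.
have dom t : 0 <= t <= t1 -> `|t| < tau.
  by move=> /andP[h1 h2]; rewrite ger0_norm //; apply: le_lt_trans t1tau.
have near t : 0 <= t <= t1 -> [/\ `|c t - p| < m, `|w t - v0| < m & `|w t - v| <= 1 / 6].
  move=> /andP[h1 h2]; have Mt : M * `|t| <= M * t1 by rewrite ler_wpM2l // ger0_norm.
  have cMt := cM t; have wMt := wM t.
  split; last by lra.
    by rewrite -(subrKA y); apply: le_lt_trans (ler_normD _ _) _; lra.
  by rewrite -(subrKA v); apply: le_lt_trans (ler_normD _ _) _; lra.
pose f t := N (c t) *d v.
have vf t : 0 <= t <= t1 -> vel (f : R -> R^o) t (kap (c t) (w t) * (w t *d v)).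
  move=> ht; have [_ [_ vn] _ _ _] := h t (dom t ht).
  by have := vel_dotl v vn; rewrite dotZl.
have df t : 0 <= t <= t1 -> k0 / 4 <= kap (c t) (w t) * (w t *d v).
  move=> ht; have [h1 h2 h3] := near t ht; have [Sc _ _ _ _] := h t (dom t ht).
  move: h1 h2; rewrite !lt_min => /and3P[_ h1 _] /and3P[_ h2 _].
  have := hk (c t) (w t) Sc h1 h2; rewrite kp ltr_norml => /andP[h4 _].
  have h5 := unit_near vv h3.
  have h6 : k0 / 2 <= kap (c t) (w t) by lra.
  apply: le_trans (_ : (k0 / 2) * (1 / 2) <= _); first lra.
  by apply: ler_pM => //; lra.
have f0 : f 0 = 0 by rewrite /f c0 dotC.
have [t1' /andP[ta tb] ft1] := mean_value t10 vf.
have f1 : eta <= f t1.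
  rewrite f0 !subr0 in ft1; rewrite ft1; apply: le_trans etat _.
  by rewrite ler_wpM2l ?(ltW t10) // df // !ltW.
have [||t ht ft] := @ivt R f 0 t1 beta (ltW t10).
- by move=> t ht; exact: vel_continuous (vf t ht).
- by rewrite f0 b0 /=; apply: le_trans f1.
have [Sc _ _ wA [fr' wv wN]] := h t (dom t ht); have [h1 h2 h3] := near t ht.
exists (c t), (w t), (w t *d v).
have Ne : N (c t) *d e = 0 by have [_ _ _ [_ _ ?]] := fr'; rewrite dotC.
have we : w t *d e = 0 by have [_ _ _ []] := fr'.
have frr := fr; have EN : N (c t) = (w t *d v) *: N y + beta *: v.
  rewrite {1}(orthonormal_expand (N (c t)) fr) Ne scale0r addr0 addrC.
  by rewrite wv -ft.
have Ew : w t = (w t *d v) *: v - beta *: N y.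
  by rewrite {1}(orthonormal_expand (w t) fr) we scale0r addr0 wN -ft scaleNr.
split=> //.
- by move: h1; rewrite lt_min => /andP[].
- by move: h2; rewrite lt_min => /andP[].
split=> //.
- by have := unit_near vv h3; lra.
- have := NN Sc; rewrite {1 2}EN !dotDl !dotDr !dotZl !dotZr (NN Sy) vv (dotC (N y) v) vN => E.
  by rewrite !expr2; lra.
Qed.

(** If [N y = N z], the strict estimate bounds the components of [y - z] along [e1] and [e2], as
    [k1] and [k2] are nonzero, and [ns_tan] bounds the one along [N p]. With this [C] they add up to
    at most half of [|y - z|]. *)
Lemma normal_inj p e1 e2 k1 k2 : S p -> orthonormal e1 e2 (N p) -> e1 *m A p = k1 *: e1 ->
  e2 *m A p = k2 *: e2 -> k1 != 0 -> k2 != 0 ->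
  exists2 d, 0 < d & forall y z, S y -> S z -> `|y - p| < d -> `|z - p| < d -> N y = N z -> y = z.
Proof.
move=> Sp fr h1 h2 k10 k20; have [e11 e22 nn [_ e1n e2n]] := fr.
pose C := 3 / `|k1| + 3 / `|k2| + 1.
have C0 : 0 < C by rewrite ltr_wpDl // addr_ge0 // divr_ge0.
have eps0 : 0 < 1 / 2 / C by rewrite !divr_gt0.
have [d d0 hd] := ns_shape ns Sp eps0; have [d' d'0 hd'] := ns_tan ns Sp eps0.
exists (Num.min d d'); first by rewrite lt_min d0.
move=> y z Sy Sz; rewrite !lt_min => /andP[y1 y2] /andP[z1 z2] Nyz.
have H1 := hd y z Sy Sz y1 z1; have H2 := hd' y z Sy Sz y2 z2.
rewrite Nyz subrr sub0r normrN in H1.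
apply/eqP; rewrite -subr_eq0 -normr_le0; set u := y - z in H1 H2 *.
have comp e k : e *d e = 1 -> e *m A p = k *: e -> k != 0 -> `|u *d e| <= 3 / `|k| * (1 / 2 / C * `|u|).
  move=> ee eA k0; have E : (u *m A p) *d e = k * (u *d e) by rewrite (dot_sym _ _ (As Sp)) eA dotZr.
  have : `|k| * `|u *d e| <= 3 * (1 / 2 / C * `|u|).
    rewrite -normrM -E; apply: le_trans (dot_le_norm _ _) _.
    rewrite -[leRHS]mulr1; apply: ler_pM; rewrite ?mulr_ge0 ?unit_norm //.
    by rewrite ler_wpM2l.
  have kk : 0 < `|k| by rewrite normr_gt0.
  by move=> hh; rewrite mulrAC ler_pdivlMr // mulrC.
have b1 := comp e1 k1 e11 h1 k10; have b2 := comp e2 k2 e22 h2 k20.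
have U : `|u| <= `|u *d e1| + `|u *d e2| + `|u *d N p|.
  rewrite {1}(orthonormal_expand u fr); apply: le_trans (ler_normD _ _) _.
  have bn (a : R) (x : 'rV[R]_3) : x *d x = 1 -> `|a *: x| <= `|a|.
    by move=> xx; rewrite normrZ ler_piMr // unit_norm.
  by rewrite lerD ?bn // (le_trans (ler_normD _ _)) // lerD // bn.
have E : (3 / `|k1| + 3 / `|k2| + 1) * (1 / 2 / C) = 1 / 2 by rewrite -/C mulrC divfK // gt_eqF.
have : `|u| <= 1 / 2 * `|u|.
  by apply: le_trans U _; apply: le_trans (lerD (lerD b1 b2) H2) _; rewrite -[X in _ <= X * _]E; apply/eq_ler; ring.
by have := normr_ge0 u; lra.
Qed.

Lemma flat p e1 e2 k1 k2 : S p -> orthonormal e1 e2 (N p) -> e1 *m A p = k1 *: e1 ->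
  e2 *m A p = k2 *: e2 -> k1 != k2 -> k1 * k2 = 0.
Proof.
move=> Sp fr h1 h2 k12; have [e11 e22 nn [e12 e1n e2n]] := fr.
have [e21 ne1 ne2] : [/\ e2 *d e1 = 0, N p *d e1 = 0 & N p *d e2 = 0] by rewrite !(dotC _ e1) !(dotC _ e2) -?(dotC e1) e12.
have kap1 : kap p e1 = k1 by exact: principal_kap e11 h1.
have kap2 : kap p e2 = k2 by exact: principal_kap e22 h2.
have k1ge : 0 <= k1 by rewrite -kap1; exact: (ns_ge0 ns).
have k2ge : 0 <= k2 by rewrite -kap2; exact: (ns_ge0 ns).
apply/eqP; rewrite mulf_eq0 -[_ || _]negbK negb_or; apply/negP => /andP[k10 k20].
have {}k1ge : 0 < k1 by rewrite lt0r k10.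
have {}k2ge : 0 < k2 by rewrite lt0r k20.
have g0 : 0 < `|k1 - k2| / 2 by rewrite divr_gt0 // normr_gt0 subr_eq0.
have [d1 d10 hk1] := kap_cont ns e1 Sp g0; have [d2 d20 hk2] := kap_cont ns e2 Sp g0.
have [di di0 hinj] := normal_inj Sp fr h1 h2 k10 k20.
pose eps := Num.min d1 (Num.min d2 di).
have eps0 : 0 < eps by rewrite !lt_min d10 d20.
have [ed1 ed2 edi] : [/\ eps <= d1, eps <= d2 & eps <= di] by rewrite /eps !ge_min !lexx !orbT.
clearbody eps.
(* The second legs are prepared first: their radii [ea] and [eb] set the accuracy [eps'] required of
   the first legs [ra'] and [rb']. *)
have [ea ea0 ra] := reach Sp e11 e1n h1 k1ge eps0.
have [eb eb0 rb] := reach Sp e22 e2n h2 k2ge eps0.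
pose eps' := Num.min eps (Num.min ea eb).
have eps'0 : 0 < eps' by rewrite !lt_min eps0 ea0.
have [ea' ea'0 ra'] := reach Sp e11 e1n h1 k1ge eps'0.
have [eb' eb'0 rb'] := reach Sp e22 e2n h2 k2ge eps'0.
pose beta := Num.min (Num.min ea eb) (Num.min ea' eb').
have beta0 : 0 < beta by rewrite !lt_min ea0 eb0 ea'0.
(* [beta] is the sine of the first rotation on both routes and [beta2] that of the second. The final
   normal is [sq^-1 (al N p + beta e1) + beta2 e2], or the same with [e1] and [e2] exchanged; the
   two agree because [beta2 = beta / sq]. *)
pose sq := Num.sqrt (1 + beta ^+ 2).
have sq2 : sq ^+ 2 = 1 + beta ^+ 2 by rewrite sqr_sqrtr // addr_ge0 // sqr_ge0.
have sq1 : 1 <= sq.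
  by rewrite -ler_sqr ?nnegrE ?sqrtr_ge0 // sq2 expr1n lerDl sqr_ge0.
have sq0 : 0 < sq by lra.
pose beta2 := beta / sq.
have beta20 : 0 <= beta2 by rewrite divr_ge0 // ltW.
have b2b : beta2 <= beta by rewrite ler_pdivrMr // ler_peMr // ltW.
have uniq al : 0 < al -> al ^+ 2 + beta2 ^+ 2 = 1 -> al = sq^-1.
  move=> al0 E; apply/eqP; rewrite -(eqrXn2 (n := 2)) ?invr_ge0 ?ltW //; apply/eqP.
  rewrite exprVn sq2; move: E; rewrite /beta2 expr_div_n sq2.
  have b2 := sqr_ge0 beta.
  have : (1 + beta ^+ 2)^-1 + beta ^+ 2 / (1 + beta ^+ 2) = 1.
    by field; apply/lt0r_neq0; lra.
  by move: (_^-1) => i; move: (beta ^+ 2 * i) => j; lra.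
have uniq1 a b : 0 < a -> 0 < b -> a ^+ 2 + beta ^+ 2 = 1 -> b ^+ 2 + beta ^+ 2 = 1 -> a = b.
  by move=> a0 b0 E1 E2; apply/eqP; rewrite -(eqrXn2 (n := 2)) ?ltW //; apply/eqP; lra.
have bound (e : R) : (beta <= e -> 0 <= beta <= e) * (beta <= e -> 0 <= beta2 <= e).
  by split=> he; rewrite ?(ltW beta0) // beta20 (le_trans b2b).
have [bea beb bea' beb'] : [/\ beta <= ea, beta <= eb, beta <= ea' & beta <= eb'].
  by rewrite /beta !ge_min !lexx !orbT.
have p0 (d : R) : 0 < d -> `|p - p| < d by rewrite subrr normr0.
have v0 v (d : R) : 0 < d -> `|v - v| < d by rewrite subrr normr0.
(* Both routes end at the normal proportional to N p + beta e1 + beta e2. *)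
have [p1 [W1 [al [Sp1 p1p W1p W1A [al0 alE N1 W1E fr1]]]]] :=
  ra' p e1 e2 k1 beta Sp (p0 _ ea'0) (v0 _ _ ea'0) fr h1 ((bound _).1 bea').
have [p2 [W2 [al' [Sp2 p2p W2p W2A [al'0 al'E N2 W2E fr2]]]]] :=
  rb' p e2 e1 k2 beta Sp (p0 _ eb'0) (v0 _ _ eb'0) (orthonormal_swap fr) h2 ((bound _).1 beb').
have aal : al' = al by exact: uniq1.
rewrite {}aal in N2 W2E.
have e2A1 := principal_compl ns Sp1 W1A fr1.
have e1A2 := principal_compl ns Sp2 W2A fr2.
have [p1b p1a p1e] : [/\ `|p1 - p| < eb, `|p1 - p| < ea & `|W1 - e1| < eps].
  by move: p1p W1p; rewrite !lt_min => /and3P[_ ? ?] /and3P[? _ _].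
have [p2b p2a p2e] : [/\ `|p2 - p| < eb, `|p2 - p| < ea & `|W2 - e2| < eps].
  by move: p2p W2p; rewrite !lt_min => /and3P[_ ? ?] /and3P[? _ _].
have [q [X1 [a1 [Sq qp X1p X1A [a10 a1E Nq X1E frq]]]]] :=
  rb p1 e2 W1 _ beta2 Sp1 p1b (v0 _ _ eb0) (orthonormal_swap fr1) e2A1 ((bound _).2 beb).
have [q' [X2 [a2 [Sq' q'p X2p X2A [a20 a2E Nq' X2E frq']]]]] :=
  ra p2 e1 W2 _ beta2 Sp2 p2a (v0 _ _ ea0) (orthonormal_swap fr2) e1A2 ((bound _).2 bea).
have Ea1 := uniq _ a10 a1E; have Ea2 := uniq _ a20 a2E; subst a1 a2.
have qq' : q = q'.
  apply: hinj => //.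
  - exact: lt_le_trans qp edi.
  - exact: lt_le_trans q'p edi.
  rewrite Nq Nq' N1 N2 /beta2 !scalerDr !scalerA mulrC -!addrA; congr (_ + _).
  by rewrite addrC (mulrC beta).
subst q'.
have W1q := principal_compl ns Sq X1A frq.
have W2q := principal_compl ns Sq X2A frq'.
have K1 : `|kap q W1 - k1| < `|k1 - k2| / 2.
  by have := hk1 q W1 Sq (lt_le_trans qp ed1) (lt_le_trans p1e ed1); rewrite kap1.
have K2 : `|kap q W2 - k2| < `|k1 - k2| / 2.
  by have := hk2 q W2 Sq (lt_le_trans qp ed2) (lt_le_trans p2e ed2); rewrite kap2.
(* Each first leg tilts its principal direction by [- beta] along [N p]. Eigenvectors of the
   symmetric [A q] that are not orthogonal share their eigenvalue, whereas [K1] and [K2] keep the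
   eigenvalues apart. *)
have W12 : W1 *d W2 = beta ^+ 2.
  by rewrite W1E W2E !dotBl !dotBr !dotZl !dotZr e12 e1n (dotC (N p) e2) e2n nn; ring.
have : kap q W1 * (W1 *d W2) = kap q W2 * (W1 *d W2).
  by rewrite -dotZl -W1q (dot_sym _ _ (As Sq)) W2q dotZr.
have : W1 *d W2 != 0 by rewrite W12 expf_neq0 // gt_eqF.
move=> /mulIf inj /inj E; move: K1 K2; rewrite E.
have := ler_normB (kap q W2 - k1) (kap q W2 - k2).
rewrite (_ : kap q W2 - k1 - _ = - (k1 - k2)); last by ring.
by rewrite normrN; move: (`|_|) (`|_|) (`|_|) => x y z; lra.
Qed.

End Flatness.

(** * Ruled case *)

Section Rulings.
Variables (R : realType) (r : R) (S : set 'rV[R]_3) (N : 'rV[R]_3 -> 'rV[R]_3)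
  (A : 'rV[R]_3 -> 'M[R]_3).
Hypotheses (r_gt0 : 0 < r) (ns : nsurf r S N A).
Implicit Types (p q x y z e u v w : 'rV[R]_3) (s t d eps tau k : R).

Let NN := ns_unit ns.
Let As := ns_sym ns.
Local Notation kap := (kap A).

Lemma kap_near p eps : S p -> 0 < eps -> exists2 d, 0 < d &
  forall y u, S y -> `|y - p| < d -> u *d u = 1 -> `|kap y u - kap p u| < eps.
Proof.
move=> Sp eps0; have [d d0 hd] := shape_cont ns Sp (divr_gt0 eps0 (ltr0Sn R 3)).
exists d => // y u Sy yd uu; rewrite /kap -dotBl.
apply: le_lt_trans (dot_le_norm _ _) _; have := hd y Sy yd u; have := unit_norm uu.
have := normr_ge0 (u *m A y - u *m A p); move: (`|u|) (`|_ - _|) => a b b0 a1 ba.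
have : b * a <= b * 1 by rewrite ler_wpM2l.
have : eps / 4 * a <= eps / 4 * 1 by rewrite ler_wpM2l // divr_ge0 // ltW.
lra.
Qed.

(** By [flat] one of the two curvatures vanishes; as curvatures are nonnegative, it is the smaller
    one. *)
Lemma null_of_flat q e w : S q -> orthonormal e w (N q) -> e *m A q = kap q e *: e ->
  kap q e < kap q w -> e *m A q = 0.
Proof.
move=> Sq fr eA lt; have wA := principal_compl ns Sq eA fr.
have := flat r_gt0 ns Sq fr eA wA; rewrite neq_lt lt => /(_ isT) /eqP.
rewrite mulf_eq0 => /orP[/eqP E|/eqP E]; first by rewrite eA E scale0r.
have [_ _ _ [_ eN _]] := fr; have := ns_ge0 ns Sq eN; rewrite -/(kap q e).
by rewrite -E leNgt lt.
Qed.

(** The principal geodesic from [y] in direction [e] has a constant transverse principal direction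
    [e'], whose curvature stays close to [k]. So the curvature along the geodesic vanishes, and its
    velocity and the normal are constant. *)
Lemma ruling p e1 e k : S p -> orthonormal e1 e (N p) -> e1 *m A p = k *: e1 -> e *m A p = 0 -> 0 < k ->
  exists d sg, [/\ 0 < d, 0 < sg & forall y s, S y -> `|y - p| < d -> e *d N y = 0 -> e *m A y = 0 ->
    `|s| < sg -> [/\ S (y + s *: e), N (y + s *: e) = N y & e *m A (y + s *: e) = 0]].
Proof.
move=> Sp fr h1 h0 k0; have [e11 ee nn [e1e e1n en]] := fr.
have k80 : 0 < k / 8 by rewrite divr_gt0.
have [d1 [tau [M [d10 tau0 M0 hg]]]] := principal_geodesic r_gt0 ns Sp.
have [d2 d20 hk2] := kap_near Sp k80.
have [d3 d30 hk3] := kap_cont ns e Sp k80.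
have [d4 d40 hN] := normal_cont ns Sp (ltac:(by rewrite divr_gt0) : 0 < 1 / 6 :> R).
pose m := Num.min d2 d3; have m0 : 0 < m by rewrite lt_min d20.
have M1 : 0 < M + 1 by rewrite ltr_wpDl.
exists (Num.min d1 (Num.min d4 (m / 2))), (Num.min tau (m / 2 / (M + 1))).
split; [by rewrite !lt_min d10 d40 divr_gt0 | by rewrite lt_min tau0 !divr_gt0 |].
move=> y s Sy; rewrite !lt_min => /and3P[yd1 yd4 ym] eN eA /andP[s1 s2].
have o1 := cross_orthonormal ee (NN Sy) eN.
pose e' := cross e (N y).
have fr' : orthonormal e e' (N y) := orthonormal_swap (orthonormal_rot (orthonormal_rot o1)).
have [_ e'e' _ [ee' _ e'Ny]] := fr'.
have eA0 : e *m A y = 0 *: e by rewrite eA scale0r.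
have [c [w [c0 w0 cM wM h]]] := hg y e e' 0 yd1 Sy fr' eA0.
(* [|N y - N p| < 1 / 6] gives [|e' *d N p| <= 1 / 2], so [(e' *d e1) ^+ 2] is at least [3 / 4]. The
   tolerance [k / 8] then separates the two curvatures, as [k / 2 - k / 8] exceeds [k / 8]. *)
have kp : k / 2 <= kap p e'.
  have E : kap p e' = k * (e' *d e1) ^+ 2.
    rewrite /kap {1}(orthonormal_expand e' fr) (dotC e' e) ee' scale0r addr0 mulmxDl -!scalemxAl h1.
    by rewrite (ns_null ns) // scaler0 addr0 !dotZl (dotC e1); ring.
  have E2 : (e' *d e1) ^+ 2 + (e' *d N p) ^+ 2 = 1.
    rewrite -e'e' {3}(orthonormal_expand e' fr) (dotC e' e) ee' scale0r addr0.
    by rewrite dotDl !dotZl (dotC e1) (dotC (N p)) -!expr2.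
  have : `|e' *d N p| <= 1 / 2.
    rewrite -[N p](subKr (N y)) dotBr e'Ny sub0r normrN; apply: le_trans (dot_le_norm _ _) _.
    have := ltW (hN y Sy yd4); have := unit_norm e'e'.
    have := normr_ge0 (N y - N p); move: (`|e'|) (`|_ - _|) => a b b0 a1 ba.
    have : a * b <= 1 * b by rewrite ler_wpM2r.
    lra.
  rewrite -ler_sqr ?nnegrE // real_normK ?num_real // => le4.
  rewrite E; have : k * (1 / 2) <= k * (e' *d e1) ^+ 2.
    by rewrite ler_wpM2l ?(ltW k0) //; move: le4; rewrite expr_div_n; lra.
  lra.
have near t : `|t| < Num.min tau (m / 2 / (M + 1)) -> [/\ `|t| < tau, `|c t - p| < m & `|w t - e| < m].
  rewrite lt_min ltr_pdivlMr // => /andP[t1 t2]; have := cM t; have := wM t; have := normr_ge0 t => h3 h4 h5.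
  split=> //; last by lra.
  by rewrite -(subrKA y); apply: le_lt_trans (ler_normD _ _) _; lra.
have null t : `|t| < Num.min tau (m / 2 / (M + 1)) -> w t *m A (c t) = 0.
  move=> /near[t1]; rewrite !lt_min => /andP[c2 c3] /andP[w2 w3].
  have [Sc _ _ wA [frt _ _]] := h t t1; apply: (null_of_flat Sc frt wA).
  have := hk2 (c t) e' Sc c2 e'e'; have := hk3 (c t) (w t) Sc c3 w3.
  have -> : kap p e = 0 by rewrite /kap h0 dot0l.
  by rewrite !ltr_norml => /andP[_ B1] /andP[B2 _]; lra.
have kap0 t : `|t| < Num.min tau (m / 2 / (M + 1)) -> kap (c t) (w t) = 0.
  by move=> /null E; rewrite /kap E dot0l.
have tt0 : `|0 : R| < Num.min tau (m / 2 / (M + 1)) by rewrite normr0 lt_min tau0 !divr_gt0.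
have ss : `|s| < Num.min tau (m / 2 / (M + 1)) by rewrite lt_min s1.
have we t : `|t| < Num.min tau (m / 2 / (M + 1)) -> w t = e.
  move=> ht; rewrite -w0; apply: (@vel0_cst R _ w (Num.min tau (m / 2 / (M + 1)))) => // t' ht'.
  by have [/h[_ _ + _ _] _ _] := near t' ht'; rewrite kap0 // oppr0 scale0r.
have cE : c s = y + s *: e.
  have : c s - s *: e = c 0 - 0 *: e.
    apply: (@vel0_cst R _ (fun s => c s - s *: e) (Num.min tau (m / 2 / (M + 1)))) => // t ht.
    have [/h[_ [vc _] _ _ _] _ _] := near t ht.
    have := velB vc (vel_scale (vel_id t) (vel_cst e t)).
    by rewrite we // scale1r scaler0 addr0 subrr.
  by rewrite c0 scale0r subr0 => <-; rewrite subrK.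
have NE : N (c s) = N y.
  rewrite -c0; apply: (@vel0_cst R _ (fun s => N (c s)) (Num.min tau (m / 2 / (M + 1)))) => // t ht.
  by have [/h[_ [_ +] _ _ _] _ _] := near t ht; rewrite kap0 // scale0r.
rewrite -cE; split=> //; last by rewrite -(we s) // null.
by have [/h[]] := near s ss.
Qed.

(** The intermediate value theorem provides [t] matching the coordinate of [q] along [e1], and [s]
    matches the one along [e]. What is left of the difference points along [N p], and by [ns_tan] it
    is at most half of itself. *)
Lemma cover p e1 e (c w : R -> 'rV[R]_3) tau sg : S p -> orthonormal e1 e (N p) -> c 0 = p ->
  0 < tau -> 0 < sg -> (forall t, `|t| < tau -> vel c t (w t)) -> 0 < w 0 *d e1 ->
  (forall t s, `|t| < tau -> `|s| < sg -> S (c t + s *: e)) ->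
  exists2 d, 0 < d & forall q, S q -> `|q - p| < d ->
    exists t s, [/\ `|t| < tau, `|s| < sg & q = c t + s *: e].
Proof.
move=> Sp fr c0 tau0 sg0 vc a0 hS; have [e11 ee nn [e1e e1n en]] := fr.
have [dl dl0 htan] := ns_tan ns Sp (ltac:(by rewrite divr_gt0) : 0 < 1 / 2 :> R).
pose rho := Num.min (dl / 8) (sg / 8); have rho0 : 0 < rho by rewrite lt_min !divr_gt0.
have rdl : rho <= dl / 8 by rewrite ge_min lexx.
have rsg : rho <= sg / 8 by rewrite ge_min lexx orbT.
clearbody rho; have t00 : `|0 : R| < tau by rewrite normr0.
have [t0 t0p ht0] := vel_cont (vc 0 t00) rho0; rewrite c0 in ht0.
pose u t := (c t - p) *d e1; set a := w 0 *d e1 in a0.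
have vu t : `|t| < tau -> vel (u : R -> R^o) t (w t *d e1).
  by move=> /vc h; have := vel_dotl e1 (velB h (vel_cst p t)); rewrite subr0.
have [t1 t1p ht1] := vu 0 t00 (a / 2) (divr_gt0 a0 (ltr0Sn R 1)).
have u0 : u 0 = 0 by rewrite /u c0 subrr dot0l.
pose T := Num.min tau (Num.min t0 t1) / 2.
have m0 : 0 < Num.min tau (Num.min t0 t1) by rewrite !lt_min tau0 t0p.
have T0 : 0 < T by rewrite divr_gt0.
have : T < Num.min tau (Num.min t0 t1) by rewrite /T; move: m0; lra.
rewrite !lt_min => /and3P[Ttau Tt0 Tt1]; clearbody T.
have uT : a * T / 2 <= u T /\ u (- T) <= - (a * T / 2).
  have nT : `|T| = T by rewrite gtr0_norm.
  have := ht1 T; have := ht1 (- T); rewrite u0 !subr0 normrN nT => /(_ Tt1) A1 /(_ Tt1) A2.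
  have Z (x : R) : x *: (a : R^o) = x * a by [].
  move: A1 A2; rewrite -/a !Z !ler_norml => /andP[_ A1] /andP[A2 _].
  by move: A1 A2; move: (u T) (u (- T)) => x y; split; lra.
have aT0 : 0 < a * T / 2 by rewrite divr_gt0 // mulr_gt0.
exists (Num.min rho (a * T / 2 / 3)); first by rewrite lt_min rho0 divr_gt0.
move=> q Sq; rewrite lt_min => /andP[qr qa].
have [|t||t /andP[tT1 tT2] ut] := @ivt R u (- T) T ((q - p) *d e1).
- by lra.
- move=> /andP[h1 h2]; apply: vel_continuous (vu t _).
  by rewrite ltr_norml; lra.
- have : `|(q - p) *d e1| <= a * T / 2.
    apply: le_trans (dot_le_norm _ _) _; have := unit_norm e11; have := normr_ge0 (q - p).
    move: (`|e1|) qa; move: (`|q - p|) => b c' qa b0 c1.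
    have : b * c' <= b * 1 by rewrite ler_wpM2l.
    lra.
  by rewrite ler_norml => /andP[h1 h2]; lra.
have tT : `|t| <= T by rewrite ler_norml tT1.
have ttau : `|t| < tau by apply: le_lt_trans tT Ttau.
have cp : `|c t - p| < rho by apply: ht0; rewrite subr0; apply: le_lt_trans tT Tt0.
pose s := (q - c t) *d e.
have qc : `|q - c t| < 2 * rho.
  by rewrite -(subrKA p); apply: le_lt_trans (ler_normD _ _) _; rewrite (distrC p); lra.
have sb : `|s| <= 3 * `|q - c t|.
  by apply: le_trans (dot_le_norm _ _) _; rewrite ler_piMr ?mulr_ge0 // unit_norm.
have ssg : `|s| < sg by lra.
exists t, s; split=> //; have Sy := hS t s ttau ssg.
set y := c t + s *: e in Sy *.
have yp : `|y - p| < dl.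
  rewrite (_ : y - p = (c t - p) + s *: e); last by rewrite /y addrAC.
  apply: le_lt_trans (ler_normD _ _) _; rewrite normrZ.
  have : `|s| * `|e| <= `|s| by rewrite ler_piMr // unit_norm.
  lra.
have qdl : `|q - p| < dl by lra.
have H := htan q y Sq Sy qdl yp.
have E : q - y = ((q - y) *d N p) *: N p.
  rewrite {1}(orthonormal_expand (q - y) fr).
  have -> : (q - y) *d e1 = 0.
    rewrite (_ : q - y = (q - p) - (c t - p) - s *: e); last by apply/rowP => i; rewrite /y !mxE; ring.
    by move: ut; rewrite /u !dotBl dotZl (dotC e) e1e => ->; ring.
  have -> : (q - y) *d e = 0.
    by rewrite /y opprD addrA dotBl dotZl ee -/s mulr1 subrr.
  by rewrite !scale0r !add0r.
apply/eqP; rewrite -subr_eq0 -normr_le0.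
have : `|q - y| <= 1 / 2 * `|q - y|.
  rewrite {1}E normrZ; apply: le_trans _ H; rewrite ler_piMr // unit_norm //.
by have := normr_ge0 (q - y); lra.
Qed.

Lemma vel_perp (c : R -> 'rV[R]_3) t v e : vel c t v -> vel (fun s => perp e (c s)) t (perp e v).
Proof.
move=> hc; have := velB hc (vel_scale (vel_dotl e hc) (vel_cst e t)).
by rewrite scaler0 addr0.
Qed.

(** The normal as an affine function of position: a cylinder of axis [e], or for [e = 0] a sphere or
    a plane. The clause on [A] allows the local results to be restarted at any point where the model
    holds. *)
Definition model p e k q := [/\ e *d N q = 0,
  forall u, u *m A q = k *: (perp e u - (u *d N q) *: N q) & N q - N p = k *: perp e (q - p)].

(** The formula for [A] on tangent vectors is the derivative of the affine formula along geodesics;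
    on the normal both sides vanish. *)
Lemma modelP p e k d : axis e -> 0 < d ->
  (forall q, S q -> `|q - p| < d -> e *d N q = 0 /\ N q - N p = k *: perp e (q - p)) ->
  forall q, S q -> `|q - p| < d -> model p e k q.
Proof.
move=> he d0 h q Sq qd; have [eN Nq] := h q Sq qd; split=> // u.
have tang v : v *d v = 1 -> v *d N q = 0 -> v *m A q = k *: perp e v.
  move=> vv vN; have [d1 [tau [M [d10 tau0 M0 hg]]]] := ns_geo ns Sq.
  have [|c [w [c0 w0 cM _ hc]]] := hg q v _ Sq vv vN; first by rewrite subrr normr0.
  have t0 : `|0 : R| < tau by rewrite normr0.
  have hK s : `|s - 0| < tau -> S (c s) by rewrite subr0 => /hc[].
  have vc : vel c 0 v by have [_ + _ _ _] := hc 0 t0; rewrite w0.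
  have vn := vel_normal ns tau0 hK vc; rewrite c0 in vn.
  have vp := velD (vel_cst (N p - k *: perp e p) 0) (velZ k (vel_perp e vc)).
  rewrite add0r in vp; apply: (vel_unique vn).
  have qd0 : 0 < d - `|q - p| by rewrite subr_gt0.
  have [d2 d20 hd2] := vel_cont vc qd0.
  apply: (vel_near (d := Num.min tau d2) _ _ vp); first by rewrite lt_min tau0.
  move=> s; rewrite lt_min => /andP[/hK Sc /hd2]; rewrite c0 => sd.
  have cp : `|c s - p| < d.
    by rewrite -(subrKA q); apply: le_lt_trans (ler_normD _ _) _; lra.
  have [_ ] := h (c s) Sc cp; rewrite perpB scalerBr => /eqP; rewrite subr_eq => /eqP ->.
  by rewrite addrC [RHS]addrAC addrA.
have [u1 [u2 fr]] := exists_perp (NN Sq); have [h1 h2 h3 [_ h13 h23]] := fr.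
have pN : perp e (N q) = N q by rewrite perp_id // dotC.
rewrite {1 2}(orthonormal_expand u fr) !mulmxDl -!scalemxAl (ns_null ns) // scaler0 addr0.
rewrite (tang u1) // (tang u2) // (perpD _ (_ *: u1 + _ *: u2)) (perpD _ (_ *: u1)) !perpZ pN addrK.
by move: (perp e u1) (perp e u2) (u *d u1) (u *d u2) => a b x y; apply/rowP => i; rewrite !mxE; ring.
Qed.

(** Rulings sweep out two curves in turn. The principal geodesic along [e1] shows that [e] is
    tangent and null on a neighbourhood. The bisecting geodesic then carries the value of the other
    curvature; a principal one could not, as its angle with its image is 0 whatever the
    curvature. *)
Lemma cylinder_local p e1 e k : S p -> orthonormal e1 e (N p) -> e1 *m A p = k *: e1 -> e *m A p = 0 ->
  0 < k -> exists2 d, 0 < d & forall q, S q -> `|q - p| < d -> model p e k q.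
Proof.
move=> Sp fr h1 h0 k0; have [e11 ee nn [e1e e1n en]] := fr.
have [d1 [sg [d10 sg0 rul]]] := ruling Sp fr h1 h0 k0.
have kp1 : kap p e1 = k by exact: principal_kap e11 h1.
have kp0 : kap p e = 0 by rewrite /kap h0 dot0l.
have k20 : 0 < k / 2 by rewrite divr_gt0.
have [d2 d20 null] : exists2 d, 0 < d & forall q, S q -> `|q - p| < d -> e *d N q = 0 /\ e *m A q = 0.
  have [dd [tau [M [dd0 tau0 M0 hg]]]] := principal_geodesic r_gt0 ns Sp.
  have pp : `|p - p| < dd by rewrite subrr normr0.
  have [c [w [c0 w0 cM wM h]]] := hg p e1 e k pp Sp fr h1.
  have [da da0 ha] := kap_cont ns e1 Sp k20; have [db db0 hb] := kap_near Sp k20.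
  have M1 : 0 < M + 1 by rewrite ltr_wpDl.
  pose m := Num.min d1 (Num.min da db); have m0 : 0 < m by rewrite !lt_min d10 da0.
  have [m1 ma mb] : [/\ m <= d1, m <= da & m <= db] by rewrite /m !ge_min !lexx !orbT.
  clearbody m.
  pose tau' := Num.min tau (m / (M + 1)); have tau'0 : 0 < tau' by rewrite lt_min tau0 divr_gt0.
  have dom t : `|t| < tau' -> [/\ `|t| < tau, `|c t - p| < m & `|w t - e1| < m].
    rewrite lt_min ltr_pdivlMr // => /andP[t1 t2]; have := cM t; have := wM t; have := normr_ge0 t.
    by split=> //; lra.
  clearbody tau'.
  have eq t : `|t| < tau' -> e *d N (c t) = 0 /\ e *m A (c t) = 0.
    move=> /dom[t1 tc tw]; have [Sc _ _ wA [frt _ _]] := h t t1.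
    have [_ _ _ [_ _ eN]] := frt; split=> //.
    have eA := principal_compl ns Sc wA frt.
    apply: (null_of_flat Sc (orthonormal_swap frt) eA).
    have := hb (c t) e Sc (lt_le_trans tc mb) ee; have := ha (c t) (w t) Sc (lt_le_trans tc ma) (lt_le_trans tw ma).
    by rewrite kp1 kp0 !ltr_norml => /andP[B1 _] /andP[_ B2]; lra.
  have rc t s : `|t| < tau' -> `|s| < sg -> [/\ S (c t + s *: e), N (c t + s *: e) = N (c t) & e *m A (c t + s *: e) = 0].
    move=> ht hs; have [t1 tc _] := dom t ht; have [eN eA] := eq t ht.
    have [Sc _ _ _ _] := h t t1.
    exact: (rul _ _ Sc (lt_le_trans tc m1) eN eA hs).
  have [|||d3 d30 h3] := @cover p e1 e c w tau' sg Sp fr c0 tau'0 sg0.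
  - by move=> t /dom[/h[_ []]].
  - by rewrite w0 e11.
  - by move=> t s ht hs; have [] := rc t s ht hs.
  exists d3 => // q Sq /(h3 q Sq)[t [s [ht hs ->]]].
  by have [_ -> ->] := rc t s ht hs; have [-> _] := eq t ht.
pose hh : R := Num.sqrt (1 / 2).
have hh2 : hh * hh = 1 / 2 by rewrite -expr2 sqr_sqrtr // divr_ge0.
have hh0 : 0 < hh by rewrite sqrtr_gt0 divr_gt0.
clearbody hh.
pose v := hh *: e1 + hh *: e.
have vv : v *d v = 1 by rewrite /v !dotDl !dotDr !dotZl !dotZr e11 ee e1e (dotC e) e1e; lra.
have vN : v *d N p = 0 by rewrite /v dotDl !dotZl e1n en; ring.
have [dd [tau [M [dd0 tau0 M0 hg]]]] := ns_geo ns Sp.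
have pp : `|p - p| < dd by rewrite subrr normr0.
have [c [w [c0 w0 cM wM h]]] := hg p v pp Sp vv vN.
have M1 : 0 < M + 1 by rewrite ltr_wpDl.
pose m := Num.min d1 d2; have m0 : 0 < m by rewrite lt_min d10.
have [m1 m2] : m <= d1 /\ m <= d2 by rewrite /m !ge_min !lexx !orbT.
clearbody m.
pose tau' := Num.min tau (m / (M + 1)); have tau'0 : 0 < tau' by rewrite lt_min tau0 divr_gt0.
have dom t : `|t| < tau' -> `|t| < tau /\ `|c t - p| < m.
  rewrite lt_min ltr_pdivlMr // => /andP[t1 t2]; have := cM t; have := normr_ge0 t.
  by split=> //; lra.
clearbody tau'; have t00 : `|0 : R| < tau' by rewrite normr0.
have nul t : `|t| < tau' -> e *d N (c t) = 0 /\ e *m A (c t) = 0.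
  move=> /dom[t1 tc]; have [Sc _ _ _ _] := h t t1.
  by apply: null => //; exact: lt_le_trans tc m2.
(* The acceleration is along the normal, which is orthogonal to [e]: the geodesic keeps bisecting
   the principal directions. *)
have we t : `|t| < tau' -> w t *d e = hh.
  move=> ht; have <- : w 0 *d e = hh by rewrite w0 /v dotDl !dotZl e1e ee; ring.
  apply: (@vel0_cst_real R (fun t => w t *d e) tau') => // s hs.
  have [ts _] := dom s hs; have [_ _ [k' vw] _ _] := h s ts; have [eN _] := nul s hs.
  by have := vel_dotl e vw; rewrite dotZl dotC eN mulr0.
have wA t : `|t| < tau' -> w t *m A (c t) = k *: perp e (w t).
  move=> ht; have [t1 _] := dom t ht; have [Sc _ _ [ww wN] inv] := h t t1.
  have [eN eA] := nul t ht; have wet := we t ht.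
  pose u := hh^-1 *: (w t - hh *: e).
  have wE : w t = hh *: u + hh *: e by rewrite /u scalerA divff ?gt_eqF // scale1r subrK.
  have uw : u *d w t = hh.
    rewrite /u dotZl dotBl dotZl ww (dotC e) wet (_ : 1 - hh * hh = hh * hh); last by rewrite hh2; lra.
    by rewrite mulrA mulVf ?mul1r // gt_eqF.
  have ue : u *d e = 0 by rewrite /u dotZl dotBl dotZl ee wet mulr1 subrr mulr0.
  have uu : u *d u = 1.
    by rewrite {2}/u dotZr dotBr dotZr uw ue mulr0 subr0 mulVf // gt_eqF.
  have uN : u *d N (c t) = 0 by rewrite /u dotZl dotBl dotZl wN eN mulr0 subr0 mulr0.
  clearbody u.
  have fru : orthonormal e u (N (c t)) by split=> //; [exact: NN | split=> //; rewrite dotC].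
  have eA' : e *m A (c t) = 0 *: e by rewrite eA scale0r.
  have uA := principal_compl ns Sc eA' fru; set kk := kap (c t) u in uA.
  have kk0 : 0 <= kk by apply: (ns_ge0 ns).
  have kk1 : r * kk < 1 by apply: (ns_lt ns).
  have rk1 : r * k < 1 by have := ns_lt ns Sp e1n e11; rewrite -/(kap p e1) kp1.
  have wA : w t *m A (c t) = (hh * kk) *: u by rewrite {1}wE mulmxDl -!scalemxAl eA uA scaler0 addr0 scalerA.
  have vA : v *m A p = (hh * k) *: e1 by rewrite /v mulmxDl -!scalemxAl h0 h1 scaler0 addr0 scalerA.
  have ve1 : v *d e1 = hh by rewrite /v dotDl !dotZl e11 (dotC e) e1e; ring.
  suff E : kk = k.
    by rewrite wA E /perp wet mulrC -scalerA; congr (_ *: _); rewrite [in RHS]wE addrK.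
  move: inv; rewrite /= wA vA !scalerA !dot_sub_scale vv ww !dotBr !dotZr ww vv (dotC (w t)) uw ve1 uu e11.
  set X := r * kk in kk1; set Y := r * k in rk1.
  have hX a : r * (hh * a) * hh = r * a * (1 / 2) by rewrite -hh2; ring.
  have hX2 a : r * (hh * a) * (r * (hh * a)) = r * a * (r * a) * (1 / 2) by rewrite -hh2; ring.
  rewrite !hX !hX2 -/X -/Y !mulr1 => inv.
  have Y0 : 0 < Y by rewrite mulr_gt0.
  have X0 : 0 <= X by rewrite mulr_ge0 // ltW.
  (* The conserved angle reads [(1 - X/2)^2 (1 - Y + Y^2/2) = (1 - Y/2)^2 (1 - X + X^2/2)], which
     factors. The second factor is positive since [0 <= X] and [0 < Y < 1]. *)
  have prod : (X - Y) * (X + Y - X * Y) = 0.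
    by move: inv; rewrite expr2 expr2; lra.
  have pos : 0 < X + Y - X * Y.
    have : X * Y <= X * 1 by rewrite ler_wpM2l // ltW.
    by lra.
  have XY : X = Y.
    apply/eqP; rewrite -subr_eq0; move/eqP: prod; rewrite mulf_eq0 => /orP[//|].
    by rewrite gt_eqF.
  by apply: (mulfI (x := r)); rewrite ?gt_eqF.
have Nc t : `|t| < tau' -> N (c t) - N p = k *: perp e (c t - p).
  move=> ht.
  have : N (c t) - k *: perp e (c t) = N (c 0) - k *: perp e (c 0).
    apply: (@vel0_cst R _ (fun t => N (c t) - k *: perp e (c t)) tau') => // s hs.
    have [ds ds0 hds] := near_dom hs; have [s1 _] := dom s hs; have [_ vc _ _ _] := h s s1.
    have vn : vel (fun t => N (c t)) s (w s *m A (c s)).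
      by apply: (vel_normal ns ds0 _ vc) => s' /hds/dom[/h[]].
    by have := velB vn (velZ k (vel_perp e vc)); rewrite wA // subrr.
  rewrite c0 perpB scalerBr => /eqP; rewrite subr_eq => /eqP ->.
  by apply/rowP => i; rewrite !mxE; ring.
have rc t s : `|t| < tau' -> `|s| < sg -> [/\ S (c t + s *: e), N (c t + s *: e) = N (c t) & e *m A (c t + s *: e) = 0].
  move=> ht hs; have [t1 tc] := dom t ht; have [eN eA] := nul t ht.
  have [Sc _ _ _ _] := h t t1.
  exact: (rul _ _ Sc (lt_le_trans tc m1) eN eA hs).
have [|||d3 d30 h3] := @cover p e1 e c w tau' sg Sp fr c0 tau'0 sg0.
- by move=> t /dom[/h[]].
- by rewrite w0 /v dotDl !dotZl e11 (dotC e) e1e mulr0 addr0 mulr1.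
- by move=> t s ht hs; have [] := rc t s ht hs.
have he : axis e by right.
exists (Num.min d2 d3); first by rewrite lt_min d20.
apply: modelP => //; first by rewrite lt_min d20.
move=> q Sq; rewrite lt_min => /andP[/(null q Sq)[eN _] /(h3 q Sq)[t [s [ht hs qE]]]]; split=> //.
have [_ Nq _] := rc t s ht hs; rewrite qE Nq Nc //; congr (_ *: _).
by rewrite addrAC (perpD e (c t - p)) perpZ perp_axis // scaler0 addr0.
Qed.

End Rulings.

(** * Umbilical case and classification *)

Section Classification.
Variables (R : realType) (r : R) (S : set 'rV[R]_3) (N : 'rV[R]_3 -> 'rV[R]_3)
  (A : 'rV[R]_3 -> 'M[R]_3).
Hypotheses (r_gt0 : 0 < r) (ns : nsurf r S N A).
Implicit Types (p q x y z e u v w : 'rV[R]_3) (s t d eps k : R).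

Let NN := ns_unit ns.
Let As := ns_sym ns.
Local Notation kap := (kap A).
Local Notation model := (model N A).

(** [c] is only Lipschitz and may have no velocity. At an umbilic the strict estimates leave, in the
    increment of [N - k x], only the normal component of the displacement, which [ns_tan] makes
    negligible. *)
Lemma umbilic_vel (c : R -> 'rV[R]_3) k t d (M : R) : S (c t) ->
  (forall u, u *m A (c t) = k *: (u - (u *d N (c t)) *: N (c t))) ->
  0 < d -> 0 <= M -> (forall s, `|s - t| < d -> S (c s)) ->
  (forall s, `|s - t| < d -> `|c s - c t| <= M * `|s - t|) ->
  vel (fun s => N (c s) - k *: c s) t 0.
Proof.
move=> Sx hk d0 M0 hS hM eps eps0.
pose e1 := eps / ((1 + `|k|) * (M + 1)).
have D0 : 0 < (1 + `|k|) * (M + 1) by apply: mulr_gt0; [rewrite ltr_pwDl | rewrite ltr_wpDl].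
have e10 : 0 < e1 by rewrite divr_gt0.
have eE : e1 * ((1 + `|k|) * (M + 1)) = eps by rewrite /e1 divfK // gt_eqF.
clearbody e1.
have [d1 d10 h1] := ns_shape ns Sx e10; have [d2 d20 h2] := ns_tan ns Sx e10.
have M1 : 0 < M + 1 by rewrite ltr_wpDl.
exists (Num.min d (Num.min d1 d2 / (M + 1))).
  by rewrite lt_min d0 divr_gt0 // lt_min d10.
move=> s; rewrite lt_min ltr_pdivlMr // => /andP[sd].
rewrite lt_min => /andP[s1 s2]; have cM := hM s sd.
have st0 := normr_ge0 (s - t).
have [c1 c2] : `|c s - c t| < d1 /\ `|c s - c t| < d2 by split; lra.
have cc d' : 0 < d' -> `|c t - c t| < d' by rewrite subrr normr0.
have := h1 _ _ (hS s sd) Sx c1 (cc d1 d10); have := h2 _ _ (hS s sd) Sx c2 (cc d2 d20).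
rewrite scaler0 subr0 hk.
have -> : N (c s) - k *: c s - (N (c t) - k *: c t) =
  (N (c s) - N (c t) - k *: (c s - c t - ((c s - c t) *d N (c t)) *: N (c t))) -
  (k * ((c s - c t) *d N (c t))) *: N (c t).
  by move: (_ *d _) => a; apply/rowP => i; rewrite !mxE; ring.
move=> B2 B1; apply: le_trans (ler_normB _ _) _; rewrite normrZ normrM.
have nt : `|N (c t)| <= 1 by apply: unit_norm; exact: NN.
have k0 := normr_ge0 k.
have B3 : `|k| * `|(c s - c t) *d N (c t)| * `|N (c t)| <= `|k| * (e1 * `|c s - c t|).
  apply: le_trans (ler_piMr _ nt) _; first by rewrite mulr_ge0.
  by rewrite ler_wpM2l.
have B4 : e1 * (1 + `|k|) * `|c s - c t| <= e1 * (1 + `|k|) * (M * `|s - t|).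
  by rewrite ler_wpM2l // mulr_ge0 ?ltW // ltr_pwDl.
have B5 : e1 * (1 + `|k|) * (M * `|s - t|) <= eps * `|s - t|.
  rewrite -eE -!mulrA ler_wpM2l ?(ltW e10) // ler_wpM2l ?addr_ge0 // ler_wpM2r //.
  by rewrite lerDl.
apply: le_trans (le_trans B4 B5).
apply: le_trans (lerD B1 B3) _.
by rewrite le_eqVlt; apply/orP; left; apply/eqP; ring.
Qed.

(** * Constancy of the curvature over a graph of umbilics *)

Section Graph.
Variables (kp : 'rV[R]_3 -> R) (g : R -> R -> 'rV[R]_3) (p u1 u2 : 'rV[R]_3) (eta : R).
Hypothesis umb : forall x, S x -> forall u, u *m A x = kp x *: (u - (u *d N x) *: N x).
Hypothesis gS : forall a b, `|a| < eta -> `|b| < eta -> S (g a b).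
Hypothesis g2 : forall a b, `|a| < eta -> `|b| < eta -> g a b *d u2 = p *d u2 + b.
Hypothesis gL1 : forall a a' b, `|a| < eta -> `|a'| < eta -> `|b| < eta ->
  `|g a' b - g a b| <= 2 * `|a' - a|.
Hypothesis gL2 : forall a b b', `|a| < eta -> `|b| < eta -> `|b'| < eta ->
  `|g a b' - g a b| <= 2 * `|b' - b|.

Lemma graph_vel1 a b : `|a| < eta -> `|b| < eta ->
  vel (fun t => N (g t b) - kp (g a b) *: g t b) a 0.
Proof.
move=> ha hb; have [d d0 hd] := near_dom ha; have Sg := gS ha hb.
apply: (@umbilic_vel (fun t => g t b) _ _ d 2) => //; first exact: umb.
  by move=> s /hd hs; exact: gS.
by move=> s /hd hs; exact: gL1.
Qed.

Lemma graph_vel2 a b : `|a| < eta -> `|b| < eta ->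
  vel (fun t => N (g a t) - kp (g a b) *: g a t) b 0.
Proof.
move=> ha hb; have [d d0 hd] := near_dom hb; have Sg := gS ha hb.
apply: (@umbilic_vel (fun t => g a t) _ _ d 2) => //; first exact: umb.
  by move=> s /hd hs; exact: gS.
by move=> s /hd hs; exact: gL2.
Qed.

(* [N \o g] has partial derivatives [kp * d g / d a] and [kp * d g / d b]: hence [N *d u2] does not
   depend on [a], and neither does its derivative [kp] in [b]. *)
Lemma graph_curvature a b : `|a| < eta -> `|b| < eta -> kp (g a b) = kp (g 0 b).
Proof.
move=> ha; have eta0 : 0 < eta by apply: le_lt_trans ha.
have h0 : `|0 : R| < eta by rewrite normr0.
have cst b' : `|b'| < eta -> N (g a b') *d u2 = N (g 0 b') *d u2.
  move=> hb; apply: (@vel0_cst_real R (fun t => N (g t b') *d u2) eta) => // t ht.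
  have [d d0 hd] := near_dom ht.
  have := velD (vel_dotl u2 (graph_vel1 ht hb)) (vel_cst (kp (g t b') * (p *d u2 + b') : R^o) t).
  rewrite dot0l addr0; apply: (vel_near d0) => s /hd hs.
  by rewrite dotBl dotZl g2 // subrK.
have dv a' : `|a'| < eta -> `|b| < eta -> vel (fun t => N (g a' t) *d u2 : R^o) b (kp (g a' b)).
  move=> ha' hb; have [d d0 hd] := near_dom hb.
  have := velD (vel_dotl u2 (graph_vel2 ha' hb))
    (velZ (kp (g a' b)) (velD (vel_cst (p *d u2 : R^o) b) (vel_id b))).
  rewrite dot0l !add0r; rewrite [X in vel _ _ X](_ : _ = kp (g a' b)); last by apply: mulr1.
  apply: (vel_near d0) => s /hd hs.
  rewrite dotBl dotZl g2 //; exact: subrK.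
move=> hb; apply: (vel_unique (dv a ha hb)).
have [d d0 hd] := near_dom hb.
by apply: (vel_near d0) (dv 0 h0 hb) => s /hd hs; rewrite -cst.
Qed.

End Graph.

(** [ns_graph] parametrizes the surface over its tangent plane, and [ns_tan] makes the
    parametrization Lipschitz. This is enough for [graph_curvature], which asks for no derivative of
    the curvature; afterwards [N - k x] is constant along both coordinate lines. *)
Lemma umbilic_local (kp : 'rV[R]_3 -> R) p :
  (forall x, S x -> forall u, u *m A x = kp x *: (u - (u *d N x) *: N x)) -> S p ->
  exists2 d, 0 < d & forall q, S q -> `|q - p| < d -> model p 0 (kp p) q.
Proof.
move=> umb Sp; have [u1 [u2 fr]] := exists_perp (NN Sp).
have [h11 h22 hnn [h12 h1n h2n]] := fr.
have [n1 n2 nn] : [/\ `|u1| <= 1, `|u2| <= 1 & `|N p| <= 1].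
  by split; apply: unit_norm => //; exact: NN.
have [d1 d10 gr] := ns_graph ns Sp.
have [d2 d20 tn] := ns_tan ns Sp (ltac:(by rewrite divr_gt0) : 0 < 1 / 2 :> R).
(* A graph point with parameters below [eta] is within [2 (|a| + |b|) < 4 eta] of [p]. *)
pose eta := Num.min d1 d2 / 6.
have eta0 : 0 < eta by rewrite divr_gt0 // lt_min d10.
have [e1 e2] : 6 * eta <= d1 /\ 6 * eta <= d2.
  by rewrite /eta mulrC divfK // !ge_min !lexx orbT.
clearbody eta.
have scale_le (x : R) v : `|v| <= 1 -> `|x *: v| <= `|x| by move=> hv; rewrite normrZ ler_piMr.
have graph (ab : R * R) : exists y, `|ab.1| < eta -> `|ab.2| < eta ->
    [/\ S y, `|y - p| < d2, (y - p) *d u1 = ab.1 & (y - p) *d u2 = ab.2].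
  case: ab => a b /=.
  have [[ha hb]|nab] := pselect (`|a| < eta /\ `|b| < eta); last by exists 0 => ha hb; case: nab.
  have ul : `|a *: u1 + b *: u2| <= `|a| + `|b|.
    by apply: le_trans (ler_normD _ _) _; apply: lerD; exact: scale_le.
  have [||h hh Sh] := gr (a *: u1 + b *: u2).
  - by rewrite dotDl !dotZl h1n h2n; ring.
  - by lra.
  exists (p + (a *: u1 + b *: u2) + h *: N p) => _ _.
  have -> : p + (a *: u1 + b *: u2) + h *: N p - p = a *: u1 + b *: u2 + h *: N p.
    by apply/rowP => i; rewrite !mxE; ring.
  split=> //.
  - apply: le_lt_trans (ler_normD _ _) _; have := scale_le h (N p) nn; lra.
  - by rewrite !dotDl !dotZl h11 (dotC u2) h12 (dotC (N p)) h1n; ring.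
  - by rewrite !dotDl !dotZl h22 h12 (dotC (N p)) h2n; ring.
have [g gP] := choice graph.
have close y z : S y -> S z -> `|y - p| < d2 -> `|z - p| < d2 ->
    `|y - z| <= 2 * (`|(y - z) *d u1| + `|(y - z) *d u2|).
  move=> Sy Sz yd zd; have := tn y z Sy Sz yd zd.
  have : `|y - z| <= `|(y - z) *d u1| + `|(y - z) *d u2| + `|(y - z) *d N p|.
    rewrite {1}(orthonormal_expand (y - z) fr); apply: le_trans (ler_normD _ _) _.
    by apply: lerD; [apply: le_trans (ler_normD _ _) _; apply: lerD|]; exact: scale_le.
  lra.
have diff y z u a b : (y - p) *d u = a -> (z - p) *d u = b -> (y - z) *d u = a - b.
  by move=> <- <-; rewrite !dotBl; ring.
have gL a b a' b' : `|a| < eta -> `|b| < eta -> `|a'| < eta -> `|b'| < eta ->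
    `|g (a', b') - g (a, b)| <= 2 * (`|a' - a| + `|b' - b|).
  move=> ha hb ha' hb'; have [S1 l1 x1 y1] := gP (a, b) ha hb; have [S2 l2 x2 y2] := gP (a', b') ha' hb'.
  by rewrite -(diff _ _ _ _ _ x2 x1) -(diff _ _ _ _ _ y2 y1); exact: close.
have t00 : `|0 : R| < eta by rewrite normr0.
have gp : g (0, 0) = p.
  have [S0 l0 x0 y0] := gP (0, 0) t00 t00; have pd : `|p - p| < d2 by rewrite subrr normr0.
  apply/eqP; rewrite -subr_eq0 -normr_le0; have := close _ _ S0 Sp l0 pd.
  by rewrite x0 y0 normr0 addr0 mulr0.
(* The same graph with its parameters exchanged, so that [graph_curvature] removes the dependence on
   each of them. *)
pose ga a b := g (a, b); pose gb b a := g (a, b).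
have S1 a b : `|a| < eta -> `|b| < eta -> S (ga a b) by move=> ha hb; have [] := gP (a, b) ha hb.
have S2 b a : `|b| < eta -> `|a| < eta -> S (gb b a) by move=> hb ha; have [] := gP (a, b) ha hb.
have L1 a a' b : `|a| < eta -> `|a'| < eta -> `|b| < eta -> `|ga a' b - ga a b| <= 2 * `|a' - a|.
  by move=> ha ha' hb; have := gL a b a' b ha hb ha' hb; rewrite subrr normr0 addr0.
have L2 a b b' : `|a| < eta -> `|b| < eta -> `|b'| < eta -> `|ga a b' - ga a b| <= 2 * `|b' - b|.
  by move=> ha hb hb'; have := gL a b a b' ha hb ha hb'; rewrite subrr normr0 add0r.
have kE a b : `|a| < eta -> `|b| < eta -> kp (g (a, b)) = kp p.
  move=> ha hb.
  rewrite (@graph_curvature kp ga p u2 eta umb S1 _ L1 L2 a b ha hb); last first.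
    by move=> a' b' ha' hb'; have [_ _ _ /=] := gP (a', b') ha' hb'; rewrite dotBl => /(canRL (subrK _)); rewrite addrC.
  rewrite -gp -[ga 0 b]/(gb b 0).
  rewrite (@graph_curvature kp gb p u1 eta umb S2 _ _ _ b 0 hb t00) //.
  - by move=> a' b' ha' hb'; have [_ _ /= + _] := gP (b', a') hb' ha'; rewrite dotBl => /(canRL (subrK _)); rewrite addrC.
  - by move=> a' b' c' h1 h2 h3; exact: L2.
  - by move=> a' b' c' h1 h2 h3; exact: L1.
have NE a b : `|a| < eta -> `|b| < eta -> N (g (a, b)) - kp p *: g (a, b) = N p - kp p *: p.
  move=> ha hb.
  have -> : N (g (a, b)) - kp p *: g (a, b) = N (g (0, b)) - kp p *: g (0, b).
    apply: (@vel0_cst R _ (fun t => N (ga t b) - kp p *: ga t b) eta) => // t ht.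
    by have := graph_vel1 umb S1 L1 ht hb; rewrite kE.
  have -> : N (g (0, b)) - kp p *: g (0, b) = N (g (0, 0)) - kp p *: g (0, 0).
    apply: (@vel0_cst R _ (fun t => N (ga 0 t) - kp p *: ga 0 t) eta) => // t ht.
    by have := graph_vel2 umb S1 L2 t00 ht; rewrite kE.
  by rewrite gp.
have eta3 : 0 < eta / 3 by rewrite divr_gt0.
exists (eta / 3) => //; apply: (modelP ns (or_introl erefl) eta3).
move=> q Sq qd; split; first by rewrite dot0l.
have cl u : `|u| <= 1 -> `|(q - p) *d u| < eta.
  move=> hu; apply: le_lt_trans (dot_le_norm _ _) _.
  have : 3 * `|q - p| * `|u| <= 3 * `|q - p| by rewrite ler_piMr // mulr_ge0.
  lra.
have [c1 c2] := (cl u1 n1, cl u2 n2).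
have [Sg lg xg yg] := gP ((q - p) *d u1, (q - p) *d u2) c1 c2.
have qE : q = g ((q - p) *d u1, (q - p) *d u2).
  apply/eqP; rewrite -subr_eq0 -normr_le0; have ql : `|q - p| < d2 by lra.
  have := close _ _ Sq Sg ql lg.
  by rewrite (diff _ _ _ _ _ erefl xg) (diff _ _ _ _ _ erefl yg) /= !subrr normr0 addr0 mulr0.
have := NE _ _ c1 c2; rewrite -qE => /eqP; rewrite subr_eq => /eqP ->.
rewrite (_ : perp 0 (q - p) = q - p); last by rewrite perp_id // dot0r.
by apply/rowP => i; rewrite !mxE; ring.
Qed.

Lemma limit_zero (W : normedModType R) (f : 'rV[R]_3 -> W) x :
  (forall eps, 0 < eps -> exists2 d, 0 < d & forall y, S y -> `|y - x| < d -> `|f y - f x| < eps) ->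
  (forall d, 0 < d -> exists2 y, S y /\ `|y - x| < d & f y = 0) -> f x = 0.
Proof.
move=> hf h0; apply/eqP; apply: contraPT isT => fx.
have fx0 : 0 < `|f x| by rewrite normr_gt0.
have [d d0 hd] := hf _ fx0; have [y [Sy yd] fy] := h0 d d0.
by have := hd y Sy yd; rewrite fy sub0r normrN ltxx.
Qed.

(** [N] and [A] are continuous on [S], so each clause passes to limits; this is the closed half of
    the connectedness argument. *)
Lemma model_closed p e k x : S x -> (forall d, 0 < d -> exists2 y, S y /\ `|y - x| < d & model p e k y) ->
  model p e k x.
Proof.
move=> Sx h.
have norm_pos v : 0 < 3 * `|v| + 1 by rewrite ltr_wpDl // mulr_ge0.
split=> [|u|].
- apply: (@limit_zero R^o (fun y => e *d N y)) => [eps eps0|d d0]; last first.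
    by have [y Sy [eN _ _]] := h d d0; exists y.
  have [d d0 hd] := normal_cont ns Sx (divr_gt0 eps0 (norm_pos e)).
  exists d => // y Sy yd; rewrite -dotBr; apply: le_lt_trans (dot_le_norm _ _) _.
  have := hd y Sy yd; rewrite ltr_pdivlMr // => hy.
  have := normr_ge0 (N y - N x); move: hy; move: (`|N y - N x|) (`|e|) => a b.
  by lra.
- apply/eqP; rewrite -subr_eq0; apply/eqP.
  apply: (@limit_zero _ (fun y => u *m A y - k *: (perp e u - (u *d N y) *: N y))) => [eps eps0|d d0]; last first.
    by have [y Sy [_ E _]] := h d d0; exists y => //; rewrite E subrr.
  have [U0 K0] := (normr_ge0 u, normr_ge0 k).
  have D0 : 0 < `|u| * (1 + 6 * `|k|) + 1 by rewrite ltr_wpDl // mulr_ge0 // addr_ge0 // mulr_ge0.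
  pose ep := eps / (`|u| * (1 + 6 * `|k|) + 1).
  have e0 : 0 < ep by rewrite divr_gt0.
  have eE : ep * (`|u| * (1 + 6 * `|k|) + 1) = eps by rewrite /ep divfK // gt_eqF.
  clearbody ep.
  have [d1 d10 hA] := shape_cont ns Sx e0; have [d2 d20 hN] := normal_cont ns Sx e0.
  exists (Num.min d1 d2); first by rewrite lt_min d10.
  move=> y Sy; rewrite lt_min => /andP[/(hA y Sy)/(_ u) + /(hN y Sy)].
  have [nx ny] : `|N x| <= 1 /\ `|N y| <= 1 by split; apply: unit_norm; exact: NN.
  have -> : u *m A y - k *: (perp e u - (u *d N y) *: N y) - (u *m A x - k *: (perp e u - (u *d N x) *: N x))
    = (u *m A y - u *m A x) + k *: ((u *d (N y - N x)) *: N y + (u *d N x) *: (N y - N x)).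
    rewrite dotBr; move: (perp e u) (u *d N x) (u *d N y) (u *m A x) (u *m A y) => a b c v w.
    by apply/rowP => i; rewrite !mxE; ring.
  move=> hA' hN'; apply: le_lt_trans (ler_normD _ _) _; rewrite normrZ.
  have := ler_normD ((u *d (N y - N x)) *: N y) ((u *d N x) *: (N y - N x)); rewrite !normrZ.
  have := dot_le_norm u (N y - N x); have := dot_le_norm u (N x).
  move: hA' hN' nx ny; rewrite -eE; have := normr_ge0 (u *d N x); have := normr_ge0 (u *d (N y - N x)).
  have := normr_ge0 (N y - N x); have := normr_ge0 (N x); have := normr_ge0 (N y).
  move: (`|_ + _|) (`|u *d N x|) (`|u *d (N y - N x)|) (`|N y - N x|) (`|N x|) (`|N y|) D0.
  clear -R U0 K0 e0.
  move=> X a b c nx ny D0 ny0 nx0 c0 b0 a0 hY hc nx1 ny1 ha hb hX.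
  have b1 : b * ny <= b * 1 by rewrite ler_wpM2l.
  have uc : `|u| * c <= `|u| * ep by rewrite ler_wpM2l // ltW.
  have a1 : `|u| * nx <= `|u| * 1 by rewrite ler_wpM2l.
  have a2 : a * c <= 3 * `|u| * c by rewrite ler_wpM2r //; lra.
  have X1 : X <= 6 * `|u| * ep by lra.
  have X2 : `|k| * X <= `|k| * (6 * `|u| * ep) by rewrite ler_wpM2l.
  by lra.
- apply/eqP; rewrite -subr_eq0; apply/eqP.
  apply: (@limit_zero _ (fun y => N y - N p - k *: perp e (y - p))) => [eps eps0|d d0]; last first.
    by have [y Sy [_ _ E]] := h d d0; exists y => //; rewrite E subrr.
  have [E0 K0] := (normr_ge0 e, normr_ge0 k).
  pose L := 1 + 3 * `|e| * `|e|; have L0 : 0 < L by rewrite ltr_pwDl // !mulr_ge0.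
  have D0 : 0 < `|k| * L + 1 by rewrite ltr_wpDl // mulr_ge0 // ltW.
  have e20 : 0 < eps / 2 by rewrite divr_gt0.
  have [d1 d10 hN] := normal_cont ns Sx e20.
  exists (Num.min d1 (eps / 2 / (`|k| * L + 1))); first by rewrite lt_min d10 !divr_gt0.
  move=> y Sy; rewrite lt_min ltr_pdivlMr // => /andP[/(hN y Sy) h1 h2].
  have -> : N y - N p - k *: perp e (y - p) - (N x - N p - k *: perp e (x - p)) =
     (N y - N x) - k *: perp e (y - x).
    by rewrite (perpB e y p) (perpB e x p) (perpB e y x); move: (perp e y) (perp e x) (perp e p) => a b c;
      apply/rowP => i; rewrite !mxE; ring.
  apply: le_lt_trans (ler_normB _ _) _; rewrite normrZ.
  have pe : `|perp e (y - x)| <= L * `|y - x|.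
    rewrite /perp /L; apply: le_trans (ler_normB _ _) _; rewrite normrZ.
    have : `|(y - x) *d e| * `|e| <= 3 * `|y - x| * `|e| * `|e| by rewrite ler_wpM2r // dot_le_norm.
    by lra.
  have : `|k| * `|perp e (y - x)| <= `|k| * (L * `|y - x|) by rewrite ler_wpM2l.
  by have := normr_ge0 (y - x); lra.
Qed.

(** Models with the same [e] and [k] but different base points fit together, because the affine
    formula is additive under a change of base point. *)
Lemma model_spread p e k : S p -> model p e k p ->
  (forall x, S x -> model p e k x -> exists2 d, 0 < d & forall y, S y -> `|y - x| < d -> model x e k y) ->
  forall q, S q -> model p e k q.
Proof.
move=> Sp mp loc; apply: (clopen_local (ns_connected ns) Sp mp) => x Sx mx.
  have [d d0 hd] := loc x Sx mx; exists d => // y Sy yd.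
  have [h1 h2 h3] := hd y Sy yd; have [_ _ h6] := mx; split=> //.
  rewrite -(subrKA (N x)) h3 h6 -scalerDr; congr (_ *: _).
  by rewrite -perpD subrKA.
apply: contrapT => h; apply: mx; apply: model_closed => // d d0; apply: contrapT => h'.
by apply: h; exists d => // y Sy yd my; apply: h'; exists y.
Qed.

(** One point with distinct curvatures forces a cylinder everywhere; otherwise all points are
    umbilics and [e = 0]. The value [k = 0], the plane, can occur only in the second case. *)
Lemma nsurf_classify : S !=set0 -> exists p e k,
  [/\ S p, axis e, 0 <= k, r * k < 1 & e = 0 \/ 0 < k] /\
  forall q, S q -> e *d N q = 0 /\ N q - N p = k *: perp e (q - p).
Proof.
case=> p0 Sp0.
suff [p [e [k [h1 h2]]]] : exists p e k, [/\ S p, axis e, 0 <= k, r * k < 1 & e = 0 \/ 0 < k] /\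
    forall q, S q -> model p e k q.
  by exists p, e, k; split=> // q Sq; have [] := h2 q Sq.
have [[p [e1 [e2 [k1 [k2 [Sp [fr h1 h2] k12]]]]]]|umb] := pselect (exists p e1 e2 k1 k2,
  [/\ S p, [/\ orthonormal e1 e2 (N p), e1 *m A p = k1 *: e1 & e2 *m A p = k2 *: e2] & k1 != k2]).
  have [e1' [e [k [fr' kk h k0]]]] : exists e1 e k,
      [/\ orthonormal e1 e (N p), e1 *m A p = k *: e1, e *m A p = 0 & 0 < k].
    have [e11 e22 _ [_ e1n e2n]] := fr.
    have ge e k : e *d e = 1 -> e *d N p = 0 -> e *m A p = k *: e -> 0 <= k.
      by move=> ee en ek; have := ns_ge0 ns Sp en; rewrite ek dotZl ee mulr1.
    have k1' := ge _ _ e11 e1n h1; have k2' := ge _ _ e22 e2n h2.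
    have := flat r_gt0 ns Sp fr h1 h2 k12 => /eqP; rewrite mulf_eq0 => /orP[] /eqP E.
      exists e2, e1, k2; split=> //; first exact: orthonormal_swap.
        by rewrite h1 E scale0r.
      by rewrite lt_neqAle k2' -E k12.
    exists e1, e2, k1; split=> //; first by rewrite h2 E scale0r.
    by rewrite lt_neqAle k1' -E eq_sym k12.
  have [f11 ee nn [f1e f1n en]] := fr'.
  exists p, e, k; split.
    split=> //; [by right | exact: ltW | | by right].
    by have := ns_lt ns Sp f1n f11; rewrite kk dotZl f11 mulr1.
  have mx x : S x -> e *d N x = 0 -> (forall u, u *m A x = k *: (perp e u - (u *d N x) *: N x)) ->
      exists2 d, 0 < d & forall y, S y -> `|y - x| < d -> model x e k y.
    move=> Sx eN mA.
    have o1 := orthonormal_rot (orthonormal_rot (cross_orthonormal ee (NN Sx) eN)).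
    have [g11 _ _ [g1e g1n _]] := o1; apply: (cylinder_local r_gt0 ns Sx o1) => //.
      by rewrite mA g1n scale0r subr0 perp_id.
    by rewrite mA eN scale0r subr0 perp_axis ?scaler0 //; right.
  apply: model_spread => //; last by move=> x Sx [x1 x2 _]; exact: mx.
  have [d d0 hd] := cylinder_local r_gt0 ns Sp fr' kk h k0.
  by apply: hd; rewrite ?subrr ?normr0.
have umb' x : exists k, S x -> forall u, u *m A x = k *: (u - (u *d N x) *: N x).
  have [Sx|nSx] := pselect (S x); last by exists 0.
  have [e1 [e2 [k1 [k2 [fr h1 h2]]]]] := spectral_plane (NN Sx) (As Sx) (ns_null ns Sx).
  have k12 : k1 = k2.
    apply/eqP; apply: contraPT isT => k12; case: umb; exists x, e1, e2, k1, k2; split=> //.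
  exists k1 => _ u; rewrite {1 2}(orthonormal_expand u fr) !mulmxDl -!scalemxAl (ns_null ns Sx) h1 h2 -k12.
  rewrite scaler0 addr0 addrK scalerDr !scalerA !(mulrC k1); exact: erefl.
have [kp hk] := choice umb'.
have [u1 [u2 fr]] := exists_perp (NN Sp0); have [h11 _ _ [_ h1n _]] := fr.
have kE : u1 *m A p0 = kp p0 *: u1 by rewrite hk // h1n scale0r subr0.
exists p0, 0, (kp p0); split.
  split=> //; [by left | | | by left].
    by have := ns_ge0 ns Sp0 h1n; rewrite kE dotZl h11 mulr1.
  by have := ns_lt ns Sp0 h1n h11; rewrite kE dotZl h11 mulr1.
apply: model_spread => //.
  have [d d0 hd] := umbilic_local hk Sp0.
  by apply: hd; rewrite ?subrr ?normr0.
move=> x Sx [_ mA _]; suff -> : kp p0 = kp x by exact: umbilic_local hk Sx.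
have [v1 [v2 [v11 _ _ [_ v1n _]]]] := exists_perp (NN Sx).
have := mA v1; rewrite hk // v1n scale0r !subr0 perp_id ?dot0r // => /(congr1 (fun v => v *d v1)).
by rewrite !dotZl v11 !mulr1 => ->.
Qed.

End Classification.

(** * Rotations and cylinders *)

Section Rotations.
Variable R : realType.
Implicit Types (u v w n e x y : 'rV[R]_3) (Q : 'M[R]_3).

Definition reflection n : 'M[R]_3 := 1%:M - 2 *: (n^T *m n).

Lemma mulmx_reflection u n : u *m reflection n = u - (2 * (u *d n)) *: n.
Proof.
have h : u *m n^T = (u *d n)%:M.
  by apply/matrixP => i j; rewrite !ord1 !mxE /=; apply: eq_bigr => k _; rewrite mxE.
by rewrite mulmxBr mulmx1 -scalemxAr mulmxA h mul_scalar_mx scalerA.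
Qed.

Lemma reflection_orth n : n *d n = 1 -> reflection n *m (reflection n)^T = 1%:M.
Proof.
move=> nn; have -> : (reflection n)^T = reflection n.
  by rewrite /reflection linearB /= linearZ /= trmx_mul trmxK trmx1.
apply/row_matrixP => i; rewrite !rowE mulmxA !mulmx_reflection mulmx1 dotBl dotZl nn.
by move: (delta_mx _ _) => u; apply/rowP => j; rewrite !mxE; ring.
Qed.

Lemma det_reflection n : \det (reflection n) = 1 - 2 * (n *d n).
Proof.
rewrite (expand_det_row _ 0) !big_ord_recl big_ord0 /cofactor.
rewrite !(expand_det_row _ ord0) !big_ord_recl !big_ord0 /cofactor !det_mx11 !mxE /=.
rewrite !big_ord1 !mxE /= dotE.
(* Coordinates are named by natural numbers so that [ring] identifies different expressions of the
   same index. *)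
have [a E] : exists a : nat -> R, forall i : 'I_3, n 0 i = a i.
  by exists (fun k => n 0 (inord k)) => i; rewrite inord_val.
by rewrite !E /= /bump /=; ring.
Qed.

Lemma dot_orth Q u w : Q *m Q^T = 1%:M -> (u *m Q) *d (w *m Q) = u *d w.
Proof. by move=> h; rewrite dot_mulmxl -mulmxA h mulmx1. Qed.

(** A product of two reflections: the first, along [n1] orthogonal to [e] and [x], fixes both; the
    second, along [x - y], fixes [e] and sends [x] to [y]. *)
Lemma rotation_ex e x y : axis e -> x *d e = 0 -> y *d e = 0 -> x *d x = y *d y -> exists Q,
  [/\ Q *m Q^T = 1%:M, \det Q = 1, e *m Q = e & x *m Q = y].
Proof.
move=> he xe ye xy; have [->|nxy] := eqVneq x y.
  by exists 1%:M; rewrite trmx1 !mulmx1 det1.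
have x0 : x != 0.
  apply: contra_neq nxy => x0; rewrite x0; apply/esym/dot_eq0.
  by rewrite -xy x0 dot0l.
have [|n1 [n11 n1e n1x]] := exists_unit_perp (u := normalize x) he _ (normalize_unit x0).
  by rewrite dotZl xe mulr0.
have {}n1x : n1 *d x = 0 by rewrite -(normalizeK x0) dotZr n1x mulr0.
have d0 : x - y != 0 by rewrite subr_eq0.
pose n2 := normalize (x - y); have n22 : n2 *d n2 = 1 := normalize_unit d0.
have n2e : n2 *d e = 0 by rewrite dotZl dotBl xe ye subrr mulr0.
have D0 := enorm_gt0 d0.
have n2x : (2 * (x *d n2)) *: n2 = x - y.
  have E : 2 * (x *d (x - y)) = enorm (x - y) ^+ 2.
    rewrite enorm2 !dotBl !dotBr (dotC y x) -xy; ring.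
  rewrite /n2 /normalize dotZr mulrCA scalerA E; set a := enorm _ in D0 *.
  by rewrite (_ : _ * _ = 1) ?scale1r //; field; rewrite gt_eqF.
exists (reflection n1 *m reflection n2); split.
- rewrite trmx_mul mulmxA -(mulmxA (reflection n1)) reflection_orth // mulmx1.
  exact: reflection_orth.
- by rewrite det_mulmx !det_reflection n11 n22; ring.
- by rewrite mulmxA (mulmx_reflection e n1) (dotC e) n1e mulr0 scale0r subr0 mulmx_reflection (dotC e) n2e mulr0 scale0r subr0.
- by rewrite mulmxA (mulmx_reflection x n1) (dotC x) n1x mulr0 scale0r subr0 mulmx_reflection n2x opprB addrC subrK.
Qed.

End Rotations.

(** * Tubes as spheres and round cylinders *)

Section Tubes.
Variable R : realType.
Implicit Types (C K : set 'rV[R]_3) (a b p q u v w e x y z : 'rV[R]_3) (rho s t : R).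

Lemma line_through a u p : line a u p -> line a u = line p u.
Proof.
move=> [t _ <-]; apply/seteqP; split=> _ [s _ <-].
  by exists (s - t) => //; rewrite -addrA -scalerDl subrKC.
by exists (t + s) => //; rewrite scalerDl addrA.
Qed.

Lemma line_dir a u b v : line a u = line b v -> exists c, u = c *: v.
Proof.
move=> E; have [t _ ht] : line b v a by rewrite -E; exists 0 => //; rewrite scale0r addr0.
have [s _ hs] : line b v (a + u) by rewrite -E; exists 1 => //; rewrite scale1r.
by exists (s - t); rewrite scalerBl -(addrK a u) (addrC u) -hs -ht; apply/rowP => i; rewrite !mxE; ring.
Qed.

Lemma line_scale a u c : c != 0 -> line a (c *: u) = line a u.
Proof.
move=> c0; apply/seteqP; split=> _ [t _ <-].
  by exists (t * c) => //; rewrite scalerA.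
by exists (t / c) => //; rewrite scalerA divfK.
Qed.

(** The squared distance to the axis is quadratic along the line; it is constant, so its leading
    coefficient vanishes, as the values at 0, 1 and -1 show. *)
Lemma tube_line a e rho b u : e *d e = 1 -> 0 < rho -> u != 0 -> line b u `<=` tube a e rho ->
  line b u = line b e.
Proof.
move=> ee rho0 u0 sub; have r0 := ltW rho0.
have pt t : perp e (b - a + t *: u) *d perp e (b - a + t *: u) = rho ^+ 2.
  by have /sub /(tubeP _ _ _ r0) : line b u (b + t *: u) by [exists t]; rewrite addrAC.
have P0 : perp e u = 0.
  apply: dot_eq0; have := pt 0; have := pt 1; have := pt (-1).
  rewrite !(perpD e (b - a)) !perpZ; move: (perp e (b - a)) (perp e u) => X U.
  rewrite !dotE !mxE; lra.
have uE : u = (u *d e) *: e by move: P0 => /eqP; rewrite subr_eq0 => /eqP.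
rewrite uE; apply: line_scale; apply: contra_neq u0 => h.
by rewrite uE h scale0r.
Qed.

Lemma tube_shift a e rho x t : axis e -> tube a e rho x -> tube a e rho (x + t *: e).
Proof.
by move=> he; rewrite /tube /= addrAC (perpD e (x - a)) perpZ perp_axis // scaler0 addr0.
Qed.

Lemma tube_round_cylinder a e rho : e *d e = 1 -> 0 < rho -> round_cylinder (tube a e rho).
Proof.
move=> ee rho0; have he : axis e by right.
have e0 : e != 0 by apply: contra_eq_neq ee => ->; rewrite dot0l eq_sym oner_neq0.
split; [split|].
- move=> p Tp; exists (line p e); split.
    split; first by exists p, e.
      by exists 0 => //; rewrite scale0r addr0.
    by move=> _ [t _ <-]; exact: tube_shift.
  move=> _ [[b [u [u0 ->]]] bp sub].
  by rewrite (tube_line ee rho0 u0 sub); rewrite (tube_line ee rho0 u0 sub) in bp; rewrite (line_through bp).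
- move=> _ _ [b [u [u0 ->]]] [b' [u' [u'0 ->]]] h h'; exists b, b', e; split=> //.
    exact: tube_line h.
  exact: tube_line h'.
- exists a, e; split=> // Q QQ _ eQ x; rewrite /tube /= addrAC subrr add0r => <-.
  have -> : perp e ((x - a) *m Q) = perp e (x - a) *m Q.
    by move: (x - a) => v; rewrite /perp mulmxBl -scalemxAl eQ (_ : _ *d e = v *d e) // -{1}eQ dot_orth.
  by rewrite /enorm dot_orth.
Qed.

Lemma tube_sphere a rho : 0 < rho -> sphere (tube a 0 rho).
Proof.
move=> rho0; exists a, rho; split=> //; apply/seteqP; split=> x; rewrite /tube /= perp_id ?dot0r //.
Qed.

Lemma sphere_tube K : sphere K -> exists a rho, 0 < rho /\ K = tube a 0 rho.
Proof.
move=> [a [rho [rho0 ->]]]; exists a, rho; split=> //.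
by apply/seteqP; split=> x; rewrite /tube /= perp_id ?dot0r.
Qed.

(* A quarter turn about the symmetry axis sends the rulings to rulings, so they are parallel to the axis. *)
Lemma round_cylinder_tube C : convex_body C -> boundary C !=set0 -> round_cylinder (boundary C) ->
  exists a e rho, [/\ e *d e = 1, 0 < rho & boundary C = tube a e rho].
Proof.
move=> bC [p0 bp0] [[rul par] [a [u [u0 rot]]]].
have [cC vC [m im]] := bC.
pose e := normalize u; have ee : e *d e = 1 := normalize_unit u0; have he : axis e by right.
have uE : enorm u *: e = u := normalizeK u0.
clearbody e.
have rot' x y : boundary C (a + x) -> x *d e = y *d e -> perp e x *d perp e x = perp e y *d perp e y ->
    boundary C (a + y).
  move=> Kx xye xy; have [Q [QQ dQ eQ xQ]] := rotation_ex he (perp_dot x he) (perp_dot y he) xy.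
  have uQ : u *m Q = u by rewrite -uE -scalemxAl eQ.
  have := rot Q QQ dQ uQ _ Kx; rewrite (addrC a x) addrK (_ : x *m Q = y) //.
  have E v : v = perp e v + (v *d e) *: e by rewrite /perp subrK.
  by rewrite (E x) mulmxDl xQ -scalemxAl eQ xye -E.
have shift p t : boundary C p -> boundary C (p + t *: e).
  move=> bp; have [_ [[[b [w [w0 ->]]] bwp sub] _]] := rul p bp.
  rewrite (line_through bwp) in sub => {bwp}.
  have [we|we] := eqVneq (perp e w) 0.
    have wE : w = (w *d e) *: e by move: we => /eqP; rewrite subr_eq0 => /eqP.
    have c0 : w *d e != 0 by apply: contra_neq w0 => h; rewrite wE h scale0r.
    by apply: sub; rewrite wE line_scale //; exists t.
  exfalso; have P1 := normalize_unit we.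
  have Pe : normalize (perp e w) *d e = 0 by rewrite dotZl perp_dot // mulr0.
  have [v [vv ve vw]] := exists_unit_perp he Pe P1.
  have vw' : perp e w *d v = 0 by rewrite -(normalizeK we) dotZl dotC vw mulr0.
  (* [w] after a quarter turn about the axis: same component along [e], with [perp e w] turned to
     the direction [v]. *)
  pose w' := (w *d e) *: e + enorm (perp e w) *: v.
  have ve' : (enorm (perp e w) *: v) *d e = 0 by rewrite dotZl ve mulr0.
  have pv : perp e (enorm (perp e w) *: v) = enorm (perp e w) *: v by rewrite perp_id.
  have [Q [QQ dQ eQ xQ]] : exists Q, [/\ Q *m Q^T = 1%:M, \det Q = 1, e *m Q = e &
      perp e w *m Q = enorm (perp e w) *: v].
    by apply: rotation_ex => //; rewrite ?perp_dot // dotZl dotZr vv mulr1 -expr2 enorm2.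
  have uQ : u *m Q = u by rewrite -uE -scalemxAl eQ.
  have wQ : w *m Q = w'.
    have {1}-> : w = perp e w + (w *d e) *: e by rewrite /perp subrK.
    by rewrite mulmxDl xQ -scalemxAl eQ addrC.
  have w'0 : w' != 0.
    apply: contra_neq (we) => h; rewrite -(normalizeK we); suff -> : enorm (perp e w) = 0 by rewrite scale0r.
    have := congr1 (fun z => z *d v) h; rewrite /= dot0l dotDl !dotZl vv (dotC e) ve; lra.
  have [||||b1 [b2 [d [d0 E1 E2]]]] := par (line p w) (line (a + (p - a) *m Q) w').
  - by exists p, w.
  - by exists (a + (p - a) *m Q), w'.
  - exact: sub.
  - move=> _ [s _ <-]; have /(rot Q QQ dQ uQ) : boundary C (p + s *: w) by apply: sub; exists s.
    by rewrite addrAC mulmxDl -scalemxAl wQ addrA.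
  have [c1 wE] := line_dir E1; have [c2 w'E] := line_dir E2.
  have Z : c1 * (d *d perp e w) = enorm (perp e w) ^+ 2.
    by rewrite enorm2 -dotZl -wE dotC dot_perp ?perp_dot // dotC.
  have Z2 : c2 * (d *d perp e w) = 0.
    rewrite -dotZl -w'E dotDl !dotZl (dotC v) vw' (dotC e) perp_dot // !mulr0; exact: addr0.
  have c20 : c2 != 0 by apply: contra_neq w'0 => h; rewrite w'E h scale0r.
  move: Z2 => /eqP; rewrite mulf_eq0 (negbTE c20) /= => /eqP h.
  move: Z; rewrite h mulr0 => /eqP; rewrite eq_sym sqrf_eq0 => /eqP /enorm0_eq0 w00.
  by rewrite w00 eqxx in we.
(* A point at the same distance from the axis as [p] is reached by a rotation followed by a
   translation along [e]. *)
have tube_in p : boundary C p -> tube a e (enorm (perp e (p - a))) `<=` boundary C.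
  move=> bp y; rewrite /tube /= => hy.
  pose z := perp e (y - a) + ((p - a) *d e) *: e.
  have bz : boundary C (a + z).
    apply: (rot' (p - a)); first by rewrite addrC subrK.
      by rewrite /z [RHS]dotDl perp_dot // dotZl ee mulr1 add0r.
    by rewrite /z (perpD e (perp e _)) perpZ perp_axis // scaler0 addr0 perp_perp // -!enorm2 hy.
  have := shift _ (((y - a) *d e) - ((p - a) *d e)) bz.
  rewrite -addrA /z -addrA -scalerDl addrC [in X in X *: _]addrC subrK /perp subrK subrK.
  by [].
have [[p bp rp]|none] := pselect (exists2 p, boundary C p & 0 < enorm (perp e (p - a))).
  exists a, e, (enorm (perp e (p - a))); split=> //.
  by apply: tube_sub_boundary => //; exact: tube_in.
(* The boundary would lie on the axis, while the body has points off it; the body would then be the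
   whole space. *)
exfalso; have sub0 : boundary C `<=` tube a e 0.
  move=> p bp; apply/eqP; rewrite eq_le enorm_ge0 andbT leNgt; apply/negP => h.
  by apply: none; exists p.
have [v [vv ve]] : exists v, v *d v = 1 /\ v *d e = 0 by have [v] := exists_unit he; exists v.
have [s /andP[s0 _] [h1 h2]] := ball_scale v im.
have v0 : v != 0 by apply: contra_eq_neq vv => ->; rewrite dot0l eq_sym oner_neq0.
have [y Cy py] : exists2 y, C y & perp e (y - a) != 0.
  have [h|h] := eqVneq (perp e (m - a)) 0; last by exists m => //; exact: interior_subset.
  exists (m + s *: v) => //; rewrite addrAC perpD h add0r perpZ perp_id //.
  by rewrite scaler_eq0 negb_or v0 andbT gt_eqF.
have full := boundary_sub_tube_full cC vC he (lexx 0) sub0 Cy (enorm_gt0 py).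
by move: bp0; rewrite full_boundary.
Qed.

End Tubes.

(** * Parallel tubes *)

Lemma Ck1_scale (R : realType) (I : set R) (f : R -> R) (k : R) : open I ->
  Ck 1 (I : set R^o) (f : R^o -> R^o) -> Ck 1 (I : set R^o) ((fun t => k * f t) : R^o -> R^o).
Proof.
move=> oI [_ [df cf]].
have vf t : I t -> vel (f : R -> R^o) t (derive1 f t).
  by move=> It; apply: derivable_vel; exact: df.
have vkf t : I t -> vel (fun t => k * f t : R^o) t (k * derive1 f t).
  by move=> /vf /(velZ k).
have DE t v : I t -> 'D_v ((fun t => k * f t) : R^o -> R^o) t = k * 'D_v (f : R^o -> R^o) t.
  move=> It; have [_ ->] := vel_is_deriveZ v (vkf t It); have [_ ->] := vel_is_deriveZ v (vf t It).
  by rewrite [_ *: _]mulrCA.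
split; first by move=> t It; exact: vel_continuous (vkf t It).
split; first by move=> t v It; have [] := vel_is_deriveZ v (vkf t It).
move=> v; split=> // t It; have [/(_ t It) /continuous_eps h _] := cf v.
apply/continuous_eps => eps eps0; have k1 : 0 < `|k| + 1 by rewrite ltr_wpDl.
have [d d0 hd] := h _ (divr_gt0 eps0 k1).
have [d' d'0 hd'] : exists2 d', 0 < d' & forall s, `|s - t| < d' -> I s.
  by apply/(nbhs_eps (t : R^o)); exact: open_nbhs_nbhs.
exists (Num.min d d'); first by rewrite lt_min d0.
move=> s; rewrite lt_min => /andP[/hd + /hd' Is]; rewrite ltr_pdivlMr // => sd.
rewrite !DE // -mulrBr normrM; apply: le_lt_trans sd.
by rewrite mulrC ler_wpM2l // lerDl.
Qed.

Section Corollary.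
Variables (R : realType) (r : R) (C0 K0 Kr Cr : set 'rV[R]_3).
Hypotheses (r_gt0 : 0 < r) (Kr_C2 : C2_surface Kr)
  (K0_connected : connected K0) (Kr_connected : connected Kr)
  (K0_convex : bounds_convex_body K0 C0) (Kr_convex : bounds_convex_body Kr Cr)
  (Kr_outside : Kr `&` C0 = set0) (dist : regular_constant_distance Kr K0 r).
Implicit Types (a e p q u v w x y z n : 'rV[R]_3) (s t d eps rho k : R).

Local Notation Pi := (projection K0).
Local Notation N := (nor r K0).

Let Kr_n0 : Kr !=set0. Proof. by case: Kr_C2. Qed.
Let NN x : Kr x -> N x *d N x = 1. Proof. exact: (nor_unit r_gt0 dist). Qed.
Let PiE x : Pi x = x - r *: N x. Proof. exact: projE. Qed.
Let Pi_in x : Kr x -> K0 (Pi x). Proof. by move=> /(projP dist)[]. Qed.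

Lemma nor_obtuse x z : Kr x -> C0 z -> N x *d (z - Pi x) <= 0.
Proof.
move=> Kx Cz; have := proj_obtuse r_gt0 K0_convex Kr_outside dist Kx Cz.
have {1}-> : x - Pi x = r *: N x by rewrite PiE opprB addrC subrK.
by rewrite dotZl pmulr_rle0.
Qed.

(** The obtuse angle inequality, read both ways for two points, puts [Kr] in a plane. Moved by
    [- r n], this plane lies in [K0], and the same inequality keeps the body on one side of it. *)
Lemma flat_case p : Kr p -> (forall q, Kr q -> N q = N p) -> plane K0.
Proof.
move=> Kp Ncst; have nn := NN Kp; set n := N p in Ncst nn.
have PiE' q : Kr q -> Pi q = q - r *: n by move=> Kq; rewrite PiE Ncst.
have C0K q : Kr q -> C0 (Pi q) by move=> /Pi_in; exact: (K0_sub K0_convex).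
have le q q' : Kr q -> Kr q' -> n *d (q' - q) <= 0.
  move=> Kq Kq'; have := nor_obtuse Kq (C0K q' Kq'); rewrite Ncst // !PiE' //.
  by rewrite (_ : q' - _ - _ = q' - q) //; apply/rowP => i; rewrite !mxE; ring.
have eq q : Kr q -> (q - p) *d n = 0.
  move=> Kq; apply/eqP; rewrite eq_le dotC le //= -[q - p]opprB dotC dotNl oppr_ge0 dotC; exact: le.
have [bCr KrE] := Kr_convex.
have Kr_plane : Kr = [set z | (z - p) *d n = 0].
  rewrite KrE; apply: boundary_sub_plane => //; first by rewrite -KrE.
  by move=> z; rewrite -KrE; exact: eq.
have [bC0 K0E] := K0_convex.
exists (Pi p), n; split; first by apply: contra_eq_neq nn => ->; rewrite dot0l eq_sym oner_neq0.
have -> : [set x | n *d (x - Pi p) = 0] = [set x | (x - Pi p) *d n = 0].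
  by apply/seteqP; split=> x /=; rewrite dotC.
rewrite {1}K0E; apply: plane_sub_boundary => //; first by rewrite -K0E.
- by move=> y Cy; rewrite dotC; exact: nor_obtuse.
- move=> z /= hz; rewrite -K0E.
  have Kz : Kr (z + r *: n).
    rewrite Kr_plane /=; move: hz; rewrite PiE' // => <-; congr (_ *d _).
    by apply/rowP => i; rewrite !mxE; ring.
  by have := Pi_in Kz; rewrite PiE' // addrK.
Qed.

(** [a] is the point at depth [1 / k] under [p], the centre or a point of the axis. Each point [z]
    of the inner tube, of positive radius as [r k < 1], is the projection of [z + r n], which lies
    on [Kr]. *)
Lemma curved_case p e k : axis e -> 0 < k -> r * k < 1 -> Kr p ->
  (forall q, Kr q -> e *d N q = 0 /\ N q - N p = k *: perp e (q - p)) ->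
  exists a, Kr = tube a e k^-1 /\ K0 = tube a e (k^-1 - r).
Proof.
move=> he k0 rk Kp h; have ki0 : 0 < k^-1 by rewrite invr_gt0.
pose a := p - k^-1 *: N p; exists a.
have Na q : Kr q -> perp e (q - a) = k^-1 *: N q.
  move=> Kq; have [eN Nq] := h q Kq; have [eNp _] := h p Kp.
  have -> : q - a = (q - p) + k^-1 *: N p by rewrite /a opprB addrA addrAC.
  rewrite (perpD e (q - p)) perpZ (perp_id (v := N p)); last by rewrite dotC.
  have -> : perp e (q - p) = k^-1 *: (N q - N p) by rewrite Nq scalerA mulVf ?scale1r // gt_eqF.
  by rewrite -scalerDr subrK.
have [bCr KrE] := Kr_convex; have [bC0 K0E] := K0_convex.
have KrT : Kr = tube a e k^-1.
  rewrite KrE; apply: boundary_sub_tube => //; first by rewrite -KrE.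
  move=> q; rewrite -KrE => Kq; apply/(tubeP _ _ _ (ltW ki0)).
  by rewrite Na // dotZl dotZr NN // mulr1 expr2.
split=> //.
have rho0 : 0 < k^-1 - r by rewrite subr_gt0 -[k^-1]mul1r ltr_pdivlMr.
rewrite K0E; apply: tube_sub_boundary => // z Tz; rewrite -K0E.
have E : k^-1 - r + r = k^-1 by rewrite subrK.
move: (k^-1 - r) rho0 Tz E => rho rho0 Tz E.
pose n := rho^-1 *: perp e (z - a).
have pn : perp e n = n by rewrite perpZ perp_perp.
have x_perp : perp e (z + r *: n - a) = k^-1 *: n.
  rewrite addrAC (perpD e (z - a)) perpZ pn -E scalerDl; congr (_ + _).
  by rewrite /n scalerA divff ?scale1r // gt_eqF.
have Tz' : perp e (z - a) *d perp e (z - a) = rho ^+ 2 by apply/(tubeP _ _ _ (ltW rho0)).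
have nn : n *d n = 1 by rewrite /n dotZl dotZr Tz'; field; rewrite gt_eqF.
have Kx : Kr (z + r *: n).
  by rewrite KrT; apply/(tubeP _ _ _ (ltW ki0)); rewrite x_perp dotZl dotZr nn mulr1 expr2.
have := Pi_in Kx; rewrite PiE (_ : N _ = n) ?addrK //.
by apply: (scalerI (lt0r_neq0 ki0)); rewrite -Na.
Qed.

Lemma preserving_shape : preserves_geodesics Kr K0 Pi -> ~ plane K0 ->
  (sphere K0 /\ sphere Kr) \/ (round_cylinder K0 /\ round_cylinder Kr).
Proof.
move=> pres npl.
have shape x : exists A : 'M[R]_3, Kr x -> [/\ A^T = A, N x *m A = 0,
    small_o Kr x (fun y z => N y - N z - (y - z) *m A) & small_o Kr x (fun y z => (y - z) *d N x : R^o)].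
  have [Kx|nK] := pselect (Kr x); last by exists 0.
  by have [A hA] := shape_ex r_gt0 Kr_C2 K0_convex Kr_outside dist Kx; exists A.
have [A hA] := choice shape.
have ns := preserved_nsurf r_gt0 Kr_C2 K0_convex Kr_outside dist hA pres Kr_connected.
have [p [e [k [[Kp he k0 rk ek] h]]]] := nsurf_classify r_gt0 ns Kr_n0.
have [kz|kz] := eqVneq k 0.
  by case: npl; apply: (flat_case Kp) => q /h[_]; rewrite kz scale0r => /eqP; rewrite subr_eq0 => /eqP.
have kp : 0 < k by rewrite lt_neqAle eq_sym kz.
have [a [-> ->]] := curved_case he kp rk Kp h.
have ki0 : 0 < k^-1 by rewrite invr_gt0.
have rho0 : 0 < k^-1 - r by rewrite subr_gt0 -[k^-1]mul1r ltr_pdivlMr.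
case: he => he; first by left; rewrite he; split; exact: tube_sphere.
by right; split; exact: tube_round_cylinder.
Qed.

(** * Projection onto a sphere or a round cylinder *)

Section Tubular.
Variables (a e : 'rV[R]_3) (rho : R).
Hypotheses (he : axis e) (rho0 : 0 < rho) (K0T : K0 = tube a e rho).

Let C0_sub x : tube a e rho x -> C0 x.
Proof. by rewrite -K0T; exact: (K0_sub K0_convex). Qed.

(** [N x] makes an obtuse angle with every chord of the tube from [Pi x]. The chords along [e] and
    [- e] give orthogonality to [e]; the chord to the point in direction [n] gives [rho <= n *d Y],
    the equality case of Cauchy-Schwarz since [Y] has length [rho]. *)
Lemma tubular_nor x : Kr x -> N x *d e = 0 /\ perp e (x - a) = (rho + r) *: N x.
Proof.
move=> Kx; have := Pi_in Kx; rewrite {1}K0T => Ty; have nn := NN Kx; have r0 := ltW rho0.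
set n := N x in nn *; set y := Pi x in Ty.
have obt z : tube a e rho z -> n *d (z - y) <= 0 by move=> /C0_sub; exact: nor_obtuse.
have ne : n *d e = 0.
  have := obt _ (tube_shift 1 he Ty); have := obt _ (tube_shift (-1) he Ty).
  by rewrite !(addrC y) !addrK !dotZr; lra.
split=> //.
have pn : perp e n = n by exact: perp_id.
pose Y := perp e (y - a).
have YY : Y *d Y = rho ^+ 2 by apply/(tubeP _ _ _ r0).
have pY : perp e Y = Y by exact: perp_perp.
have YE : Y = rho *: n.
  have T : tube a e rho (y + (rho *: n - Y)).
    apply/(tubeP _ _ _ r0); rewrite addrAC (perpD e (y - a)) -/Y perpB perpZ pn pY addrC subrK.
    by rewrite dotZl dotZr nn mulr1 expr2.
  have := obt _ T; rewrite (addrC y) addrK dotBr dotZr nn => h.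
  apply/eqP; rewrite -subr_eq0; apply/eqP/dot_eq0/eqP; rewrite eq_le dot_ge0 andbT.
  have E z m : (z - rho *: m) *d (z - rho *: m) = z *d z - 2 * (rho * (m *d z)) + rho ^+ 2 * (m *d m).
    by rewrite !dotE !mxE; ring.
  by rewrite E YY nn; have := ler_wpM2l r0 h; lra.
have -> : x - a = (y - a) + r *: n by rewrite /y PiE -/n; apply/rowP => i; rewrite !mxE; ring.
by rewrite (perpD e (y - a)) -/Y perpZ pn YE -scalerDl.
Qed.

Lemma tangent_of_normal x v : Kr x -> v *d v = 1 -> v *d N x = 0 -> tangent Kr x v.
Proof.
move=> Kx vv vN; have [d [tau [M [d0 tau0 _ hg]]]] := normal_geodesic r_gt0 Kr_C2 K0_convex Kr_outside dist Kx.
have [|c [w [acc [c0 w0 _ _ h]]]] := hg x v _ Kx vv vN; first by rewrite subrr normr0.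
exists c; split=> //.
  by apply/(nbhs_eps (0 : R^o)); exists tau => // t; rewrite subr0 => /h[].
by apply: vel_is_derive; rewrite -w0; have [|_ ? _ _ _] := h 0; rewrite ?normr0.
Qed.

Lemma tangent_tube y v : tangent K0 y v -> v *d perp e (y - a) = 0.
Proof.
move=> [c [c0 hc /is_derive_vel hv]].
have /nbhs_eps[d d0 hd] := hc.
have vp : vel (fun s => perp e (c s - a)) 0 (perp e v).
  by have := vel_perp e (velB hv (vel_cst a 0)); rewrite subr0.
have vq := vel_dot vp vp.
have : perp e v *d perp e (y - a) + perp e (y - a) *d perp e v = 0.
  rewrite -c0; apply: (vel_unique vq); apply: (vel_near d0 _ (vel_cst (rho ^+ 2 : R^o) 0)) => s /hd.
  by rewrite K0T => /(tubeP _ _ _ (ltW rho0)) ->.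
rewrite (dotC (perp e v)) dot_perp ?perp_dot // (dotC _ v); lra.
Qed.

(** [1 - ka = rho / (rho + r)] is the ratio of the radii, and [L] is the linear part of the affine
    map that the projection restricts. *)
Let ka : R := r / (rho + r).
Let L v := v - ka *: perp e v.

Let ka_lt1 : ka < 1.
Proof. by rewrite /ka ltr_pdivrMr ?addr_gt0 // mul1r ltrDr. Qed.

Let PiT x : Kr x -> Pi x = a + L (x - a).
Proof.
move=> Kx; have [_ E] := tubular_nor Kx; rewrite PiE /L E; move: (N x) => n.
rewrite scalerA /ka divfK ?gt_eqF ?addr_gt0 //.
by apply/rowP => i; rewrite !mxE; ring.
Qed.

Let vel_L (c : R -> 'rV[R]_3) t v : vel c t v -> vel (fun s => L (c s)) t (L v).
Proof. by move=> h; exact: velB h (velZ ka (vel_perp e h)). Qed.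

Let LL v : L v *d L v = (1 - ka) ^+ 2 * (v *d v) + (1 - (1 - ka) ^+ 2) * (v *d e) ^+ 2.
Proof.
case: he => ee; rewrite /L /perp.
  by rewrite ee !dot0r !scale0r !subr0 !dotBl !dotBr !dotZl !dotZr; ring.
rewrite !dotBl !dotBr !dotZl !dotZr !dotBl !dotBr !dotZl !dotZr ee (dotC e); ring.
Qed.

Let L_bound v : `|L v| <= (1 + `|ka| * (1 + 3 * `|e| * `|e|)) * `|v|.
Proof.
apply: le_trans (ler_normB _ _) _; rewrite normrZ mulrDl mul1r lerD2l -mulrA ler_wpM2l //.
apply: le_trans (ler_normB _ _) _; rewrite normrZ mulrDl mul1r lerD2l.
apply: le_trans (ler_wpM2r (normr_ge0 e) (dot_le_norm v e)) _.
by rewrite le_eqVlt; apply/orP; left; apply/eqP; ring.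
Qed.

Let affine_cont (f : R -> 'rV[R]_3) k t : {for k * t, continuous (f : R^o -> 'rV[R]_3)} ->
  {for t, continuous ((fun t => k *: (k *: L (f (k * t)))) : R^o -> 'rV[R]_3)}.
Proof.
move=> /continuous_eps hf; apply/continuous_eps => eps eps0.
set M := 1 + `|ka| * (1 + 3 * `|e| * `|e|).
have M0 : 0 <= M by rewrite addr_ge0 // mulr_ge0 // addr_ge0 // !mulr_ge0.
have D0 : 0 < `|k| * `|k| * M + 1 by rewrite ltr_wpDl // !mulr_ge0.
have [d d0 hd] := hf _ (divr_gt0 eps0 D0).
have k1 : 0 < `|k| + 1 by rewrite ltr_wpDl.
exists (d / (`|k| + 1)); first by rewrite divr_gt0.
move=> s; rewrite ltr_pdivlMr // => sd.
have kst : `|k * s - k * t| < d.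
  by rewrite -mulrBr normrM; have := normr_ge0 (s - t); lra.
have := hd _ kst; rewrite ltr_pdivlMr // => h.
have -> : k *: (k *: L (f (k * s))) - k *: (k *: L (f (k * t))) = k *: (k *: L (f (k * s) - f (k * t))).
  rewrite /L (perpB e (f _)); move: (perp e _) (perp e _) => b b'.
  by apply/rowP => i; rewrite !mxE; ring.
rewrite !normrZ; apply: le_lt_trans h.
have : `|k| * (`|k| * `|L (f (k * s) - f (k * t))|) <= `|k| * (`|k| * (M * `|f (k * s) - f (k * t)|)).
  by rewrite !ler_wpM2l // L_bound.
by have := normr_ge0 (f (k * s) - f (k * t)); lra.
Qed.

(** [sg] is the constant speed of the image, so dividing the parameter by [sg] gives arc length and
    [phi] is multiplied by it. [L] is self-adjoint and maps vectors orthogonal to the normal to such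
    vectors, so the image of a normal acceleration is normal. *)
Lemma tubular_preserves : preserves_geodesics Kr K0 Pi.
Proof.
move=> I g [oI [J [s [phi [[oJ sC2 sK s1 sacc] [phic [phid phiC]] phi0 phiJ gs]]]]].
split=> //.
pose s' : R -> 'rV[R]_3 := derive1 s; pose s'' : R -> 'rV[R]_3 := derive1n 2 s.
have vs (u : R) : J u -> vel s u (s' u).
  by move=> Ju; apply: derivable_vel; case: sC2 => _ [/(_ u 1 Ju)].
have s'E : s' = 'D_1 (s : R^o -> 'rV[R]_3) by apply/funext => x; exact: derive1E.
have vs' (u : R) : J u -> vel s' u (s'' u).
  move=> Ju; have ds : derivable (s' : R^o -> 'rV[R]_3) u 1.
    by rewrite s'E; case: sC2 => _ [_ /(_ 1)[_ [/(_ u 1 Ju)]]].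
  exact: derivable_vel ds.
have cs'' (u : R) : J u -> {for u, continuous (s'' : R^o -> 'rV[R]_3)}.
  move=> Ju; have -> : s'' = 'D_1 (s' : R^o -> 'rV[R]_3) by apply/funext => x; exact: derive1E.
  by rewrite s'E; case: sC2 => _ [_ /(_ 1)[_ [_ /(_ 1)[/(_ u Ju)]]]].
clear s'E.
have s'1 (u : R) : J u -> s' u *d s' u = 1 by move=> Ju; apply/enorm_unit/s1.
have {}sacc (u : R) v : J u -> tangent Kr (s u) v -> s'' u *d v = 0 by exact: sacc.
clearbody s'' s'.
have nJ (u : R) : J u -> exists2 d, 0 < d & forall t, `|t - u| < d -> J t.
  by move=> Ju; apply/(nbhs_eps (u : R^o)); apply: open_nbhs_nbhs; split=> //; case: oJ.
have s'N (u : R) : J u -> s' u *d N (s u) = 0.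
  move=> Ju; have [d d0 hd] := nJ u Ju.
  apply: (tangent_nor r_gt0 K0_convex Kr_outside dist (sK u Ju)).
  exists (fun t => s (1 * t + u)); split.
  - by rewrite mulr0 add0r.
  - apply/(nbhs_eps (0 : R^o)); exists d => // t; rewrite subr0 => td; apply/sK/hd.
    by rewrite mul1r addrK.
  - apply: vel_is_derive; rewrite -[s' u]scale1r; apply: vel_affine.
    by rewrite mulr0 add0r; exact: vs.
have s''N (u : R) v : J u -> v *d N (s u) = 0 -> s'' u *d v = 0.
  move=> Ju vN; have [->|v0] := eqVneq v 0; first by rewrite dot0r.
  rewrite -(normalizeK v0) dotZr (sacc _ _ Ju) ?mulr0 //.
  apply: tangent_of_normal; [exact: sK | exact: normalize_unit | by rewrite dotZl vN mulr0].
have s''e (u : R) : J u -> s'' u *d e = 0.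
  by move=> Ju; apply: s''N => //; rewrite dotC; have [] := tubular_nor (sK u Ju).
have [u0 Ju0] : J !=set0 by case: oJ.
have cst (u v : R) : J u -> J v -> u < v -> s' u *d e = s' v *d e.
  move=> Ju Jv uv; have iJ : is_interval J by case: oJ.
  have [t ht] := @mean_value R (fun t => s' t *d e) (fun=> 0) u v uv (fun t ht =>
    eq_ind _ (fun x : R => vel (fun t => s' t *d e : R^o) t x)
      (vel_dotl e (vs' t (iJ _ _ Ju Jv t ht))) _ (s''e t (iJ _ _ Ju Jv t ht))).
  by rewrite mulr0 => /eqP; rewrite subr_eq0 => /eqP.
have {}cst (u : R) : J u -> s' u *d e = s' u0 *d e.
  move=> Ju; have [uu|uu|->//] := ltgtP u u0; first exact: cst.
  by apply/esym; exact: cst.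
pose sg := enorm (L (s' u0)).
have Lsg (u : R) : J u -> L (s' u) *d L (s' u) = sg ^+ 2.
  by move=> Ju; rewrite /sg enorm2 (LL (s' u)) (LL (s' u0)) (cst u Ju) (s'1 u Ju) (s'1 u0 Ju0).
have sg0 : 0 < sg.
  rewrite /sg sqrtr_gt0 (LL (s' u0)) (s'1 u0 Ju0) mulr1.
  have k1 : 0 < (1 - ka) ^+ 2 by rewrite exprn_gt0 // subr_gt0.
  have e1 : (s' u0 *d e) ^+ 2 <= 1.
    case: he => ee; first by rewrite ee dot0r expr0n ler01.
    by have := cauchy_schwarz (s' u0) e; rewrite ee (s'1 u0 Ju0) mulr1.
  have e2 := sqr_ge0 (s' u0 *d e).
  move: ((1 - ka) ^+ 2) (_ ^+ 2) k1 e1 e2 => X E X0 E1 E0.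
  nra.
pose c t := a + L (s (sg^-1 * t) - a).
pose w t := sg^-1 *: L (s' (sg^-1 * t)).
pose acc t := sg^-1 *: (sg^-1 *: L (s'' (sg^-1 * t))).
have LZ k v : L (k *: v) = k *: L v.
  by rewrite /L perpZ; move: (perp e v) => b; apply/rowP => i; rewrite !mxE; ring.
have lin t : vel (fun t => sg^-1 * t : R^o) t sg^-1.
  by have := velZ sg^-1 (vel_id t); rewrite [_ *: _]mulr1.
have vc t : J (sg^-1 * t) -> vel c t (w t).
  move=> Jt; have := vel_L (velB (vel_chain (lin t) (vs _ Jt)) (vel_cst a t)).
  by rewrite subr0 LZ => /(velD (vel_cst a t)); rewrite add0r.
have vw t : J (sg^-1 * t) -> vel w t (acc t).
  move=> Jt; have := velZ sg^-1 (vel_L (vel_chain (lin t) (vs' _ Jt))).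
  by rewrite LZ.
have sgK t : sg^-1 * (sg * t) = t by rewrite mulKf // gt_eqF.
have near_c t : J (sg^-1 * t) -> exists2 d, 0 < d & forall t', `|t' - t| < d -> J (sg^-1 * t').
  move=> /nJ[d d0 hd]; exists (sg * d); first by rewrite mulr_gt0.
  move=> t' td; apply: hd; rewrite -mulrBr normrM gtr0_norm ?invr_gt0 //.
  by rewrite -ltr_pdivlMl ?invr_gt0 // invrK.
have oJ' : open_interval [set t | J (sg^-1 * t)].
  have [_ iJ _] := oJ; split.
  - by rewrite openE => t /= /near_c[d d0 hd]; apply/(nbhs_eps (t : R^o)); exists d.
  - move=> x y /= Jx Jy z /andP[xz zy]; apply: (iJ _ _ Jx Jy).
    by rewrite !ler_pM2l ?invr_gt0 // xz.
  - by exists (sg * u0); rewrite /= sgK.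
have vphi t : I t -> vel (phi : R -> R^o) t (derive1 phi t).
  by move=> It; apply: derivable_vel; exact: phid.
exists [set t | J (sg^-1 * t)], c, (fun t => sg * phi t); split.
- split; first exact: oJ'.
  + apply: (Ck2_vel _ vc vw); first by case: oJ'.
    by move=> t Jt; apply: affine_cont (cs'' _ Jt).
  + by move=> t Jt; rewrite /c -PiT; [exact/Pi_in/sK | exact: sK].
  + move=> t Jt; rewrite (vel_derive1 (vc t Jt)); apply/enorm_unit.
    by rewrite /w dotZl dotZr Lsg //; field; rewrite gt_eqF.
  + move=> t v Jt /tangent_tube; have Kx := sK _ Jt; have [Ne Nx] := tubular_nor Kx.
    have eN : e *d N (s (sg^-1 * t)) = 0 by rewrite dotC.
    have cE : perp e (c t - a) = rho *: N (s (sg^-1 * t)).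
      rewrite /c -PiT // PiE addrAC (perpB e (_ - a)) Nx perpZ perp_id // -scalerBl.
      by rewrite addrK.
    rewrite cE dotZr => /eqP; rewrite mulf_eq0 (gt_eqF rho0) /= => /eqP vN.
    have [d d0 hd] := near_c t Jt.
    have v2 : vel (derive1 c) t (acc t).
      by apply: (vel_near d0 _ (vw t Jt)) => t' /hd/vc/vel_derive1.
    rewrite (vel_derive1 v2 : derive1 (derive1 c) t = acc t) /acc !dotZl.
    have adj x : L x *d v = x *d L v by rewrite /L /perp !dotE !mxE; ring.
    rewrite adj (s''N _ _ Jt) ?mulr0 //.
    by rewrite /L /perp dotBl (dotZl ka) dotBl dotZl vN eN; ring.
- by apply: Ck1_scale; [case: oI | split].
- move=> t It; rewrite (vel_derive1 (velZ sg (vphi t It))).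
  by rewrite mulf_neq0 ?phi0 // gt_eqF.
- apply/seteqP; split=> [_ [t It <-]|t /=]; first by rewrite /= sgK -phiJ; exists t.
  rewrite -phiJ => -[t' It' E]; exists t' => //.
  by rewrite E mulVKf // gt_eqF.
- move=> t It; have Js : J (phi t) by rewrite -phiJ; exists t.
  by rewrite /= gs // /c sgK PiT //; exact: sK.
Qed.

End Tubular.
End Corollary.

Unset Implicit Arguments.

Theorem corollary1p3 (R : realType) (r : R) (C0 K0 Kr : set 'rV[R]_3)
    (r_gt0 : 0 < r)
    (K0_C2 : C2_surface K0) (Kr_C2 : C2_surface Kr)
    (K0_complete : complete_subset K0) (Kr_complete : complete_subset Kr)
    (K0_connected : connected K0) (Kr_connected : connected Kr)
    (K0_convex : bounds_convex_body K0 C0) (Kr_convex : convex_surface Kr)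
    (Kr_outside : Kr `&` C0 = set0)
    (K0Kr_dist : regular_constant_distance Kr K0 r)
    (K0_not_plane : ~ plane K0) :
  preserves_geodesics Kr K0 (projection K0) <->
  (sphere K0 /\ sphere Kr) \/ (round_cylinder K0 /\ round_cylinder Kr).
Proof.
have [Cr Kr_body] := Kr_convex; have [bC0 K0E] := K0_convex.
have K0_n0 : boundary C0 !=set0 by rewrite -K0E; case: K0_C2.
split=> [pres|[[sK0 _]|[cK0 _]]].
- exact: (preserving_shape r_gt0 Kr_C2 K0_connected Kr_connected K0_convex Kr_body Kr_outside K0Kr_dist
    pres K0_not_plane).
- have [a [rho [rho0 K0T]]] := sphere_tube sK0.
  exact: (tubular_preserves r_gt0 Kr_C2 K0_convex Kr_outside K0Kr_dist (or_introl erefl) rho0 K0T).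
- have [|a [e [rho [ee rho0 K0T]]]] := round_cylinder_tube bC0 K0_n0; first by rewrite -K0E.
  rewrite -K0E in K0T.
  exact: (tubular_preserves r_gt0 Kr_C2 K0_convex Kr_outside K0Kr_dist (or_intror ee) rho0 K0T).
Qed.
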